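(* Let $\Pi_\infty$ be a partially exchangeable random partition of $\mathbb{N}=\{1,2,\ldots\}$ with ranked frequencies $(P^{\downarrow}_j)$. For each $n=0,1,2,\ldots$ let $\Pi_\infty^{(n)}$ be the random partition of $\mathbb{N}$ obtained by restricting $\Pi_\infty$ to $\{n+1,n+2,\ldots\}$ and subtracting $n$ from each element, let $p^{(n)}$ be the PEPPF of $\Pi_\infty^{(n)}$ (so $p=p^{(0)}$ is the PEPPF of $\Pi_\infty$), and let $(P^{(n)}_j)_{j\ge 1}$ be the frequencies of clusters of $\Pi_\infty$ listed in the order of appearance of these clusters in $\Pi_\infty^{(n)}$. Then: (1) As $n\to\infty$, the distribution of $\Pi_\infty^{(n)}$ converges weakly to that of the exchangeable random partition $\widetilde{\Pi}_\infty$ of $\mathbb{N}$ with ranked frequencies $(P^{\downarrow}_j)$, meaning that $p^{(n)}(n_1,\ldots,n_k)$ converges to $p^{(\infty)}(n_1,\ldots,n_k)$ for every composition $(n_1,\ldots,n_k)$ of a positive integer, where $p^{(\infty)}$ is the EPPF of $\widetilde{\Pi}_\infty$. (2) As $n\to\infty$, the finite dimensional distributions of $(P^{(n)}_j)_{j\ge1}$ converge weakly to those of $(P_j)_{j\ge 1}$, the list of frequencies in order of appearance of clusters of an exchangeable random partition of $\mathbb{N}$ with ranked frequencies $(P^{\downarrow}_j)$; when $(P^{\downarrow}_j)$ is proper, i.e. $\sum_j P^{\downarrow}_j=1$ almost surely, this $(P_j)$ is (in distribution) a size-biased random permutation of $(P^{\downarrow}_j)$, or of $(P^{(n)}_j)$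 for any fixed $n$. (3) $\Pi_\infty$ is exchangeable if and only if the partition-valued process $(\Pi_\infty^{(n)})_{n\ge0}$ is stationary, meaning that $\Pi_\infty^{(n)}$ has the same distribution as $\Pi_\infty$ for $n=1$, hence for all $n\ge1$; or, equivalently, if and only if $p^{(n)}=p$ for $n=1$, hence for all $n\ge 1$.
   Context: Write $[n]=\{1,\ldots,n\}$. A random partition $\Pi_\infty$ of $\mathbb{N}$ is identified with the sequence $(\Pi_n)$ of its restrictions to $[n]$, each $\Pi_n$ being a random element of the finite set of partitions of $[n]$. The blocks of a partition are called clusters. Clusters are in order of appearance if they are listed in increasing order of their least elements. $\Pi_\infty$ is exchangeable if for each $n$ the distribution of $\Pi_n$ is invariant under the natural action of permutations of $[n]$ on partitions of $[n]$. $\Pi_\infty$ is partially exchangeable if there is a function $p$ of compositions (finite sequences $(n_1,\ldots,n_k)$ of positive integers, a composition of $n=\sum_i n_i$) such that for each $n$ and each partition $\{C_1,\ldots,C_k\}$ of $[n]$ with clusters $C_1,\ldots,C_k$ in order of appearance, $$\mathbb{P}(\Pi_n=\{C_1,\ldots,C_k\})=p(\#C_1,\ldots,\#C_k).$$ Then $p$ is called the partially exchangeable partition probability function (PEPPF) of $\Pi_\infty$. $\Pi_\infty$ is exchangeable iff it is partially exchangeable with $p(n_1,\ldots,n_k)$ a symmetric function of its $k$ arguments for each $k$; then $p$ is called an EPPF. If $\Pi_\infty$ is partially exchangeable then so is $\Pi_\infty^{(n)}$ for every $n\ge 0$. Every cluster $\mathcal{C}$ of a partially exchangeable random partition of $\mathbb{N}$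 has an almost sure limiting relative frequency $\lim_{n}\#(\mathcal{C}\cap[n])/n$, which is almost surely $0$ iff the cluster is a singleton. ''Frequencies'' of clusters means these limits; if there are only finitely many clusters, the sequence of frequencies is continued by zeros. The ranked frequencies $(P^{\downarrow}_j)$ are these frequencies rearranged in weakly decreasing order (a random sequence with $P^{\downarrow}_1\ge P^{\downarrow}_2\ge\cdots\ge0$ and $\sum_jP^{\downarrow}_j\le1$). By Kingman's theory, the law of an exchangeable random partition of $\mathbb{N}$ is determined by the law of its ranked frequencies. ''The exchangeable random partition with ranked frequencies $(P^{\downarrow}_j)$'' is the one (unique in law) whose ranked frequencies have the distribution of $(P^{\downarrow}_j)$. It can be generated by the relation $m\sim n$ iff $X_m=X_n$ where, given a random probability distribution $F$ on $\mathbb{R}$ whose atoms have ranked sizes $(P^{\downarrow}_j)$, the $X_n$ are i.i.d. with distribution $F$. A size-biased random permutation of a proper random sequence $(Q_j)$ ($Q_j\ge0$, $\sum_jQ_j=1$) is $(Q_{J_1},Q_{J_2},\ldots)$ where, given $(Q_j)$, the indices $J_1,J_2,\ldots$ are drawn successively without replacement, with $\mathbb{P}(J_{i+1}=j\mid J_1,\ldots,J_i,(Q_j))=Q_j/(1-Q_{J_1}-\cdots-Q_{J_i})$ for $j\notin\{J_1,\ldots,J_i\}$ (continued by zeros once all positive terms have been drawn). *)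

(* Defs.v *)
From HB Require Import structures.
From mathcomp Require Import all_boot all_order all_algebra all_fingroup.
From mathcomp Require Import all_classical all_reals all_analysis.

Set Implicit Arguments.
Unset Strict Implicit.
Unset Printing Implicit Defensive.

Import Order.TTheory GRing.Theory Num.Theory.
Import numFieldNormedType.Exports.

(* Indices are 0-based throughout: the element i of nat stands for the element
   i + 1 of N = {1, 2, ...}, so that 'I_n stands for [n]. *)

(* A partition of N is given by the relation same cluster. *)
Record npart0 := NPart {
  same_cluster :> rel nat;
  same_cluster_equiv : equivalence_rel same_cluster }.

Fact same_cluster_all_equiv : equivalence_rel (fun _ _ : nat => true).
Proof. by []. Qed.

HB.instance Definition _ := gen_eqMixin npart0.
HB.instance Definition _ := gen_choiceMixin npart0.
HB.instance Definition _ := isPointed.Build npart0 (NPart same_cluster_all_equiv).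

Definition restriction (n : nat) (pi : npart0) : {set {set 'I_n}} :=
  equivalence_partition (fun i j : 'I_n => pi i j) [set: 'I_n].

Fact tail_equiv (n : nat) (pi : npart0) :
  equivalence_rel (fun i j : nat => pi (n + i) (n + j)).
Proof. by move=> x y z; exact: same_cluster_equiv. Qed.

(* Restriction to {n+1, n+2, ...}, followed by subtraction of n. *)
Definition tail0 (n : nat) (pi : npart0) : npart0 := NPart (tail_equiv n pi).

Definition act_partition (n : nat) (s : 'S_n) (S : {set {set 'I_n}}) :
  {set {set 'I_n}} := [set s @: C | C : {set 'I_n} in S].

(* For nonempty A and B this says min A < min B. *)
Definition appears_before (n : nat) (A B : {set 'I_n}) : bool :=
  [exists i in A, [forall j in B, (i < j)%N]].

Definition clusters_in_order (n : nat) (C : seq {set 'I_n}) : bool :=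
  finset.partition [set:: C] [set: 'I_n] && sorted (@appears_before n) C.

(* Compositions of a positive integer. *)
Definition composition (c : seq nat) : bool := (c != [::]) && (0%N \notin c).

Local Open Scope classical_set_scope.
Local Open Scope ring_scope.

(* The sigma-algebra on partitions of N generated by the restrictions to the
   sets [n]; a random partition is a random variable with values in npart. *)
Definition restriction_events : set (set npart0) :=
  [set A | exists (n : nat) (S : {set {set 'I_n}}),
             A = [set pi | restriction n pi = S]].
Definition npart := g_sigma_algebraType restriction_events.

Definition tail (n : nat) (pi : npart) : npart := tail0 n pi.

(* Generators of the product sigma-algebra. *)
Definition coord_events (R : realType) : set (set (nat -> R)) :=
  [set A | exists (i : nat) (B : set R),
             measurable B /\ A = [set x | B (x i)]].
Definition realseq (R : realType) := g_sigma_algebraType (@coord_events R).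

Definition eq_law (R : realType) (d d' dE : measure_display)
    (T : measurableType d) (T' : measurableType d') (E : measurableType dE)
    (P : probability T R) (X : T -> E) (P' : probability T' R) (X' : T' -> E) :=
  forall A : set E, measurable A -> P (X @^-1` A) = P' (X' @^-1` A).

Definition exchangeable (R : realType) (d : measure_display)
    (T : measurableType d) (P : probability T R) (Pi : T -> npart) :=
  forall (n : nat) (s : 'S_n) (S : {set {set 'I_n}}),
    P [set w | act_partition s (restriction n (Pi w)) = S] =
    P [set w | restriction n (Pi w) = S].

Definition is_peppf (R : realType) (d : measure_display)
    (T : measurableType d) (P : probability T R) (Pi : T -> npart)
    (p : seq nat -> R) :=
  forall (n : nat) (C : seq {set 'I_n}), clusters_in_order C ->
    P [set w | restriction n (Pi w) = [set:: C]%SET] =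
    (p [seq #|pred_of_set A| | A <- C])%:E.

Definition partially_exchangeable (R : realType) (d : measure_display)
    (T : measurableType d) (P : probability T R) (Pi : T -> npart) :=
  exists p : seq nat -> R, is_peppf P Pi p.

(* The PEPPF; it is determined by the law of Pi on compositions only, and has no
   meaning on sequences with a zero entry. *)
Definition peppf (R : realType) (d : measure_display)
    (T : measurableType d) (P : probability T R) (Pi : T -> npart) :
  seq nat -> R := xget (fun=> 0) [set p | is_peppf P Pi p].

Definition eq_on_compositions (R : realType) (p q : seq nat -> R) :=
  forall c, composition c -> p c = q c.

(* Limiting relative frequency of the cluster containing i. *)
Definition cluster_freq (R : realType) (pi : npart) (i : nat) : R :=
  limn (fun m : nat => (count (same_cluster pi i) (iota 0 m))%:R / m%:R : R).

Definition least_in_cluster (pi : npart) (i : nat) : bool :=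
  all (fun l => ~~ same_cluster pi l i) (iota 0 i).

(* Is i the least element of the (j+1)-st cluster in order of appearance? *)
Definition starts_cluster (pi : npart) (j i : nat) : bool :=
  least_in_cluster pi i && (count (least_in_cluster pi) (iota 0 i) == j).

(* None if there are at most j clusters. *)
Definition cluster_start (pi : npart) (j : nat) : option nat :=
  if pselect (exists i, starts_cluster pi j i) is left ex
  then Some (ex_minn ex) else None.

(* Frequencies of the clusters of pi, in the order of appearance of these
   clusters in tail n pi, continued by zeros. *)
Definition appearance_freq (R : realType) (n : nat) (pi : npart) : realseq R :=
  fun j => if cluster_start (tail n pi) j is Some i
           then cluster_freq R pi (n + i) else 0.

(* y lists in weakly decreasing order the positive terms of x, with their
   multiplicities, and continues by zeros if these are finitely many. *)
Definition is_ranking (R : realType) (x y : nat -> R) :=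
  [/\ forall j, 0 <= y j,
      forall i j : nat, (i <= j)%N -> y j <= y i &
      forall t : R, 0 < t -> ([set j | x j = t] #= [set j | y j = t])%card ].

Definition ranked_freq (R : realType) (pi : npart) : realseq R :=
  xget (fun=> 0) [set y | is_ranking (appearance_freq R 0 pi) y].

(* Weak convergence of the finite dimensional distributions of X n, under P, to
   those of Y, under P'. *)
Definition fdd_weak_cvg (R : realType) (d d' : measure_display)
    (T : measurableType d) (T' : measurableType d')
    (P : probability T R) (X : nat -> T -> realseq R)
    (P' : probability T' R) (Y : T' -> realseq R) :=
  forall (k : nat) (f : 'rV[R]_k -> R),
    continuous f -> (exists M : R, forall x, `|f x| <= M) ->
    (fun n => \int[P]_w (f (\row_(j < k) X n w j)%R)%:E)%E @ \oo -->
      (\int[P']_w (f (\row_(j < k) Y w j)%R)%:E)%E.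

Definition proper_seq (R : realType) (x : realseq R) :=
  (forall j, 0 <= x j) /\ (\sum_(0 <= j <oo) (x j)%:E = 1)%E.

Definition drawn_mass (R : realType) (q : realseq R) (h : nat -> nat)
    (i : nat) : R := \sum_(l < i) q (h l).

(* P(J_i = j | J_0, ..., J_{i-1}, Q) = Q_j / (1 - Q_{J_0} - ... - Q_{J_{i-1}})
   on the event that j is none of J_0, ..., J_{i-1} and that the denominator is
   positive; the conditional probability is spelled out by integration over the
   events {Q \in B, J_0 = h_0, ..., J_{i-1} = h_{i-1}}. *)
Definition size_biased_draws (R : realType) (d : measure_display)
    (T : measurableType d) (P : probability T R)
    (Q : T -> realseq R) (J : nat -> T -> nat) :=
  forall (i : nat) (h : nat -> nat) (j : nat) (B : set (realseq R)),
    measurable B -> (forall l, (l < i)%N -> h l <> j) ->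
    let E := [set w | [/\ B (Q w), forall l, (l < i)%N -> J l w = h l &
                          drawn_mass (Q w) h i < 1] ] in
    P (E `&` [set w | J i w = j]) =
    (\int[P]_(w in E) (Q w j / (1 - drawn_mass (Q w) h i))%:E)%E.

(* Once the drawn mass is 1, all positive terms have been drawn; the indices
   J i are irrelevant from then on. *)
Definition size_biased_perm (R : realType) (d : measure_display)
    (T : measurableType d) (P : probability T R)
    (Q : {RV P >-> realseq R}) (S : T -> realseq R) :=
  {ae P, forall w, proper_seq (Q w)} /\
  exists J : nat -> {RV P >-> nat},
    size_biased_draws P Q J /\
    forall w i, S w i = if drawn_mass (Q w) (fun l => J l w) i < 1
                        then Q w (J i w) else 0.

(* Main.v *)
Require Import Defs.
From HB Require Import structures.
From mathcomp Require Import all_boot all_order all_algebra all_fingroup.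
From mathcomp Require Import all_classical all_reals all_analysis.
From mathcomp Require Import measurable_realfun.
From mathcomp Require Import zify lra.

(** The proof works with the law [mu] of the partition. A partially
    exchangeable law is a law invariant under the swaps of two neighbours
    [b], [b.+1] that do not both start a cluster ([peppf_pexch],
    [pexch_peppf]): these swaps generate all the rearrangements of a partition
    that keep its cluster sizes in order of appearance.

    Once [l] is older than [b], the indicators that [b], [b.+1], ... join the
    cluster of [l] form an exchangeable sequence. A second moment computation
    shows that their averages converge ([pexch_cvg]), and averaging gives the
    prediction rule on which everything rests ([pexch_freq]): given the past and
    the frequencies, [b] joins the cluster of [l] with probability the frequency
    of this cluster. Shift the partition by [n] and ask that the blocks of a
    partition [S] of a finite set lie inside clusters. Unless one of finitely
    many late elements starts a cluster that another one joins, which becomes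
    unlikely as the probabilities of such pairs are summable ([cvg_pair_prob]),
    the elements join older clusters. The prediction rule, applied to one element at
    a time, shows that the probability converges to the expected product of the
    power sums of the frequencies with the sizes of the blocks as exponents
    ([coarser_tail_cvg]). This limit depends on the ranked frequencies only.
    For a stationary law the sequence is constant, so an exchangeable law with
    the same ranked frequencies has exactly these probabilities, and Moebius
    inversion ([restriction_cvg]) yields the convergence of the PEPPFs. The limit
    being symmetric in the blocks, a stationary partially exchangeable law is
    exchangeable ([stationary_exch]); the converse is an invariance under
    cyclic permutations, and PEPPFs determine laws ([peppf_law]).

    For the frequencies in order of appearance, which are not continuous in the
    partition, it is enough to approximate them by empirical frequencies, which
    depend on a restriction, uniformly over all partially exchangeable laws
    ([emp_app_uniform]); indeed a late element is unlikely to start one of the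
    first [j] clusters, with a bound that does not depend on the law.

    For the size-biased permutation, weight a sequence [x] by the product
    [discovery k x] of the factors [1 - x_0 - ... - x_(l-1)], for [l < k]. For
    successive size-biased draws this weight cancels the denominators, and for a
    stationary partition it is the conditional probability that [k] new elements
    lie in [k] distinct clusters. In both cases the weighted law of the first
    [k] terms is compared with the law of [k] independent draws that happen
    to be distinct, a sum over tuples of terms that does not see their order
    ([discovery_ge], [discovery_le], [tuple_sum_rearr]). Dividing by the weight
    gives an inequality between the laws of the first [k] terms, hence an
    equality, by induction on [k] ([discovery_law_ext]). *)

Set Implicit Arguments.
Unset Strict Implicit.
Unset Printing Implicit Defensive.

Import Order.TTheory GRing.Theory Num.Theory.
Import numFieldNormedType.Exports.

Local Open Scope classical_set_scope.
Local Open Scope ring_scope.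

(** * Bounded measurable functions and their expectations *)

Section BoundedExpectation.
Context (R : realType) (d : measure_display) (T : measurableType d).
Implicit Types (f g : T -> R) (A : set T) (b : T -> bool).

(** Expectations are real integrals of bounded measurable functions, so that
    linearity and monotonicity come with simple side conditions. *)
Definition bmf f := measurable_fun setT f /\ exists M, forall x, `|f x| <= M.

Lemma bmf_cst c : bmf (cst c).
Proof. by split; [exact: measurable_cst|exists `|c|]. Qed.

Lemma bmfD f g : bmf f -> bmf g -> bmf (fun x => f x + g x).
Proof.
move=> [mf [M Mf]] [mg [N Ng]]; split; first exact: measurable_funD.
by exists (M + N) => x; rewrite (le_trans (ler_normD _ _))// lerD.
Qed.

Lemma bmfM f g : bmf f -> bmf g -> bmf (fun x => f x * g x).
Proof.
move=> [mf [M Mf]] [mg [N Ng]]; split; first exact: measurable_funM.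
by exists (M * N) => x; rewrite normrM ler_pM.
Qed.

Lemma bmfN f : bmf f -> bmf (fun x => - f x).
Proof.
move=> [mf [M Mf]]; split; first exact: measurableT_comp.
by exists M => x; rewrite normrN.
Qed.

Lemma bmfB f g : bmf f -> bmf g -> bmf (fun x => f x - g x).
Proof. by move=> bf bg; apply: bmfD => //; exact: bmfN. Qed.

Lemma bmf_norm f : bmf f -> bmf (fun x => `|f x|).
Proof.
move=> [mf [M Mf]]; split; first exact: measurableT_comp.
by exists M => x; rewrite normr_id.
Qed.

Lemma bmf_exp f n : bmf f -> bmf (fun x => f x ^+ n).
Proof.
move=> bf; elim: n => [|n IH]; first exact: bmf_cst.
by under eq_fun do rewrite exprS; exact: bmfM.
Qed.

Lemma bmf_sum I (r : seq I) (Q : pred I) (F : I -> T -> R) :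
  (forall i, Q i -> bmf (F i)) -> bmf (fun x => \sum_(i <- r | Q i) F i x).
Proof.
move=> bF; elim: r => [|i r IH].
  by under eq_fun do rewrite big_nil; exact: bmf_cst.
under eq_fun do rewrite big_cons.
by case: (boolP (Q i)) => Qi //; exact: bmfD (bF _ Qi) IH.
Qed.

Lemma bmf_prod I (r : seq I) (Q : pred I) (F : I -> T -> R) :
  (forall i, Q i -> bmf (F i)) -> bmf (fun x => \prod_(i <- r | Q i) F i x).
Proof.
move=> bF; elim: r => [|i r IH].
  by under eq_fun do rewrite big_nil; exact: bmf_cst.
under eq_fun do rewrite big_cons.
by case: (boolP (Q i)) => Qi //; exact: bmfM (bF _ Qi) IH.
Qed.

Lemma bmf_bool b : measurable [set x | b x] -> bmf (fun x => (b x)%:R).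
Proof.
move=> mb; split; last by exists 1 => x; case: (b x); rewrite ?normr1 ?normr0.
rewrite (_ : (fun x => (b x)%:R) = \1_[set x | b x]).
  exact: measurable_indic.
by apply/funext => x; rewrite indicE; congr (nat_of_bool _)%:R;
  apply/idP/idP; rewrite inE.
Qed.

Lemma bmf_indic A : measurable A -> bmf (\1_A).
Proof.
move=> mA; split; first exact: measurable_indic.
by exists 1 => x; rewrite indicE; case: (_ \in _); rewrite ?normr1 ?normr0.
Qed.

Variable P : probability T R.

Lemma bmf_integrable f : bmf f -> P.-integrable setT (EFin \o f).
Proof.
move=> [mf [M Mf]]; apply: measurable_bounded_integrable => //.
  by rewrite (le_lt_trans (probability_le1 P _))// ltey.
exists M; split; first exact: num_real.
by move=> N /ltW MN x _; exact: le_trans (Mf x) MN.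
Qed.

Lemma ExD f g : bmf f -> bmf g ->
  \int[P]_x (f x + g x) = \int[P]_x f x + \int[P]_x g x.
Proof. by move=> bf bg; rewrite RintegralD//; exact: bmf_integrable. Qed.

Lemma ExB f g : bmf f -> bmf g ->
  \int[P]_x (f x - g x) = \int[P]_x f x - \int[P]_x g x.
Proof. by move=> bf bg; rewrite RintegralB//; exact: bmf_integrable. Qed.

Lemma ExZ c f : bmf f -> \int[P]_x (c * f x) = c * \int[P]_x f x.
Proof. by move=> bf; rewrite RintegralZl//; exact: bmf_integrable. Qed.

Lemma Ex_cst c : \int[P]_x c = c.
Proof.
rewrite (Rintegral_cst P measurableT) -[RHS]mulr1; congr (_ * _).
exact: (congr1 fine (probability_setT P)).
Qed.

Lemma Ex_sum I (r : seq I) (Q : pred I) (F : I -> T -> R) :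
  (forall i, Q i -> bmf (F i)) ->
  \int[P]_x (\sum_(i <- r | Q i) F i x) = \sum_(i <- r | Q i) \int[P]_x F i x.
Proof.
move=> bF; elim: r => [|i r IH].
  by under eq_Rintegral do rewrite big_nil; rewrite big_nil Ex_cst.
under eq_Rintegral do rewrite big_cons.
rewrite big_cons; case: (boolP (Q i)) => Qi //.
by rewrite ExD ?IH//; [exact: bF|exact: bmf_sum].
Qed.

Lemma Ex_le f g : bmf f -> bmf g -> (forall x, f x <= g x) ->
  \int[P]_x f x <= \int[P]_x g x.
Proof. by move=> bf bg fg; apply: le_Rintegral => //; exact: bmf_integrable. Qed.

Lemma Ex_ge0 f : (forall x, 0 <= f x) -> 0 <= \int[P]_x f x.
Proof. by move=> f0; exact: Rintegral_ge0. Qed.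

Lemma Ex_norm f : bmf f -> `|\int[P]_x f x| <= \int[P]_x `|f x|.
Proof. by move=> bf; apply: le_normr_Rintegral => //; exact: bmf_integrable. Qed.

Lemma EFin_Ex f : bmf f -> (\int[P]_x f x)%:E = (\int[P]_x (f x)%:E)%E.
Proof.
by move=> /bmf_integrable bf; rewrite /Rintegral fineK//; apply: integrable_fin_num.
Qed.

Lemma Ex_indic A : measurable A -> (\int[P]_x \1_A x)%:E = P A.
Proof.
move=> mA; rewrite EFin_Ex; last exact: bmf_indic.
by rewrite integral_indic// setIT.
Qed.

Lemma Ex_bool b : measurable [set x | b x] ->
  (\int[P]_x (b x)%:R)%:E = P [set x | b x].
Proof.
move=> mb; rewrite -Ex_indic//; congr EFin; apply: eq_Rintegral => x _.
by rewrite indicE; congr (nat_of_bool _)%:R; apply/idP/idP; rewrite inE.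
Qed.

Lemma Ex_dct (f_ : nat -> T -> R) f M :
  (forall n, measurable_fun setT (f_ n)) -> measurable_fun setT f ->
  (forall n x, `|f_ n x| <= M) -> {ae P, forall x, f_ ^~ x @ \oo --> f x} ->
  (fun n => \int[P]_x f_ n x) @ \oo --> \int[P]_x f x.
Proof.
move=> mf_ mf Mf f_f.
have h := @dominated_convergence _ _ _ P setT measurableT
  (fun n x => (f_ n x)%:E) (fun x => (f x)%:E) (fun=> M%:E).
have [|||||if_ _ cf] := h.
- by move=> n; exact/measurable_EFinP.
- exact/measurable_EFinP.
- case: f_f => N [mN N0 NC]; exists N; split=> // x /= nc; apply: NC => /= cx.
  by apply: nc => _; exact/cvg_EFin/cx/nearW.
- exact: (finite_measure_integrable_cst P).
- by exists set0; split => // x /= []; move=> n _; rewrite lee_fin.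
have fn : (\int[P]_x (f x)%:E)%E \is a fin_num by exact: integrable_fin_num if_.
rewrite -[X in _ --> X]/(fine _); apply: fine_cvg.
by rewrite fineK.
Qed.

Lemma Ex_eq_ae f g : measurable_fun setT f -> measurable_fun setT g ->
  {ae P, forall x, f x = g x} -> \int[P]_x f x = \int[P]_x g x.
Proof.
move=> mf mg fg; congr fine; apply: ae_eq_integral => //.
- exact/measurable_EFinP.
- exact/measurable_EFinP.
by case: fg => N [mN N0 NC]; exists N; split=> // x /= nc; apply: NC => /= fgx;
  apply: nc => _; rewrite fgx.
Qed.

End BoundedExpectation.

(** * Partitions of the integers and exchanges of neighbours *)

Notation starter := least_in_cluster.

Section NPart.
Implicit Types (pi rho : npart0) (x y z l : nat).

Lemma npart_refl pi x : pi x x.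
Proof. by have [] := same_cluster_equiv pi x x x. Qed.

Lemma npart_eql pi x y z : pi x y -> pi x z = pi y z.
Proof. by move=> xy; have [_ ->] := same_cluster_equiv pi x y z. Qed.

Lemma npart_sym pi x y : pi x y = pi y x.
Proof.
by apply/idP/idP => h; [rewrite -(npart_eql _ h)|rewrite -(npart_eql _ h)]; exact: npart_refl.
Qed.

Lemma npart_eqr pi x y z : pi x y -> pi z x = pi z y.
Proof. by move=> /(npart_eql z); rewrite !(npart_sym pi z). Qed.

Lemma npart_trans pi y x z : pi x y -> pi y z -> pi x z.
Proof. by move=> xy yz; rewrite -(npart_eqr x yz). Qed.

Lemma npart_ext pi rho : (forall x y, pi x y = rho x y) -> pi = rho.
Proof.
case: pi rho => [r er] [s es] /= rs.
have rsE : r = s by apply/funext => x; apply/funext => y; exact: rs.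
by subst s; congr NPart; exact: Prop_irrelevance.
Qed.

(** Equality of restrictions in terms of the relations, rather than as an
    equality between sets of sets; see [restriction_agree]. *)
Definition agree n pi rho := forall i j, (i < n)%N -> (j < n)%N -> pi i j = rho i j.

Lemma agree_sym n pi rho : agree n pi rho -> agree n rho pi.
Proof. by move=> h i j i_n j_n; rewrite h. Qed.

Lemma agreeW m n pi rho : (m <= n)%N -> agree n pi rho -> agree m pi rho.
Proof. by move=> mn h i j im jm; apply: h; lia. Qed.

Lemma in_restriction n pi (i j : 'I_n) :
  (j \in finset.pblock (restriction n pi) i) = pi i j.
Proof.
apply: (@pblock_equivalence_partition _ (fun i j : 'I_n => pi i j)) => //.
by move=> x y z _ _ _; exact: same_cluster_equiv.
Qed.

Lemma restriction_partition n pi : finset.partition (restriction n pi) [set: 'I_n].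
Proof. by apply: equivalence_partitionP => x y z _ _ _; exact: same_cluster_equiv. Qed.

Lemma restriction_agree n pi rho : restriction n pi = restriction n rho <-> agree n pi rho.
Proof.
split=> [e i j i_n j_n|e].
  by have := in_restriction pi (Ordinal i_n) (Ordinal j_n); rewrite e in_restriction.
rewrite /restriction /equivalence_partition; apply: eq_imset => x.
by apply/setP => y; rewrite !inE e.
Qed.

(* The partition whose classes are the preimages of the classes of pi. *)
Fact pull_equiv (f : nat -> nat) pi : equivalence_rel (fun i j => pi (f i) (f j)).
Proof. by move=> x y z; exact: same_cluster_equiv. Qed.
Definition pull (f : nat -> nat) pi : npart0 := NPart (pull_equiv f pi).

Lemma starterP pi x : reflect (forall l, (l < x)%N -> ~~ pi l x) (starter pi x).
Proof.
apply: (iffP allP) => h l; first by move=> lx; apply: h; rewrite mem_iota.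
by rewrite mem_iota => /andP[_ lx]; exact: h.
Qed.

Lemma starterF pi x l : starter pi x -> (l < x)%N -> pi l x = false.
Proof. by move=> /starterP h /h/negbTE. Qed.

Lemma starter_agree n pi rho x : agree n pi rho -> (x < n)%N ->
  starter pi x = starter rho x.
Proof.
move=> h xn; apply/starterP/starterP => st l lx.
  by rewrite -h ?st//; lia.
by rewrite h ?st//; lia.
Qed.

Lemma starter_inj pi x y : starter pi x -> starter pi y -> pi x y -> x = y.
Proof.
move=> sx sy xy; case: (ltngtP x y) => // [xy'|yx'].
  by rewrite (starterF sy xy') in xy.
by rewrite npart_sym (starterF sx yx') in xy.
Qed.

Definition swap (b x : nat) : nat :=
  if x == b then b.+1 else if x == b.+1 then b else x.

Lemma swapK b : involutive (swap b).
Proof. by move=> x; rewrite /swap; do !case: eqP; lia. Qed.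

Lemma swap_lt b x : (x < b)%N -> swap b x = x.
Proof. by rewrite /swap; do !case: eqP; lia. Qed.

Lemma swap_gt b x : (b.+1 < x)%N -> swap b x = x.
Proof. by rewrite /swap; do !case: eqP; lia. Qed.

Lemma swapl b : swap b b = b.+1.
Proof. by rewrite /swap eqxx. Qed.

Lemma swapr b : swap b b.+1 = b.
Proof. by rewrite /swap eqxx; case: eqP => //; lia. Qed.

Lemma swap_bound b n x : (b.+1 < n)%N -> (swap b x < n)%N = (x < n)%N.
Proof. by rewrite /swap; do !case: eqP; lia. Qed.

Lemma swap_inf b n x : (n <= b)%N -> (swap b x < n)%N = (x < n)%N.
Proof. by rewrite /swap; do !case: eqP; lia. Qed.

Definition two_starters b pi := starter pi b && starter pi b.+1.

(** Exchanging [b] and [b.+1] reverses the order of appearance of their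
    clusters exactly when both start one; in that case nothing is done. *)
Definition oswap b pi : npart0 := if two_starters b pi then pi else pull (swap b) pi.

Lemma two_startersF b pi l : two_starters b pi -> (l < b)%N ->
  pi l b = false /\ pi l b.+1 = false.
Proof. by move=> /andP[h1 h2] lb; split; apply: starterF => //; lia. Qed.

Lemma two_starters_pull b pi : two_starters b (pull (swap b) pi) = two_starters b pi.
Proof.
have aux rho : two_starters b rho -> two_starters b (pull (swap b) rho).
  move=> h; have /andP[h1 h2] := h; apply/andP; split; apply/starterP => l lb /=.
    by rewrite swapl swap_lt// (two_startersF h lb).2.
  rewrite swapr; case: (ltngtP l b) => [lb'| |->]; last 1 first.
  - by rewrite swapl npart_sym (starterF h2).
  - by rewrite swap_lt// (two_startersF h lb').1.
  - by lia.
apply/idP/idP => [/aux|/aux//]; congr two_starters.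
by apply: npart_ext => x y /=; rewrite !swapK.
Qed.

Lemma oswapK b : involutive (oswap b).
Proof.
move=> pi; rewrite {2}/oswap; case: ifPn => [h|/negbTE h]; first by rewrite /oswap h.
by rewrite /oswap two_starters_pull h; apply: npart_ext => x y /=; rewrite !swapK.
Qed.

Lemma oswap_agree b n pi rho : (b.+1 < n)%N -> agree n pi rho ->
  agree n (oswap b pi) (oswap b rho).
Proof.
move=> bn h i j i_n j_n; rewrite /oswap /two_starters !(starter_agree h)//; last lia.
by case: ifP => _ //=; rewrite h ?swap_bound.
Qed.

(** Relations to an element older than the exchanged ones are exchanged even
    when both start a cluster, as then there are none. *)
Lemma oswap_row b pi l x : (l < b)%N -> oswap b pi l x = pi l (swap b x).
Proof.
move=> lb; rewrite /oswap; case: ifPn => [h|_] /=; last by rewrite swap_lt.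
have [e1 e2] := two_startersF h lb.
by rewrite /swap; case: eqP => [->|_]; [rewrite e1 e2|case: eqP => [->|]; rewrite ?e1 ?e2].
Qed.

Lemma starter_pull_swap b pi x : (x < b)%N || (b.+1 < x)%N ->
  starter (pull (swap b) pi) x = starter pi x.
Proof.
move=> xb; have sx : swap b x = x by case/orP: xb => ?; [rewrite swap_lt|rewrite swap_gt].
have hx l : (swap b l < x)%N = (l < x)%N.
  by case/orP: xb => ?; [rewrite swap_inf//; lia|rewrite swap_bound].
apply/starterP/starterP => h l lx /=.
  by have := h (swap b l); rewrite /= swapK sx hx; exact.
by rewrite sx; apply: h; rewrite hx.
Qed.

Lemma starter_oswap b pi x : (x < b)%N || (b.+1 < x)%N ->
  starter (oswap b pi) x = starter pi x.
Proof. by move=> xb; rewrite /oswap; case: ifP => // _; exact: starter_pull_swap. Qed.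

Lemma starter_pull_swap2 b pi : ~~ two_starters b pi ->
  starter (pull (swap b) pi) b = starter pi b.+1 || (starter pi b && pi b b.+1)
  /\ starter (pull (swap b) pi) b.+1 = starter pi b && ~~ pi b b.+1.
Proof.
move=> nt; split.
  apply/idP/idP.
    move=> /starterP /= h; have {}h l : (l < b)%N -> ~~ pi l b.+1.
      by move=> lb; have := h l lb; rewrite swapl swap_lt.
    case: (boolP (pi b b.+1)) => [pb|npb].
      rewrite andbT; apply/orP; right; apply/starterP => l lb.
      by rewrite (npart_eqr l pb) h.
    apply/orP; left; apply/starterP => l; rewrite ltnS leq_eqVlt => /orP[/eqP->//|].
    exact: h.
  move=> h; apply/starterP => l lb /=; rewrite swapl swap_lt//.
  case/orP: h => [/starterF->//|/andP[/starterP h pb]]; first by lia.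
  by rewrite -(npart_eqr l pb) h.
apply/idP/idP.
  move=> /starterP /= h; rewrite swapr in h; apply/andP; split.
    by apply/starterP => l lb; have := h l; rewrite swap_lt//; apply; lia.
  by have := h b; rewrite swapl npart_sym; apply.
move=> /andP[/starterP h npb]; apply/starterP => l /=; rewrite swapr ltnS leq_eqVlt.
case/orP => [/eqP->|lb]; first by rewrite swapl npart_sym.
by rewrite swap_lt// h.
Qed.

End NPart.

(** * Events determined by a restriction *)

Section Determined.
Context (R : realType).
Implicit Types (n m b : nat) (A : set npart).

Lemma measurable_restriction n (S : {set {set 'I_n}}) :
  measurable ([set pi | restriction n pi = S] : set npart).
Proof. by apply: sub_gen_smallest; exists n, S. Qed.

Definition determined n A := forall pi rho, agree n pi rho -> A pi -> A rho.

Lemma determined_measurable n A : determined n A -> measurable A.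
Proof.
move=> dA.
rewrite (_ : A = \bigcup_(S in [set S | exists2 pi, A pi & restriction n pi = S])
    [set pi | restriction n pi = S]); last first.
  apply/seteqP; split=> [pi Api|rho [S [pi Api <-]] /=]; first by exists (restriction n pi) => //; exists pi.
  by move=> /restriction_agree e; apply: dA Api; exact: agree_sym.
apply: fin_bigcup_measurable => [|S _]; first exact: finite_finset.
exact: measurable_restriction.
Qed.

Lemma measurable_toward_npart d (T : measurableType d) (X : T -> npart) :
  (forall n (S : {set {set 'I_n}}), measurable [set x | restriction n (X x) = S]) ->
  measurable_fun setT X.
Proof.
move=> mX; apply: (@measurability _ _ T npart setT X restriction_events) => //.
by move=> _ [_ [n [S ->]] <-]; rewrite setTI; exact: mX.
Qed.

(** A restriction of the image that depends on a restriction of the argument is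
    a function on a finite set. *)
Lemma measurable_local (F : npart -> npart) :
  (forall n, exists m, forall pi rho, agree m pi rho -> agree n (F pi) (F rho)) ->
  measurable_fun setT F.
Proof.
move=> lF; apply: measurable_toward_npart => n S; have [m hm] := lF n.
apply: (@determined_measurable m) => pi rho /hm /restriction_agree /= e <-.
by rewrite e.
Qed.

Lemma measurable_pull f : measurable_fun setT (pull f : npart -> npart).
Proof.
apply: measurable_local => n; exists (\max_(i < n) (f i).+1)%N => pi rho h i j i_n j_n /=.
have fm k : (k < n)%N -> (f k < (\max_(i < n) (f i).+1)%N)%N.
  by move=> kn; apply: (@leq_bigmax _ (fun i : 'I_n => (f i).+1) (Ordinal kn)).
by apply: h; exact: fm.
Qed.

Lemma measurable_tail n : measurable_fun setT (tail n).
Proof.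
rewrite (_ : tail n = pull (addn n)); first exact: measurable_pull.
by apply/funext => pi; exact: npart_ext.
Qed.

Lemma measurable_oswap b : measurable_fun setT (oswap b : npart -> npart).
Proof.
apply: measurable_local => n; exists (maxn n b.+2) => pi rho h.
by apply: (@agreeW n (maxn n b.+2)); [lia|apply: oswap_agree => //; lia].
Qed.

Lemma measurable_same (x y : nat) : measurable ([set pi | same_cluster pi x y] : set npart).
Proof.
apply: (@determined_measurable (maxn x y).+1) => pi rho h /=.
by rewrite h//; lia.
Qed.

Lemma measurable_starter x : measurable ([set pi | starter pi x] : set npart).
Proof.
apply: (@determined_measurable x.+1) => pi rho h /=.
by rewrite (starter_agree h).
Qed.

Lemma bmf_same (x y : nat) : bmf (fun pi : npart => (same_cluster pi x y)%:R : R).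
Proof. by apply: bmf_bool; exact: measurable_same. Qed.

Lemma bmf_starter (x : nat) : bmf (fun pi : npart => (starter pi x)%:R : R).
Proof. by apply: bmf_bool; exact: measurable_starter. Qed.

(** Reduces the expectation of a function of a restriction to the finitely many
    probabilities of restrictions. *)
Lemma determined_expand n (f : npart -> R) :
  (forall pi rho, agree n pi rho -> f pi = f rho) ->
  exists c : {set {set 'I_n}} -> R,
    forall pi, f pi = \sum_S c S * (restriction n pi == S)%:R.
Proof.
move=> df; exists (fun S => f (xget point [set pi | restriction n pi = S])) => pi.
rewrite (bigD1 (restriction n pi))//= eqxx mulr1 big1 ?addr0; last first.
  by move=> S /negbTE; rewrite eq_sym => ->; rewrite mulr0.
apply: df; case: xgetP => [rho _ /= /restriction_agree/agree_sym//|/(_ pi)].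
by case.
Qed.

Lemma bmf_restriction n (S : {set {set 'I_n}}) :
  bmf (fun pi : npart => (restriction n pi == S)%:R : R).
Proof.
apply: bmf_bool; rewrite [X in measurable X](_ : _ = [set pi | restriction n pi = S]).
  exact: measurable_restriction.
by apply/seteqP; split=> pi /eqP.
Qed.

Lemma bmf_determined n (f : npart -> R) :
  (forall pi rho, agree n pi rho -> f pi = f rho) -> bmf f.
Proof.
move=> /determined_expand[c fE]; rewrite (funext fE).
by apply: bmf_sum => S _; apply: bmfM; [exact: bmf_cst|exact: bmf_restriction].
Qed.

Lemma Ex_determined (mu : probability npart R) n c (f : npart -> R) :
  (forall pi, f pi = \sum_(S : {set {set 'I_n}}) c S * (restriction n pi == S)%:R) ->
  \int[mu]_pi f pi = \sum_S c S * \int[mu]_pi (restriction n pi == S)%:R.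
Proof.
move=> /funext ->.
rewrite Ex_sum; last by move=> S _; apply: bmfM; [exact: bmf_cst|exact: bmf_restriction].
by apply: eq_bigr => S _; rewrite ExZ//; exact: bmf_restriction.
Qed.

Lemma Ex_restriction (mu : probability npart R) n (S : {set {set 'I_n}}) :
  (\int[mu]_pi (restriction n pi == S)%:R)%:E = mu [set pi | restriction n pi = S].
Proof.
have e : [set pi : npart | restriction n pi == S] = [set pi : npart | restriction n pi = S].
  by apply/seteqP; split=> pi /eqP.
by rewrite Ex_bool ?e//; exact: measurable_restriction.
Qed.

(** The events determined by a restriction are stable under intersection and
    generate the sigma-algebra; a restriction determines the smaller ones. *)
Lemma npart_law_ext N (mu nu : probability npart R) :
  (forall n (S : {set {set 'I_n}}), (N <= n)%N ->
     mu [set pi | restriction n pi = S] = nu [set pi | restriction n pi = S]) ->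
  forall A, measurable A -> mu A = nu A.
Proof.
move=> h A mA.
have hd n B : determined n B -> mu B = nu B.
  move=> dB; have mB := determined_measurable dB.
  rewrite -!Ex_indic//; have [|c cE] := @determined_expand (maxn N n) (\1_B).
    move=> pi rho /(@agreeW n) e; have {}e := e (leq_maxr _ _).
    rewrite !indicE; congr (nat_of_bool _)%:R.
    by apply/idP/idP; rewrite !inE; apply: dB => //; exact: agree_sym.
  congr EFin; rewrite !(Ex_determined _ cE); apply: eq_bigr => S _; congr (_ * _).
  by apply: EFin_inj; rewrite !Ex_restriction h// leq_maxl.
apply: (@measure_unique _ R npart [set B | exists n, determined n B] (fun=> setT)) => //.
- apply/seteqP; split=> B; last first.
    apply: smallest_sub => [|C [n]]; first exact: sigma_algebra_measurable.
    exact: determined_measurable.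
  apply: smallest_sub; first exact: smallest_sigma_algebra.
  move=> C [n [S ->]]; apply: sub_gen_smallest; exists n => pi rho.
  by move=> /restriction_agree /= ->.
- move=> B C [n dB] [m dC]; exists (maxn n m) => pi rho e [Bpi Cpi]; split.
    by apply: dB Bpi; apply: agreeW e; lia.
  by apply: dC Cpi; apply: agreeW e; lia.
- by move=> _; exists 0%N.
- by rewrite bigcup_const.
- by move=> B [n]; exact: hd.
- by move=> _; rewrite (le_lt_trans (probability_le1 _ _))// ltey.
Qed.

End Determined.

(** * Partially exchangeable laws *)

Section Laws.
Context (R : realType).

Lemma bmf_comp d d' (T : measurableType d) (E : measurableType d') (f : E -> R) (X : T -> E) :
  bmf f -> measurable_fun setT X -> bmf (f \o X).
Proof.
move=> [mf [M Mf]] mX; split; first exact: measurableT_comp.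
by exists M => x; exact: Mf.
Qed.

(** The distribution, for a map whose measurability is a hypothesis. *)
Definition law d d' (T : measurableType d) (E : measurableType d')
  (P : probability T R) (X : T -> E) (mX : measurable_fun setT X) : probability E R :=
  distribution P (mfun_Sub (mem_set mX) : {mfun T >-> E}).

Lemma lawE d d' (T : measurableType d) (E : measurableType d')
  (P : probability T R) (X : T -> E) (mX : measurable_fun setT X) A :
  law P mX A = P (X @^-1` A).
Proof. by []. Qed.

Lemma Ex_law d d' (T : measurableType d) (E : measurableType d')
  (P : probability T R) (X : T -> E) (mX : measurable_fun setT X) (f : E -> R) :
  bmf f -> \int[law P mX]_y f y = \int[P]_x f (X x).
Proof.
move=> bf; congr fine; rewrite integral_pushforward//.
- by apply/measurable_EFinP; case: bf.
- exact: (bmf_integrable P (bmf_comp bf mX)).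
Qed.

Lemma eq_law_Ex d d' dE (T : measurableType d) (T' : measurableType d') (E : measurableType dE)
  (P : probability T R) (X : T -> E) (P' : probability T' R) (X' : T' -> E)
  (mX : measurable_fun setT X) (mX' : measurable_fun setT X') (f : E -> R) :
  bmf f -> eq_law P X P' X' -> \int[P]_x f (X x) = \int[P']_x f (X' x).
Proof.
move=> bf e; rewrite -(Ex_law P mX)// -(Ex_law P' mX')//; congr fine.
by apply: eq_measure_integral => A mA _; exact: e.
Qed.

End Laws.

Section PartialExchangeability.
Context (R : realType).
Implicit Types (mu : probability npart R) (Phi f : npart -> R).

(** Partial exchangeability of a law, without reference to a PEPPF; see
    [peppf_pexch] and [pexch_peppf]. *)
Definition pexch mu := forall b (A : set npart), measurable A -> mu ((oswap b : npart -> npart) @^-1` A) = mu A.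

Lemma pexch_Ex mu b f : pexch mu -> bmf f ->
  \int[mu]_pi f (oswap b pi) = \int[mu]_pi f pi.
Proof.
move=> pe bf; apply: (eq_law_Ex (X := (oswap b : npart -> npart)) (X' := id) _ _ bf).
- exact: measurable_oswap.
- exact: measurable_id.
by move=> A mA; exact: pe.
Qed.

(** These functions play the role of functions of the partition before [a] and
    of the limiting frequencies: later elements may be exchanged. *)
Definition fixed_from a Phi := forall y pi, (a <= y)%N -> Phi (oswap y pi) = Phi pi.

Lemma fixed_fromW a b Phi : (a <= b)%N -> fixed_from a Phi -> fixed_from b Phi.
Proof. by move=> ab h y pi yb; apply: h; lia. Qed.

Lemma fixed_fromM a f g : fixed_from a f -> fixed_from a g -> fixed_from a (fun pi => f pi * g pi).
Proof. by move=> hf hg y pi ay; rewrite hf ?hg. Qed.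

Lemma fixed_from_same a (l x : nat) : (l < a)%N -> (x < a)%N ->
  fixed_from a (fun pi : npart => (same_cluster pi l x)%:R).
Proof.
by move=> la xa y pi ay; rewrite oswap_row ?swap_lt//; lia.
Qed.

Lemma fixed_from_starter a x : (x < a)%N ->
  fixed_from a (fun pi : npart => (starter pi x)%:R).
Proof. by move=> xa y pi ay; rewrite starter_oswap//; lia. Qed.

(** The swaps of the elements from [a] on act on the row of the older element [l]
    even where they leave the partition unchanged, as no element that starts a
    cluster is in the cluster of [l]. *)
Lemma pexch_row mu Phi (l a y : nat) : pexch mu -> bmf Phi -> fixed_from a Phi ->
  (l < a)%N -> (a <= y)%N ->
  \int[mu]_pi (Phi pi * (same_cluster pi l y)%:R) =
  \int[mu]_pi (Phi pi * (same_cluster pi l a)%:R).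
Proof.
move=> pe bP hP la; elim: y => [|y IH]; first by rewrite leqn0 => /eqP ->.
rewrite leq_eqVlt => /orP[/eqP -> //|ay]; rewrite -IH//.
rewrite -(pexch_Ex y pe); last by apply: bmfM => //; exact: bmf_same.
apply: eq_Rintegral => pi _; rewrite hP; last by lia.
by rewrite oswap_row ?swapr//; lia.
Qed.

Lemma tail_pull_swap n b (pi : npart0) :
  tail0 n (pull (swap (n + b)) pi) = pull (swap b) (tail0 n pi).
Proof.
apply: npart_ext => x y /=.
by have e z : swap (n + b) (n + z) = (n + swap b z)%N; [rewrite /swap; do !case: eqP; lia|rewrite !e].
Qed.

Lemma starter_tail n (pi : npart0) x : starter pi (n + x) -> starter (tail0 n pi) x.
Proof. by move=> /starterP h; apply/starterP => l lx; apply: h; lia. Qed.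

(** If [n + b] and its successor both start clusters of the partition, they do so
    in its tail, where nothing is then exchanged; on the other event a swap of
    the tail is a swap of the partition. *)
Lemma pexch_tail mu n : pexch mu -> pexch (law mu (measurable_tail n)).
Proof.
move=> pe b A mA; change (mu (tail n @^-1` ((oswap b : npart -> npart) @^-1` A)) = mu (tail n @^-1` A)).
have mo : measurable ((oswap b : npart -> npart) @^-1` A).
  by rewrite -[X in measurable X]setTI; exact: measurable_oswap.
have mt B : measurable B -> measurable (tail n @^-1` B).
  by move=> mB; rewrite -[X in measurable X]setTI; exact: measurable_tail.
rewrite -!Ex_indic; [|exact: mt..]; congr EFin.
pose g (pi : npart) : R := (~~ two_starters b (tail n pi))%:R.
have bg : bmf g.
  apply: (@bmf_determined _ (n + b.+2)) => pi rho e; rewrite /g; congr (~~ _)%:R.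
  have h : agree b.+2 (tail n pi) (tail n rho) by move=> i j i_n j_n /=; apply: e; lia.
  by rewrite /two_starters !(starter_agree h).
pose h (pi : npart) : R := \1_(tail n @^-1` (oswap b @^-1` A)) pi.
pose k (pi : npart) : R := \1_(tail n @^-1` A) pi.
have bh : bmf h by apply: bmf_indic; exact: mt.
have bk : bmf k by apply: bmf_indic; exact: mt.
rewrite -/h -/k.
suff e : \int[mu]_pi (h pi * g pi) = \int[mu]_pi (k pi * g pi).
  have split u : bmf u -> \int[mu]_pi u pi =
      \int[mu]_pi (u pi * g pi) + \int[mu]_pi (u pi * (1 - g pi)).
    move=> bu; rewrite -ExD; [|exact: bmfM|apply: bmfM => //; apply: bmfB => //; exact: bmf_cst].
    by apply: eq_Rintegral => pi _; lra.
  rewrite (split h)// (split k)// e; congr (_ + _); apply: eq_Rintegral => pi _.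
  rewrite /g /h /k !indicE; case: (boolP (two_starters b (tail n pi))) => [ts|]; last by rewrite subrr !mulr0.
  by congr ((nat_of_bool _)%:R * _); apply/idP/idP; rewrite !inE /= /oswap ts.
rewrite -(pexch_Ex (n + b) pe (bmfM bh bg)); apply: eq_Rintegral => pi _.
have [ts|nts] := boolP (two_starters (n + b) pi).
  rewrite /g /oswap ts (_ : two_starters b (tail n pi)) ?mulr0//.
  by move/andP: ts => [s1 s2]; apply/andP; split; apply: starter_tail; rewrite ?addnS.
rewrite /oswap (negbTE nts) /g /tail tail_pull_swap two_starters_pull -/(tail n pi).
have [ts|nts'] := boolP (two_starters b (tail n pi)); first by rewrite !mulr0.
congr (_ * _); rewrite /h /k !indicE; congr (nat_of_bool _)%:R.
apply/idP/idP; rewrite !inE /= /tail tail_pull_swap -/(tail n pi) /oswap two_starters_pull (negbTE nts');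
  rewrite (_ : pull _ (pull _ _) = tail n pi)//; by apply: npart_ext => x y /=; rewrite !swapK.
Qed.

End PartialExchangeability.

(** * Partitions as words *)

Section Words.
Implicit Types (n b x y c : nat) (f g : nat -> nat) (pi rho : npart0).

(** [f] lists the clusters of a partition of [n] by their rank of appearance
    exactly when each value is preceded by all the smaller ones. *)
Definition growing n f := forall x c, (x < n)%N -> (c < f x)%N ->
  exists2 y, (y < x)%N & f y = c.

Fact kernel_equiv f : equivalence_rel (fun x y => f x == f y).
Proof. by move=> x y z; split=> // /eqP ->. Qed.
Definition kernel f : npart0 := NPart (kernel_equiv f).

Definition nclusters n f : nat := (\max_(x < n) (f x).+1)%N.
Definition clusters n f : seq {set 'I_n} :=
  [seq [set x : 'I_n | f x == i]%SET | i <- iota 0 (nclusters n f)].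
Definition sizes n f := [seq #|pred_of_set A| | A <- clusters n f].

Lemma lt_nclusters n f x : (x < n)%N -> (f x < nclusters n f)%N.
Proof. by move=> xn; apply: (@bigop.leq_bigmax _ (fun i : 'I_n => (f i).+1) (Ordinal xn)). Qed.

Lemma growing_onto n f c : growing n f -> (c < nclusters n f)%N ->
  exists2 x, (x < n)%N & f x = c.
Proof.
move=> gf; case: n gf => [|n] gf; first by rewrite /nclusters big_ord0.
have [i0] := @bigop.eq_bigmax _ (fun i : 'I_n.+1 => (f i).+1) ltac:(by rewrite card_ord).
rewrite -/(nclusters n.+1 f) => ->; rewrite ltnS leq_eqVlt => /orP[/eqP ->|ci].
  by exists i0.
by have [y yi fy] := gf _ _ (ltn_ord i0) ci; exists y => //; exact: ltn_trans yi (ltn_ord i0).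
Qed.

Lemma restriction_kernel n f : growing n f ->
  restriction n (kernel f) = [set:: clusters n f]%SET.
Proof.
move=> gf; apply/setP => A; rewrite inE; apply/imsetP/mapP => [[x _ ->]|[i]].
  exists (f x); first by rewrite mem_iota lt_nclusters.
  by apply/setP => y; rewrite !inE eq_sym.
rewrite mem_iota => /(growing_onto gf)[x xn fx] ->; exists (Ordinal xn) => //.
by apply/setP => y; rewrite !inE /= fx eq_sym.
Qed.

Lemma clusters_in_orderP n f : growing n f -> clusters_in_order (clusters n f).
Proof.
move=> gf; apply/andP; split; first by rewrite -restriction_kernel//; exact: restriction_partition.
apply/(sortedP finset.set0) => i; rewrite size_map size_iota => iK.
rewrite !(nth_map 0%N) ?size_iota//; try lia.
rewrite !nth_iota//; try lia.
have ex : exists x, (x < n)%N && (f x == i).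
  by have [|x xn fx] := @growing_onto n f i gf; [lia|exists x; rewrite xn fx eqxx].
rewrite !add0n; case: (ex_minnP ex) => x /andP[xn fx] xmin.
apply/existsP; exists (Ordinal xn); rewrite inE fx /=.
apply/forallP => j; apply/implyP; rewrite inE => /eqP fj.
have [|y yj fy] := gf j i (ltn_ord j); first by rewrite fj.
apply: (leq_ltn_trans _ yj); apply: xmin; rewrite fy eqxx andbT.
exact: ltn_trans yj (ltn_ord j).
Qed.

Lemma appears_before_trans n : transitive (@appears_before n).
Proof.
move=> B A C /existsP[i /andP[iA /forallP iB]] /existsP[j /andP[jB /forallP jC]].
apply/existsP; exists i; rewrite iA; apply/forallP => k; apply/implyP => kC.
by apply: (@ltn_trans j); [exact: (implyP (iB j))|exact: (implyP (jC k))].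
Qed.

Lemma appears_before_irr n (A : {set 'I_n}) : ~~ appears_before A A.
Proof.
apply/existsP => -[i /andP[iA /forallP /(_ i)]].
by rewrite iA ltnn.
Qed.

(** Label each element by the index of its cluster in the list. *)
Lemma clusters_in_order_growing n (C : seq {set 'I_n}) : clusters_in_order C ->
  exists2 f, growing n f & clusters n f = C.
Proof.
move=> /andP[pC sC].
have /and3P[/eqP covC tC C0] := pC.
have before i j : (i < j)%N -> (j < size C)%N -> appears_before (nth finset.set0 C i) (nth finset.set0 C j).
  move=> ij jC; move: sC; rewrite (sorted_pairwise (@appears_before_trans n)).
  by move=> /(pairwiseP finset.set0); apply; rewrite ?inE//; lia.
have Cx (x : 'I_n) : has (fun A : {set 'I_n} => x \in A) C.
  have : x \in finset.cover [set:: C] by rewrite covC finset.in_setT.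
  by move=> /finset.bigcupP[A]; rewrite inE => AC xA; apply/hasP; exists A.
pose f x := find (fun A : {set 'I_n} => [exists i in A, val i == x]) C.
have fE (x : 'I_n) : f x = find (fun A : {set 'I_n} => x \in A) C.
  apply: eq_find => A; apply/existsP/idP => [[i /andP[iA /eqP/val_inj <-]]//|xA].
  by exists x; rewrite xA eqxx.
have fC (x : 'I_n) : (f x < size C)%N by rewrite fE -has_find.
have mem_f (x : 'I_n) : x \in nth finset.set0 C (f x).
  by rewrite fE; exact: (@nth_find _ finset.set0 (fun A : {set 'I_n} => x \in A)).
have disj i j (x : 'I_n) : (i < size C)%N -> (j < size C)%N ->
    x \in nth finset.set0 C i -> x \in nth finset.set0 C j -> i = j.
  have aux i' j' : (i' < j')%N -> (j' < size C)%N ->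
      x \in nth finset.set0 C i' -> x \in nth finset.set0 C j' -> False.
    move=> ij jC xi xj; have e : nth finset.set0 C i' = nth finset.set0 C j'.
      rewrite -(def_pblock tC _ xi); last by rewrite inE mem_nth//; exact: ltn_trans ij jC.
      by rewrite -(def_pblock tC _ xj)// inE mem_nth.
    by have := before _ _ ij jC; rewrite e; apply/negP; exact: appears_before_irr.
  move=> iC jC xi xj; case: (ltngtP i j) => // [ij|ji]; first by case: (aux _ _ ij jC xi xj).
  by case: (aux _ _ ji iC xj xi).
have fiff (x : 'I_n) i : (i < size C)%N -> (f x == i) = (x \in nth finset.set0 C i).
  move=> iC; apply/eqP/idP => [<-//|xi]; exact: disj (fC x) iC (mem_f x) xi.
have ne i : (i < size C)%N -> exists x : 'I_n, f x = i.
  move=> iC; have : nth finset.set0 C i != finset.set0.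
    by apply: contraNneq C0 => <-; rewrite inE mem_nth.
  by move=> /finset.set0Pn[x xi]; exists x; apply/eqP; rewrite fiff.
exists f.
  move=> x c xn cf; have := before _ _ cf (fC (Ordinal xn)).
  move=> /existsP[y /andP[yc /forallP /(_ (Ordinal xn)) /implyP yx]].
  exists y; first exact: yx (mem_f (Ordinal xn)).
  by apply/eqP; rewrite fiff//; exact: ltn_trans cf (fC (Ordinal xn)).
have K : nclusters n f = size C.
  apply/eqP; rewrite eqn_leq; apply/andP; split; first by apply/bigmax_leqP => x _; exact: fC.
  case E : (size C) => [//|k]; have [|x fx] := ne k; first by rewrite E.
  by rewrite -fx; apply: lt_nclusters.
apply: (@eq_from_nth _ finset.set0); rewrite size_map size_iota K// => i iC.
rewrite /clusters K (nth_map 0%N) ?size_iota// nth_iota// add0n.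
by apply/setP => x; rewrite inE fiff.
Qed.

Lemma nclusters_swap n f b : (b.+1 < n)%N -> nclusters n (f \o swap b) = nclusters n f.
Proof.
move=> bn; have sn (x : 'I_n) : (swap b x < n)%N by rewrite swap_bound.
pose s (x : 'I_n) := Ordinal (sn x).
have sI : injective s by move=> x y /(congr1 val) /= /(can_inj (swapK b)) /val_inj.
by rewrite /nclusters [RHS](reindex_inj sI).
Qed.

Lemma sizes_swap n f b : (b.+1 < n)%N -> sizes n (f \o swap b) = sizes n f.
Proof.
move=> bn; have sn (x : 'I_n) : (swap b x < n)%N by rewrite swap_bound.
pose s (x : 'I_n) := Ordinal (sn x).
have sI : injective s by move=> x y /(congr1 val) /= /(can_inj (swapK b)) /val_inj.
rewrite /sizes /clusters -!map_comp nclusters_swap//; apply: eq_map => i /=.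
rewrite -[RHS](card_imset _ sI); congr #|pred_of_set _|; apply/setP => x; rewrite inE.
apply/idP/imsetP => [fx|[y]].
  by exists (s x); rewrite ?inE//; apply: val_inj; rewrite /= swapK.
by rewrite inE => fy ->; rewrite /= swapK.
Qed.

(** A value that has occurred before may move across its neighbour: the smaller
    values have occurred before it already. *)
Lemma growing_swap n f b : (b.+1 < n)%N -> growing n f -> ~~ two_starters b (kernel f) ->
  growing n (f \o swap b).
Proof.
move=> bn gf nts x c xn /=.
case: (ltngtP x b) => [xb|bx|->]; last 1 first.
- rewrite swapl => cf.
  have [y yb fy] : exists2 y, (y < b.+1)%N & f y = c by apply: gf.
  case: (ltngtP y b) => [yb'||yb']; last 1 first.
  + subst y; move: nts; rewrite /two_starters negb_and => /orP[]/starterP nst.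
      have [z zb fz] : exists2 z, (z < b)%N & f z = c.
        apply: contrapT => h; apply: nst => l lb /=; apply/eqP => fl.
        by apply: h; exists l; rewrite ?fl ?fy.
      by exists z; rewrite ?swap_lt.
    have [z zb fz] : exists2 z, (z < b)%N & f z = f b.+1.
      apply: contrapT => h; apply: nst => l; rewrite ltnS leq_eqVlt => /orP[/eqP ->|lb] /=.
        by rewrite fy; lia.
      by apply/eqP => fl; apply: h; exists l.
    have [|//|w wz fw] := gf z c; [lia|by rewrite fz|].
    by exists w; rewrite ?swap_lt ?fw//; lia.
  + by exists y => //; rewrite swap_lt.
  + by lia.
- rewrite swap_lt// => cf; have [//|y yx fy] := gf x c xn.
  by exists y => //; rewrite swap_lt//; lia.
- case: (ltngtP x b.+1) => [|bx'|->]; first by lia.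
    rewrite swap_gt// => cf; have [y yx fy] := gf x c xn cf.
    by exists (swap b y); rewrite ?swapK// swap_bound.
  rewrite swapr => cf; have [|y yb fy] := gf b c _ cf; first by lia.
  by exists y; rewrite ?swap_lt//; lia.
Qed.

Definition cluster_min pi x := ex_minn (ex_intro (fun l => pi l x) x (npart_refl pi x)).

Lemma cluster_minP pi x : [/\ starter pi (cluster_min pi x), pi (cluster_min pi x) x & (cluster_min pi x <= x)%N].
Proof.
rewrite /cluster_min; case: ex_minnP => l lx lmin; split=> //; last exact/lmin/npart_refl.
apply/starterP => k kl; apply/negP => pkl.
by have := lmin k (npart_trans pkl lx); lia.
Qed.

Lemma cluster_min_unique pi x l : starter pi l -> pi l x -> cluster_min pi x = l.
Proof.
move=> sl lx; have [sf fx _] := cluster_minP pi x; apply: starter_inj sf sl _.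
by apply: npart_trans fx _; rewrite npart_sym.
Qed.

Definition rank pi x := count (starter pi) (iota 0 x).

Lemma rankS pi x : rank pi x.+1 = (rank pi x + starter pi x)%N.
Proof. by rewrite /rank -addn1 iotaD count_cat /= addn0 add0n. Qed.

Lemma rank_le pi x y : (x <= y)%N -> (rank pi x <= rank pi y)%N.
Proof.
elim: y => [|y IH]; first by rewrite leqn0 => /eqP ->.
by rewrite leq_eqVlt => /orP[/eqP ->//|/IH]; rewrite rankS; lia.
Qed.

Lemma rank_lt pi x y : starter pi x -> (x < y)%N -> (rank pi x < rank pi y)%N.
Proof. by move=> sx /(rank_le pi); rewrite rankS sx; lia. Qed.

Lemma rank_inj pi x y : starter pi x -> starter pi y -> rank pi x = rank pi y -> x = y.
Proof.
by move=> sx sy e; case: (ltngtP x y) => // [/(rank_lt sx)|/(rank_lt sy)]; lia.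
Qed.

Lemma rank_onto pi x c : (c < rank pi x)%N ->
  exists2 y, (y < x)%N & starter pi y /\ rank pi y = c.
Proof.
elim: x => [|x IH]; first by rewrite /rank.
rewrite rankS; case: (boolP (starter pi x)) => sx; rewrite ?addn0 ?addn1 ?ltnS.
  rewrite leq_eqVlt => /orP[/eqP ->|/IH[y yx h]]; first by exists x.
  by exists y => //; lia.
by move=> /IH[y yx h]; exists y => //; lia.
Qed.

Definition label pi x := rank pi (cluster_min pi x).

Lemma label_growing pi n : growing n (label pi).
Proof.
move=> x c _ /rank_onto[y yf [sy ry]]; have [_ _ fx] := cluster_minP pi x.
exists y; first by lia.
by rewrite /label (cluster_min_unique sy)//; exact: npart_refl.
Qed.

Lemma kernel_label pi : kernel (label pi) = pi.
Proof.
apply: npart_ext => x y /=; have [sx px _] := cluster_minP pi x; have [sy py _] := cluster_minP pi y.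
apply/eqP/idP => [/(rank_inj sx sy) e|xy].
  by rewrite -(npart_eql _ px) e.
by rewrite /label (@cluster_min_unique pi x (cluster_min pi y))// (npart_eqr _ xy).
Qed.

Lemma oswap_kernel b f : oswap b (kernel f) =
  if two_starters b (kernel f) then kernel f else kernel (f \o swap b).
Proof. by rewrite /oswap; case: ifP => // _; exact: npart_ext. Qed.

End Words.

(** * Existence of a PEPPF as invariance under swaps *)

Section Peppf.
Context (R : realType).
Implicit Types (mu : probability npart R).

Definition lawid : npart -> npart := id.

(** A swap that preserves the order of appearance preserves the cluster sizes in
    this order, of which the probability is a function. *)
Lemma peppf_pexch mu p : is_peppf mu lawid p -> pexch mu.
Proof.
move=> hp b; suff h : forall A, measurable A -> law mu (measurable_oswap b) A = mu A by exact: h.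
apply: (@npart_law_ext _ b.+2) => n S bn.
change (mu [set pi | restriction n (oswap b pi) = S] = mu [set pi | restriction n pi = S]).
have [[rho <-]|nS] := pselect (exists rho : npart0, restriction n rho = S); last first.
  rewrite (_ : [set pi | _ ] = set0); last first.
    by apply/seteqP; split => // pi /= e; apply: nS; exists (oswap b pi).
  rewrite (_ : [set pi | _ ] = set0)//.
  by apply/seteqP; split => // pi /= e; apply: nS; exists pi.
set f := label rho; have gf : growing n f by exact: label_growing.
have -> : rho = kernel f by rewrite kernel_label.
have -> : [set pi : npart | restriction n (oswap b pi) = restriction n (kernel f)] =
    [set pi : npart | restriction n pi = restriction n (oswap b (kernel f))].
  apply/seteqP; split=> pi /= /restriction_agree e; apply/restriction_agree.
    by rewrite -[pi](oswapK b); apply: oswap_agree.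
  by rewrite -[kernel f](oswapK b); apply: oswap_agree.
rewrite oswap_kernel; case: ifPn => // nts.
have gs := growing_swap bn gf nts.
have := hp _ _ (clusters_in_orderP gs); have := hp _ _ (clusters_in_orderP gf).
rewrite -!restriction_kernel// -/(sizes n f) -/(sizes n (f \o swap b)) sizes_swap//.
by move=> e1 e2; rewrite [LHS]e2 [RHS]e1.
Qed.

Lemma count_cell n (h : nat -> nat) (i : nat) :
  count (pred1 i) [seq h x | x <- iota 0 n] = #|[set x : 'I_n | h x == i]%SET|.
Proof.
rewrite count_map cardE /enum_mem size_filter -enumT -val_enum_ord count_map.
by apply: eq_count => x /=; rewrite inE.
Qed.

Lemma size_sizes n h : size (sizes n h) = nclusters n h.
Proof. by rewrite /sizes /clusters !size_map size_iota. Qed.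

Lemma nth_sizes n h (i : nat) : nth 0%N (sizes n h) i = count (pred1 i) [seq h x | x <- iota 0 n].
Proof.
rewrite /sizes /clusters -map_comp count_cell.
have [iK|Ki] := ltnP i (nclusters n h); first by rewrite (nth_map 0%N) ?size_iota// nth_iota.
rewrite nth_default ?size_map ?size_iota//; symmetry; apply/eqP; rewrite cards_eq0.
apply/eqP/setP => x; rewrite inE [RHS]inE; apply/negP => /eqP hx.
by have := lt_nclusters h (ltn_ord x); rewrite hx ltnNge Ki.
Qed.

Lemma nondecr_growing_unique n f g :
  {in gtn n &, {homo f : x y / (x <= y)%N}} -> {in gtn n &, {homo g : x y / (x <= y)%N}} ->
  sizes n f = sizes n g -> {in gtn n, f =1 g}.
Proof.
move=> ndf ndg e.
have srt h : {in gtn n &, {homo h : x y / (x <= y)%N}} -> sorted leq [seq h x | x <- iota 0 n].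
  move=> ndh; apply/(sortedP 0%N) => i; rewrite size_map size_iota => i_n.
  rewrite !(nth_map 0%N) ?size_iota//; try lia.
  by rewrite !nth_iota; try lia; apply: ndh; rewrite ?inE; lia.
have perm : perm_eq [seq f x | x <- iota 0 n] [seq g x | x <- iota 0 n].
  by apply/allP => i _ /=; rewrite -!nth_sizes e.
have fg := sorted_eq leq_trans anti_leq (srt _ ndf) (srt _ ndg) perm.
move=> x xn; have := congr1 (fun s => nth 0%N s x) fg.
by rewrite !(nth_map 0%N) ?size_iota// nth_iota.
Qed.

Lemma growing_le n f x : growing n f -> (x < n)%N -> (f x <= x)%N.
Proof.
move=> gf; elim/ltn_ind: x => x IH xn; rewrite leqNgt; apply/negP => xf.
have [y yx fy] := gf x x xn xf.
by have := IH y yx (ltn_trans yx xn); lia.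
Qed.

(** Bubble sort. Of two decreasing neighbours the second has a value that has
    occurred before, so they may be exchanged; this increases the sum of the
    products [x * f x], which is bounded. *)
Lemma pexch_sort mu n f : pexch mu -> growing n f ->
  exists g, [/\ growing n g, sizes n g = sizes n f,
    mu [set pi | restriction n pi = restriction n (kernel g)] =
    mu [set pi | restriction n pi = restriction n (kernel f)] &
    {in gtn n &, {homo g : x y / (x <= y)%N}}].
Proof.
move=> pe.
have [k] := ubnP (n * (n * n) - \sum_(x < n) x * f x)%N.
elim: k f => // k IH f fk gf.
have [[b [bn fb]]|nd] := pselect (exists b, (b.+1 < n)%N /\ (f b.+1 < f b)%N); last first.
  exists f; split=> // x y; rewrite !inE => xn yn.
  elim: y yn => [|y IHy] yn; first by rewrite leqn0 => /eqP ->.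
  rewrite leq_eqVlt => /orP[/eqP ->//|xy]; apply: leq_trans (IHy _ xy) _; first by lia.
  by rewrite leqNgt; apply/negP => h; apply: nd; exists y.
have nts : ~~ two_starters b (kernel f).
  apply/negP => /andP[_ /starterP st].
  have [|y yb fy] := gf b (f b.+1) _ fb; first by lia.
  by have /= := st y (leqW yb); rewrite fy eqxx.
have gs := growing_swap bn gf nts.
have [|g [gg gsz gmu gnd]] := IH (f \o swap b) _ gs; last first.
  exists g; split=> //; first by rewrite gsz sizes_swap.
  rewrite gmu -(pe b _ (measurable_restriction (restriction n (kernel f)))).
  congr (mu _); apply/seteqP; split=> pi /= /restriction_agree e; apply/restriction_agree.
    rewrite -[kernel f](oswapK b) oswap_kernel (negbTE nts); exact: oswap_agree.
  have := oswap_agree bn e; rewrite oswapK oswap_kernel (negbTE nts); exact.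
have S : (\sum_(x < n) x * f x < \sum_(x < n) x * (f \o swap b) x)%N.
  have b1n : (b < n)%N by lia.
  rewrite (bigD1 (Ordinal bn))//= (bigD1 (Ordinal b1n))/=; last first.
    by apply/eqP => /(congr1 val) /=; lia.
  rewrite [X in (_ < X)%N](bigD1 (Ordinal bn))//= [X in (_ < _ + X)%N](bigD1 (Ordinal b1n))/=; last first.
    by apply/eqP => /(congr1 val) /=; lia.
  rewrite swapl swapr.
  under [X in (_ < _ + (_ + X))%N]eq_bigr => x xb.
    rewrite (_ : swap b x = x); first over.
    move: xb => /andP[/eqP x1 /eqP x2]; rewrite /swap; case: eqP => [e|_].
      by case: x2; apply: val_inj.
    by case: eqP => // e; case: x1; apply: val_inj.
  by rewrite !addnA ltn_add2r; nia.
have B : (\sum_(x < n) x * (f \o swap b) x <= n * (n * n))%N.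
  have -> : (n * (n * n) = \sum_(x < n) n * n)%N by rewrite sum_nat_const card_ord.
  apply: leq_sum => x _; apply: leq_mul; first exact: ltnW.
  have := growing_le gs (ltn_ord x); have := ltn_ord x; rewrite /=; lia.
lia.
Qed.

(** A law invariant under the swaps that preserve the order of appearance has
    a PEPPF: such swaps sort any word without changing its probability, and
    the sorted word depends on the cluster sizes only. *)
Lemma pexch_peppf mu : pexch mu -> exists p, is_peppf mu lawid p.
Proof.
move=> pe.
pose v n f := mu [set pi | restriction n pi = restriction n (kernel f)].
have vE n f g : growing n f -> growing n g -> sizes n f = sizes n g -> v n f = v n g.
  move=> gf gg e; have [f' [gf' szf ef ndf]] := pexch_sort pe gf.
  have [g' [gg' szg eg ndg]] := pexch_sort pe gg.
  have fg := nondecr_growing_unique ndf ndg; rewrite szf szg in fg; have {}fg := fg e.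
  rewrite /v -ef -eg (_ : restriction n (kernel f') = restriction n (kernel g'))//.
  by apply/restriction_agree => i j i_n j_n /=; rewrite !fg.
have sumsz n f : growing n f -> sumn (sizes n f) = n.
  move=> gf; rewrite /sizes sumnE big_map.
  have /andP[/and3P[/eqP cov triv n0] srt] := clusters_in_orderP gf.
  have u : uniq (clusters n f).
    rewrite map_inj_in_uniq ?iota_uniq// => i j; rewrite !mem_iota => iK jK.
    have [//|x xn fx] := @growing_onto n f i gf.
    by move=> /setP /(_ (Ordinal xn)); rewrite !inE /= fx eqxx => /esym/eqP.
  rewrite (@big_uniq _ _ _ _ (clusters n f) (fun A => #|pred_of_set A|))//.
  have := leq_card_cover [set:: clusters n f]%SET; rewrite /finset.trivIset in triv.
  move: triv; rewrite cov cardsT card_ord => /eqP e _; rewrite -[RHS]e.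
  by apply: eq_bigl => A; rewrite inE.
pose Q c r := exists n f, [/\ growing n f, sizes n f = c & r = v n f].
exists (fun c => fine (xget 0%E [set r | Q c r])) => n C /clusters_in_order_growing[f gf <-].
rewrite -restriction_kernel// -/(sizes n f).
have Qv : Q (sizes n f) (v n f) by exists n, f.
have -> : xget 0%E [set r | Q (sizes n f) r] = v n f.
  case: xgetP => [r _ [m [g [gg e ->]]]|/(_ _ Qv)//].
  have mn : m = n by rewrite -(sumsz m g gg) e sumsz.
  by subst m; apply: vE.
by rewrite fineK// fin_num_measure//; exact: measurable_restriction.
Qed.

End Peppf.

(** * Averages and frequencies of clusters *)

Section Sequences.
Context (R : realType).
Implicit Types (u v : nat -> R).

Lemma cvg_close u v (l : R) : (fun n => u n - v n) @ \oo --> (0 : R) -> v @ \oo --> l -> u @ \oo --> l.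
Proof. by move=> uv h; apply: cvg_sub0 h. Qed.

Lemma limn_close u v : (fun n => u n - v n) @ \oo --> (0 : R) -> limn u = limn v.
Proof.
move=> uv.
have vu : (fun n => v n - u n) @ \oo --> 0.
  by rewrite -oppr0; under eq_fun do rewrite -opprB; exact: cvgN.
have [cu|du] := pselect (cvgn u).
  by symmetry; apply: cvg_lim => //; exact: cvg_close vu cu.
rewrite (dvgP du) dvgP// => cv; apply: du; apply/cvg_ex; exists (limn v); exact: cvg_close uv cv.
Qed.

Lemma cvg_div_nat (c : R) : (fun n : nat => c / n%:R) @ \oo --> 0.
Proof.
rewrite -[X in _ --> X](mulr0 c); apply: cvgM; first exact: cvg_cst.
by rewrite -cvg_shiftS; exact: cvg_harmonic.
Qed.

Lemma cvg0_le (c u : nat -> R) : (forall n, `|u n| <= c n) -> c @ \oo --> 0 -> u @ \oo --> 0.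
Proof.
move=> uc c0; apply: norm_cvg0; apply: (@squeeze_cvgr _ _ _ _ (fun=> 0) c) => //.
- by apply: nearW => n; rewrite normr_ge0 uc.
- exact: cvg_cst.
Qed.

Lemma invn_lt (e : R) : 0 < e -> exists k : nat, k.+1%:R^-1 < e.
Proof.
move=> e0; have /cvgrPdist_lt /(_ e e0) [N _ hN] := @cvg_harmonic R.
by exists N; have := hN N (leqnn N); rewrite /= sub0r normrN ger0_norm ?invr_ge0.
Qed.

Lemma cvgn_cauchyP u : cvgn u <->
  forall k : nat, exists N, forall n, (N <= n)%N -> `|u n - u N| <= k.+1%:R^-1.
Proof.
split=> [/cvg_ex[l ul] k|h].
  have e0 : 0 < k.+1%:R^-1 / 2 :> R by rewrite divr_gt0.
  have /cvgrPdist_lt /(_ _ e0) [N _ hN] := ul.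
  exists N => n Nn; have := hN n Nn; have := hN N (leqnn N); rewrite /= => h1 h2.
  rewrite (_ : u n - u N = (l - u N) - (l - u n)); last by lra.
  by apply: (le_trans (ler_normB _ _)); move: h1 h2; set e := _^-1; lra.
apply/cauchy_cvgP/cauchy_exP => e e0; have [k ke] := invn_lt e0; have [N hN] := h k.
exists (u N); exists N => // n Nn /=; rewrite /ball /= distrC.
exact: le_lt_trans (hN n Nn) ke.
Qed.

Lemma cvg_sumr I (r : seq I) (Q : pred I) (f : I -> nat -> R) (l : I -> R) :
  (forall i, Q i -> f i @ \oo --> l i) ->
  (fun n => \sum_(i <- r | Q i) f i n) @ \oo --> \sum_(i <- r | Q i) l i.
Proof.
move=> fl; elim: r => [|i r IH].
  by rewrite big_nil; under eq_fun do rewrite big_nil; exact: cvg_cst.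
rewrite big_cons; under eq_fun do rewrite big_cons.
by case: (boolP (Q i)) => Qi //; apply: cvgD => //; exact: fl.
Qed.

Lemma cvg_prodr I (r : seq I) (Q : pred I) (f : I -> nat -> R) (l : I -> R) :
  (forall i, Q i -> f i @ \oo --> l i) ->
  (fun n => \prod_(i <- r | Q i) f i n) @ \oo --> \prod_(i <- r | Q i) l i.
Proof.
move=> fl; elim: r => [|i r IH].
  by rewrite big_nil; under eq_fun do rewrite big_nil; exact: cvg_cst.
rewrite big_cons; under eq_fun do rewrite big_cons.
by case: (boolP (Q i)) => Qi //; apply: cvgM => //; exact: fl.
Qed.

Lemma shift_sum_le (a : nat -> R) n m : (forall y, 0 <= a y) -> (forall y, a y <= 1) ->
  `|\sum_(y < m) a (n + y)%N - \sum_(y < m) a y| <= n%:R.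
Proof.
move=> a0 a1.
rewrite (_ : \sum_(y < m) _ = \sum_(n <= y < n + m) a y); last first.
  rewrite -[X in \sum_(X <= _ < _) _]add0n big_addn addKn big_mkord; apply: eq_bigr => i _.
  by rewrite addnC.
rewrite (_ : \sum_(y < m) _ = \sum_(0 <= y < m) a y); last by rewrite big_mkord.
have e : \sum_(0 <= y < n) a y + \sum_(n <= y < n + m) a y =
    \sum_(0 <= y < m) a y + \sum_(m <= y < n + m) a y.
  by rewrite -!big_cat_nat//; lia.
have b0 i j : 0 <= \sum_(i <= y < j) a y by apply: sumr_ge0.
have b1 i j : \sum_(i <= y < j) a y <= (j - i)%N%:R.
  rewrite (le_trans (ler_sum _ (fun y _ => a1 y)))//.
  by rewrite big_const_nat iter_addr addr0.
have := b1 0%N n; have := b1 m (n + m)%N; have := b0 0%N n; have := b0 m (n + m)%N.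
rewrite subn0 addnK => h1 h2 h3 h4.
by rewrite ler_norml; apply/andP; split; lra.
Qed.

End Sequences.

Section Frequencies.
Context (R : realType).
Implicit Types (pi : npart) (l x y : nat).

Definition avg pi l m : R := (count (same_cluster pi l) (iota 0 m))%:R / m%:R.

Lemma avg_sum pi l m : avg pi l m = (\sum_(y < m) (same_cluster pi l y)%:R) / m%:R.
Proof.
rewrite /avg -(big_mkord xpredT (fun y => (same_cluster pi l y)%:R)) -natr_sum.
by rewrite /index_iota subn0 -sumn_count sumnE big_map.
Qed.

Lemma avg_ge0 pi l m : 0 <= avg pi l m.
Proof. by rewrite divr_ge0. Qed.

Lemma avg_le1 pi l m : avg pi l m <= 1.
Proof.
case: m => [|m]; first by rewrite /avg /= invr0 mulr0.
by rewrite ler_pdivrMr// mul1r ler_nat (leq_trans (count_size _ _))// size_iota.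
Qed.

Definition cvg_avg pi l := cvgn (avg pi l).

Notation freq := (cluster_freq R).

Lemma freqE pi l : freq pi l = limn (avg pi l). Proof. by []. Qed.

Lemma freq_dvg pi l : ~ cvg_avg pi l -> freq pi l = 0.
Proof. by move=> h; rewrite freqE dvgP. Qed.

Lemma freq_cvg pi l : cvg_avg pi l -> avg pi l @ \oo --> freq pi l.
Proof. by []. Qed.

Lemma freq_ge0 pi l : 0 <= freq pi l.
Proof.
have [h|/freq_dvg->//] := pselect (cvg_avg pi l).
by apply: limr_ge => //; apply: nearW => n; exact: avg_ge0.
Qed.

Lemma freq_le1 pi l : freq pi l <= 1.
Proof.
have [h|/freq_dvg->//] := pselect (cvg_avg pi l).
by apply: limr_le => //; apply: nearW => n; exact: avg_le1.
Qed.

Lemma freq_related pi x y : same_cluster pi x y -> freq pi x = freq pi y.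
Proof.
move=> xy; rewrite !freqE; congr (limn _); apply/funext => m; rewrite /avg.
by congr (_%:R / _); apply: eq_count => z; rewrite (npart_eql _ xy).
Qed.

Lemma freq_pull_swap b pi l : freq (pull (swap b) pi) l = freq pi (swap b l).
Proof.
rewrite !freqE; apply: limn_close; apply: (@cvg_close _ _ (fun=> 0)); last exact: cvg_cst.
apply: cvg_near_cst; exists b.+2 => // m /= bm; rewrite subr0 !avg_sum -mulrBl.
have sm (x : 'I_m) : (swap b x < m)%N by rewrite swap_bound.
pose s (x : 'I_m) := Ordinal (sm x).
have sI : injective s by move=> x y /(congr1 val) /= /(can_inj (swapK b)) /val_inj.
by rewrite [X in (_ - X) / _](reindex_inj sI)/= subrr mul0r.
Qed.

Lemma freq_tail n pi l : freq (tail n pi) l = freq pi (n + l).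
Proof.
rewrite !freqE; apply: limn_close; apply: cvg0_le (cvg_div_nat n%:R) => m.
rewrite !avg_sum -mulrBl normrM normfV normr_nat ler_wpM2r//.
have := @shift_sum_le R (fun y => (same_cluster pi (n + l) y)%:R) n m.
by apply => // y; case: (same_cluster _ _ _).
Qed.

Lemma bmf_avg l m : bmf (fun pi : npart => avg pi l m).
Proof.
under eq_fun do rewrite avg_sum; apply: bmfM; last exact: bmf_cst.
by apply: bmf_sum => y _; exact: bmf_same.
Qed.

Lemma measurable_cvg_avg l : measurable [set pi | cvg_avg pi l].
Proof.
rewrite (_ : [set pi | _] = \bigcap_(k : nat) \bigcup_(N : nat) \bigcap_(n : nat)
   [set pi : npart | (N <= n)%N ==> (`|avg pi l n - avg pi l N| <= k.+1%:R^-1)]); last first.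
  apply/seteqP; split=> pi /=.
    by move=> /cvgn_cauchyP h k _; have [N hN] := h k; exists N => // n _; apply/implyP/hN.
  move=> h; apply/cvgn_cauchyP => k; have [N _ hN] := h k I.
  by exists N => n; apply/implyP/hN.
apply: bigcapT_measurable => k; apply: bigcupT_measurable => N; apply: bigcapT_measurable => n.
case: (N <= n)%N => /=; last by rewrite (_ : [set _ | _] = setT)//; apply/seteqP.
have [m _] := bmf_norm (bmfB (bmf_avg l n) (bmf_avg l N)).
rewrite -[X in measurable X]setTI; apply: (measurable_fun_ler m (measurable_cst _)) => //.
Qed.

Lemma bmf_freq l : bmf (fun pi : npart => freq pi l).
Proof.
split; last by exists 1 => pi; rewrite ger0_norm ?freq_ge0 ?freq_le1.
pose D := [set pi | cvg_avg pi l].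
apply: (@measurable_fun_cvg _ _ _ _ (fun m pi => avg pi l m * \1_D pi)) => [m|pi _].
  apply: measurable_funM; first by case: (bmf_avg l m).
  by apply: measurable_indic; exact: measurable_cvg_avg.
rewrite indicE; have [h|h] := pselect (cvg_avg pi l).
  by rewrite mem_set//; under eq_fun do rewrite mulr1; exact: freq_cvg.
by rewrite memNset//; under eq_fun do rewrite mulr0; rewrite freq_dvg//; exact: cvg_cst.
Qed.

Lemma freq_oswap b pi l : freq (oswap b pi) l =
  if two_starters b pi then freq pi l else freq pi (swap b l).
Proof. by rewrite /oswap; case: ifP => // _; exact: freq_pull_swap. Qed.

Lemma fixed_from_freq a l : (l < a)%N -> fixed_from a (fun pi : npart => freq pi l).
Proof.
move=> la b pi ab; rewrite freq_oswap; case: ifP => // _; rewrite swap_lt//; lia.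
Qed.

(** Distinct clusters have disjoint elements, so their averages add up to at most 1. *)
Lemma sum_avg_le1 pi (s : seq nat) m : uniq s -> all (starter pi) s ->
  \sum_(l <- s) avg pi l m <= 1.
Proof.
case: m => [|m] us st; first by rewrite big1// => l _; rewrite /avg invr0 mulr0.
under eq_bigr do rewrite avg_sum.
rewrite -mulr_suml ler_pdivrMr// mul1r exchange_big /=.
rewrite [leRHS](_ : _ = \sum_(y < m.+1) 1); last by rewrite sumr_const card_ord.
apply: ler_sum => y _; have [sf fy _] := cluster_minP pi y.
have h l : starter pi l -> same_cluster pi l y = (l == cluster_min pi y).
  by move=> sl; apply/idP/eqP => [/(cluster_min_unique sl)//|->].
rewrite (eq_big_seq (fun l => (l == cluster_min pi y)%:R)); last first.
  by move=> l ls; rewrite h//; exact: (allP st).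
have [fs|fs] := boolP (cluster_min pi y \in s).
  rewrite (bigD1_seq (cluster_min pi y))//= eqxx big1 ?addr0// => l /negbTE ->; by [].
rewrite big_seq big1// => l ls; rewrite (_ : (l == _) = false)//.
by apply/eqP => e; move: fs; rewrite -e ls.
Qed.

Lemma sum_freq_le1 pi (s : seq nat) : uniq s -> all (starter pi) s ->
  \sum_(l <- s) freq pi l <= 1.
Proof.
move=> us st; pose c l := `[< cvg_avg pi l >].
rewrite (bigID c)/= [X in _ + X]big1 ?addr0; last by move=> l /asboolP; exact: freq_dvg.
rewrite -big_filter; set t := [seq _ <- _ | _].
have ut : uniq t by exact: filter_uniq.
have stt : all (starter pi) t.
  by apply/allP => l; rewrite mem_filter => /andP[_]; exact: (allP st).
have ct : forall l, l \in t -> cvg_avg pi l by move=> l; rewrite mem_filter => /andP[/asboolP].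
have cv : (fun m => \sum_(l <- t) avg pi l m) @ \oo --> \sum_(l <- t) freq pi l.
  rewrite big_seq; under eq_fun do rewrite big_seq.
  by apply: cvg_sumr => l /ct; exact: freq_cvg.
rewrite -(cvg_lim _ cv)//; apply: limr_le; first by apply/cvg_ex; eexists; exact: cv.
by apply: nearW => m; exact: sum_avg_le1.
Qed.

End Frequencies.
Notation freq := (cluster_freq _).

(** * A law of large numbers for cluster membership *)

(** Bounds the mean increment of the averages from [x ^ 3] to [(x + 1) ^ 3]
    elements, as given by [Ex_abs] with the weight [c = x (x + 1)], by a term of
    a telescoping sum. *)
Lemma cube_increment_le (R : realType) (x : R) : 1 <= x ->
  (x * (x + 1) * ((x ^+ 3)^-1 - ((x + 1) ^+ 3)^-1) + (x * (x + 1))^-1) / 2 <=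
  5 / 2 * (x^-1 - (x + 1)^-1).
Proof.
move=> x1.
rewrite [(x * (x + 1))^-1]invfM -!exprVn; set a := x^-1; set b := (x+1)^-1.
have xa : x * a = 1 by rewrite mulfV//; lra.
have yb : (x+1) * b = 1 by rewrite mulfV//; lra.
have ab : a - b = a * b.
  have : a * ((x+1) * b) - b * (x * a) = a * b by lra.
  by rewrite xa yb; lra.
have a0 : 0 < a by rewrite invr_gt0; lra.
have b0 : 0 < b by rewrite invr_gt0; lra.
have e : x * (x+1) * (a ^+ 3 - b ^+ 3) = a * b * (3 + a * b).
  have -> : x * (x+1) * (a ^+ 3 - b ^+ 3) = x * (x + 1) * ((a - b) * ((a - b) ^+ 2 + 3 * (a * b))) by lra.
  rewrite ab.
  have -> : x * (x + 1) * (a * b * ((a * b) ^+ 2 + 3 * (a * b))) = (x * a) * ((x + 1) * b) * (a * b * (a * b + 3)) by lra.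
  by rewrite xa yb; lra.
rewrite e ab.
have a1 : a <= 1 by rewrite invf_le1; lra.
have b1 : b <= 1 by rewrite invf_le1; lra.
have abp : 0 < a * b by rewrite mulr_gt0.
have ab1 : a * b <= 1 by apply: mulr_ile1 => //; exact: ltW.
nra.
Qed.

Section LLN.
Context (R : realType) (mu : probability npart R) (pe : pexch mu) (l : nat).

Let xi y (pi : npart) : R := (same_cluster pi l y)%:R.
Let a := l.+1.
Let T N pi := \sum_(i < N) xi (a + i) pi.
Let S N pi := T N pi / N%:R.

Let bxi y : bmf (xi y). Proof. exact: bmf_same. Qed.
Let bT N : bmf (T N). Proof. by apply: bmf_sum. Qed.
Let bS N : bmf (S N). Proof. by apply: bmfM => //; exact: bmf_cst. Qed.

Let xi_oswap b y pi : (l < b)%N -> xi y (oswap b pi) = xi (swap b y) pi.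
Proof. by move=> lb; rewrite /xi oswap_row. Qed.

Let alpha := \int[mu]_pi xi a pi.
Let beta := \int[mu]_pi (xi a pi * xi a.+1 pi).

Let Ex_xi y : (a <= y)%N -> \int[mu]_pi xi y pi = alpha.
Proof.
move=> ay; have h (z : nat) : \int[mu]_pi xi z pi = \int[mu]_pi (1 * xi z pi).
  by apply: eq_Rintegral => pi _; rewrite mul1r.
by rewrite /alpha !h; apply: (@pexch_row R mu (fun=> 1)) => //; exact: bmf_cst.
Qed.

Let Ex_xixi y z : (a <= y)%N -> (y < z)%N -> \int[mu]_pi (xi y pi * xi z pi) = beta.
Proof.
have up y' z' : (a <= y')%N -> (y' < z')%N ->
    \int[mu]_pi (xi y' pi * xi z' pi) = \int[mu]_pi (xi y' pi * xi y'.+1 pi).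
  by move=> ay yz; apply: pexch_row => //; [apply: fixed_from_same; lia|lia].
elim: y z => [|y IH] z ay yz; first by lia.
rewrite up//; move: ay; rewrite leq_eqVlt => /orP[/eqP ay|ay]; first by rewrite /beta ay.
rewrite -(IH y.+2)//.
rewrite -(pexch_Ex y pe); last exact: bmfM.
by apply: eq_Rintegral => pi _; rewrite !xi_oswap ?swapr ?swap_gt//; lia.
Qed.

(* Only the cases of equal and of distinct elements occur, with the
   expectations alpha and beta. *)
Let Ex_TT N M : (N <= M)%N ->
  \int[mu]_pi (T N pi * T M pi) = N%:R * (alpha - beta) + N%:R * M%:R * beta.
Proof.
move=> NM; transitivity (\int[mu]_pi (\sum_(i < N) \sum_(j < M) xi (a + i) pi * xi (a + j) pi)).
  by apply: eq_Rintegral => pi _; rewrite mulr_suml; apply: eq_bigr => i _; rewrite mulr_sumr.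
rewrite Ex_sum; last by move=> i _; apply: bmf_sum => j _; exact: bmfM.
transitivity (\sum_(i < N) ((alpha - beta) + M%:R * beta)); last first.
  rewrite sumr_const card_ord -mulr_natl; lra.
apply: eq_bigr => i _; rewrite Ex_sum; last by move=> j _; exact: bmfM.
have iM : (i < M)%N by exact: leq_trans (ltn_ord i) NM.
rewrite (bigD1 (Ordinal iM))//=.
rewrite [X in X + _](_ : _ = alpha); last first.
  rewrite -(@Ex_xi (a + i)); last by lia.
  by apply: eq_Rintegral => pi _; rewrite /xi -natrM mulnb andbb.
rewrite (eq_bigr (fun=> beta)); last first.
  move=> j ji; have {}ji : j <> i :> nat by move=> e; move/eqP: ji; apply; exact: val_inj.
  case: (ltngtP j i) => // jlt; last by apply: Ex_xixi; lia.
  by under eq_Rintegral do rewrite mulrC; apply: Ex_xixi; lia.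
rewrite sumr_const cardC1 card_ord -mulr_natl.
have -> : M%:R = M.-1%:R + 1 :> R by rewrite natr1 prednK//; lia.
by lra.
Qed.

Let Ex_sqr N M : (0 < N)%N -> (N <= M)%N ->
  \int[mu]_pi ((S M pi - S N pi) ^+ 2) <= N%:R^-1 - M%:R^-1.
Proof.
move=> N0 NM; have M0 : (0 < M)%N by lia.
have n0 : N%:R != 0 :> R by rewrite pnatr_eq0; lia.
have m0 : M%:R != 0 :> R by rewrite pnatr_eq0; lia.
set n := N%:R^-1; set m := M%:R^-1.
rewrite [leLHS](_ : _ = \int[mu]_pi (m ^+ 2 * (T M pi * T M pi) -
    (2 * n * m * (T N pi * T M pi) - n ^+ 2 * (T N pi * T N pi)))); last first.
  by apply: eq_Rintegral => pi _; rewrite /S -/n -/m; lra.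
have bZ c f : bmf f -> bmf (fun pi : npart => c * f pi).
  by move=> bf; apply: bmfM => //; exact: bmf_cst.
rewrite !ExB ?ExZ ?Ex_TT//; do ?[exact: bmfM|apply: (bZ); exact: bmfM|apply: bmfB; apply: (bZ); exact: bmfM].
have en : N%:R * n = 1 by rewrite mulfV.
have em : M%:R * m = 1 by rewrite mulfV.
have -> : m ^+ 2 * (M%:R * (alpha - beta) + M%:R * M%:R * beta) -
   (2 * n * m * (N%:R * (alpha - beta) + N%:R * M%:R * beta) -
    n ^+ 2 * (N%:R * (alpha - beta) + N%:R * N%:R * beta)) =
   (M%:R * m) * m * (alpha - beta) + (M%:R * m) ^+ 2 * beta -
   2 * (N%:R * n) * m * (alpha - beta) - 2 * (N%:R * n) * (M%:R * m) * beta +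
   (N%:R * n) * n * (alpha - beta) + (N%:R * n) ^+ 2 * beta by lra.
rewrite en em.
have -> : 1 * m * (alpha - beta) + 1 ^+ 2 * beta - 2 * 1 * m * (alpha - beta) - 2 * 1 * 1 * beta +
   1 * n * (alpha - beta) + 1 ^+ 2 * beta = (alpha - beta) * (n - m) by lra.
have nm : 0 <= n - m.
  by rewrite subr_ge0 lef_pV2 ?posrE ?ltr0n// ler_nat.
rewrite ler_piMl//.
have a1 : alpha <= 1.
  rewrite -[leRHS](Ex_cst mu); apply: Ex_le => //; first exact: bmf_cst.
  by move=> pi; rewrite /xi; case: (same_cluster _ _ _).
have b0 : 0 <= beta by apply: Ex_ge0 => pi; rewrite mulr_ge0.
lra.
Qed.

(* From 2 |d| <= c d^2 + 1/c, where the weight c remains to be chosen. *)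
Let Ex_abs c N M : 0 < c -> (0 < N)%N -> (N <= M)%N ->
  \int[mu]_pi `|S M pi - S N pi| <= (c * (N%:R^-1 - M%:R^-1) + c^-1) / 2.
Proof.
move=> c0 N0 NM; apply: (@le_trans _ _ (\int[mu]_pi ((c / 2) * (S M pi - S N pi) ^+ 2 + c^-1 / 2))).
  apply: Ex_le => //.
  - by apply: bmf_norm; exact: bmfB.
  - apply: bmfD; last exact: bmf_cst.
    by apply: bmfM; [exact: bmf_cst|apply: bmf_exp; exact: bmfB].
  move=> pi; rewrite -(real_normK (num_real (S M pi - S N pi))).
  set D := `|_|; have cc : c * c^-1 = 1 by rewrite mulfV// gt_eqF.
  have i0 : 0 < c^-1 by rewrite invr_gt0.
  have := mulr_ge0 (ltW i0) (sqr_ge0 (c * D - 1)).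
  have -> : c^-1 * (c * D - 1) ^+ 2 = (c * c^-1) * (c * D ^+ 2) - 2 * (c * c^-1) * D + c^-1 by lra.
  rewrite cc; lra.
rewrite ExD; last exact: bmf_cst.
  rewrite ExZ ?Ex_cst; last by apply: bmf_exp; exact: bmfB.
  have := Ex_sqr N0 NM; have c2 : 0 <= c / 2 by lra.
  by move=> /(ler_wpM2l c2); lra.
by apply: bmfM; [exact: bmf_cst|apply: bmf_exp; exact: bmfB].
Qed.

Let S_avg N pi : `|S N pi - avg R pi l N| <= a%:R / N%:R.
Proof.
rewrite avg_sum -mulrBl normrM normfV normr_nat ler_wpM2r//.
have := @shift_sum_le R (fun y => xi y pi) a N.
by apply => // y; rewrite /xi; case: (same_cluster _ _ _).
Qed.

Let T_incr N M pi : (N <= M)%N -> T N pi <= T M pi <= T N pi + (M - N)%N%:R.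
Proof.
move=> NM; rewrite /T -(subnKC NM) big_split_ord /= lerDl lerD2l addKn.
rewrite sumr_ge0//= -[leRHS]mulr_natr mul1r -[X in _ <= X%:R]card_ord -sumr_const.
by apply: ler_sum => i _; rewrite /xi; case: (same_cluster _ _ _).
Qed.

Let S_gap N M pi : (0 < N)%N -> (N <= M)%N -> `|S M pi - S N pi| <= 2 * (M - N)%N%:R / N%:R.
Proof.
move=> N0 NM; have := T_incr pi NM; have := T_incr pi (leq0n N).
rewrite (_ : T 0 pi = 0); last by rewrite /T big_ord0.
rewrite subn0 add0r natrB//.
have n0 : 0 < N%:R :> R by rewrite ltr0n.
have m0 : 0 < M%:R :> R by rewrite ltr0n; lia.
have nm : N%:R <= M%:R :> R by rewrite ler_nat.
rewrite /S; set n := N%:R in n0 nm *; set m := M%:R in m0 nm *.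
move=> /andP[t0 tn] /andP[tm1 tm2].
rewrite ler_norml -mulNr; apply/andP; split.
  rewrite lerBrDr -mulrDl ler_pdivrMr// mulrAC ler_pdivlMr//; nra.
rewrite lerBlDr -mulrDl ler_pdivrMr// mulrAC ler_pdivlMr//; nra.
Qed.

Let cube k := (k.+1 ^ 3)%N.

Let cube_gt0 k : (0 < cube k)%N. Proof. by rewrite expn_gt0. Qed.
Let cube_le k m : (k <= m)%N -> (cube k <= cube m)%N.
Proof. by move=> km; rewrite leq_exp2r. Qed.

Let D k pi := `|S (cube k.+1) pi - S (cube k) pi|.

Let bD k : bmf (D k). Proof. by apply: bmf_norm; exact: bmfB. Qed.

Let Ex_D k : \int[mu]_pi D k pi <= 5 / 2 * (k.+1%:R^-1 - k.+2%:R^-1).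
Proof.
have x1 : 1 <= k.+1%:R :> R by rewrite ler1n.
have e2 : k.+2%:R = k.+1%:R + 1 :> R by rewrite natr1.
have := @Ex_abs (k.+1%:R * k.+2%:R) (cube k) (cube k.+1).
rewrite /cube !natrX e2; set x := k.+1%:R in x1 *.
move=> h; apply: (le_trans (h _ (cube_gt0 k) (cube_le (leqnSn k)))).
  by apply: mulr_gt0; lra.
exact: cube_increment_le.
Qed.

Let sum_Ex_D K : \sum_(0 <= k < K) \int[mu]_pi D k pi <= 5 / 2.
Proof.
apply: (@le_trans _ _ (5 / 2 * (1 - K.+1%:R^-1))).
  elim: K => [|K IH]; first by rewrite big_nil invr1 subrr mulr0.
  rewrite big_nat_recr//=; apply: (le_trans (lerD IH (Ex_D K))).
  set u := K.+1%:R^-1; set v := K.+2%:R^-1; lra.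
have : 0 <= K.+1%:R^-1 :> R by rewrite invr_ge0.
set u := K.+1%:R^-1; lra.
Qed.

Let ae_summable : {ae mu, forall pi, (\sum_(0 <= k <oo) (D k pi)%:E < +oo)%E}.
Proof.
have D0 k pi : 0 <= D k pi by exact: normr_ge0.
have eD0 k pi : (0 <= (D k pi)%:E)%E by rewrite lee_fin.
have mD k : measurable_fun setT (fun pi => (D k pi)%:E).
  by apply/measurable_EFinP; case: (bD k).
have : mu.-integrable setT (fun pi => \sum_(0 <= k <oo) (D k pi)%:E)%E.
  apply/integrableP; split; first by apply: ge0_emeasurable_sum => // k pi _ _; rewrite lee_fin.
  under eq_integral do rewrite gee0_abs ?nneseries_ge0//.
  rewrite integral_nneseries//.
  apply: (@le_lt_trans _ _ (5 / 2)%:E); last by rewrite ltry.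
  apply: lime_le; first by apply: is_cvg_nneseries => k _ _; apply: integral_ge0.
  apply: nearW => K; under eq_bigr do rewrite -EFin_Ex//.
  by rewrite sumEFin lee_fin; exact: sum_Ex_D.
move=> /(integrable_ae measurableT) [N [mN N0 NC]]; exists N; split=> // pi /= h.
apply: NC => /= h'; apply: h; have := h' I; rewrite ge0_fin_numE//.
by apply: nneseries_ge0 => k _ _; rewrite lee_fin.
Qed.

Let cvg_cube pi : (\sum_(0 <= k <oo) (D k pi)%:E < +oo)%E -> cvgn (fun k => S (cube k) pi).
Proof.
move=> fin; pose u k := S (cube k.+1) pi - S (cube k) pi.
have D0 k : 0 <= D k pi by exact: normr_ge0.
have : cvgn (series u).
  apply: normed_cvg; apply: nondecreasing_is_cvgn.
    apply/nondecreasing_seqP => n; by rewrite -subr_ge0 seriesSB; exact: normr_ge0.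
  exists (fine (\sum_(0 <= k <oo) (D k pi)%:E)%E) => _ [n _ <-].
  rewrite -lee_fin fineK; last first.
    by rewrite ge0_fin_numE// nneseries_ge0// => k _ _; rewrite lee_fin.
  rewrite /= seriesEnat/= -sumEFin; apply: nneseries_lim_ge => k _ _; exact: D0.
move=> cs; apply/cvg_ex; exists (limn (series u) + S (cube 0) pi).
rewrite (_ : (fun k => _) = (fun k => series u k + S (cube 0) pi)).
  by apply: cvgD => //; exact: cvg_cst.
by apply/funext => k; rewrite seriesEnat/= telescope_sumr// subrK.
Qed.

Let cvg_S pi (L : R) : (fun k => S (cube k) pi) @ \oo --> L -> (fun N => S N pi) @ \oo --> L.
Proof.
move=> cL; apply/cvgrPdist_lt => e e0.
have e2 : 0 < e / 2 by lra.
have /cvgrPdist_lt /(_ _ e2) [K1 _ hK1] := cL.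
have e28 : 0 < e / 28 by lra.
have [K2 hK2] := invn_lt e28.
exists (cube (maxn K1 K2)) => // N /= KN.
have ex : exists m, (N < cube m)%N.
  by exists N; rewrite /cube -addn1 expnS; apply: (@leq_trans (N + 1)); [lia|rewrite leq_pmulr// expn_gt0 addn1].
case: (ex_minnP ex) => -[|k] Nk kmin.
  by have := cube_le (leq0n (maxn K1 K2)); lia.
have kN : (cube k <= N)%N by rewrite leqNgt; apply/negP => /kmin; lia.
have Kk : (maxn K1 K2 <= k)%N.
  by rewrite leqNgt; apply/negP => /cube_le; lia.
have := S_gap pi (cube_gt0 k) kN; have := hK1 k _; rewrite /= => h1 h2.
have {}h1 : `|L - S (cube k) pi| < e / 2 by apply: h1; lia.
rewrite (_ : L - S N pi = (L - S (cube k) pi) - (S N pi - S (cube k) pi)); last by lra.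
apply: (le_lt_trans (ler_normB _ _)).
suff : 2 * (N - cube k)%:R / (cube k)%:R < e / 2 by lra.
have x1 : 1 <= k.+1%:R :> R by rewrite ler1n.
have xe : k.+1%:R^-1 < e / 28.
  apply: le_lt_trans hK2; rewrite lef_pV2 ?posrE ?ltr0n// ler_nat; lia.
apply: (@le_lt_trans _ _ (14 * k.+1%:R^-1)); last by move: xe; set u := k.+1%:R^-1; lra.
have NN : (N - cube k)%:R <= 7 * k.+1%:R ^+ 2 :> R.
  have : (N - cube k)%:R <= (cube k.+1 - cube k)%:R :> R by rewrite ler_nat; lia.
  rewrite (natrB _ (cube_le (leqnSn k))).
  rewrite /cube !natrX (_ : k.+2%:R = k.+1%:R + 1 :> R) ?natr1//.
  move: x1; set x := k.+1%:R => x1 h; apply: (le_trans h); nra.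
have c0 : 0 < (cube k)%:R :> R by rewrite ltr0n.
rewrite ler_pdivrMr// /cube natrX.
have -> : 14 * k.+1%:R^-1 * k.+1%:R ^+ 3 = 14 * k.+1%:R ^+ 2 :> R.
  by rewrite exprS mulrA -[_ * _ * k.+1%:R]mulrA mulVf ?mulr1// pnatr_eq0.
by lra.
Qed.

Let cvg_avg_of_S pi (L : R) : (fun N => S N pi) @ \oo --> L -> avg R pi l @ \oo --> L.
Proof.
apply: cvg_close; apply: cvg0_le (cvg_div_nat a%:R) => N.
by rewrite distrC; exact: S_avg.
Qed.

Let cvg_S_of_avg pi (L : R) : avg R pi l @ \oo --> L -> (fun N => S N pi) @ \oo --> L.
Proof. by apply: cvg_close; apply: cvg0_le (cvg_div_nat a%:R) => N; exact: S_avg. Qed.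

(** Membership in the cluster of [l] is an exchangeable sequence of indicators
    after [l], whose averages are Cauchy in mean square at rate [1/N]; along
    the cubes the increments are summable, and between cubes the averages
    vary little. *)
Lemma pexch_cvg : {ae mu, forall pi, cvg_avg R pi l}.
Proof.
have [N [mN N0 NC]] := ae_summable; exists N; split=> // pi /= h.
apply: NC => /= /cvg_cube /cvg_ex[L cL]; apply: h.
by apply/cvg_ex; exists L; apply: cvg_avg_of_S; exact: cvg_S.
Qed.

Let ae_cvg_S : {ae mu, forall pi, (fun N => S N pi) @ \oo --> cluster_freq R pi l}.
Proof.
have [N [mN N0 NC]] := pexch_cvg; exists N; split=> // pi /= h.
by apply: NC => /= c; apply: h; apply: cvg_S_of_avg.
Qed.

(** The prediction rule: [b] may be replaced by any later element, hence by the
    average over the first [N] of these, which converges to the frequency. *)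
Lemma pexch_freq Phi b : (l < b)%N -> bmf Phi -> fixed_from b Phi ->
  \int[mu]_pi (Phi pi * (same_cluster pi l b)%:R) =
  \int[mu]_pi (Phi pi * cluster_freq R pi l).
Proof.
move=> lb bP fP.
pose T' N pi := \sum_(i < N) xi (b + i) pi.
pose S' N pi := T' N pi / N%:R.
have bS' N : bmf (S' N).
  by apply: bmfM; [apply: bmf_sum => i _; exact: bxi|exact: bmf_cst].
have E N : (0 < N)%N -> \int[mu]_pi (Phi pi * S' N pi) = \int[mu]_pi (Phi pi * xi b pi).
  move=> N0; transitivity (\int[mu]_pi (\sum_(i < N) N%:R^-1 * (Phi pi * xi (b + i) pi))).
    apply: eq_Rintegral => pi _; rewrite /S' /T' -!mulr_sumr [RHS]mulrCA.
    by congr (_ * _); exact: mulrC.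
  rewrite Ex_sum; last by move=> i _; apply: bmfM; [exact: bmf_cst|exact: bmfM].
  rewrite (eq_bigr (fun=> N%:R^-1 * \int[mu]_pi (Phi pi * xi b pi))).
    by rewrite sumr_const card_ord -[LHS]mulr_natl mulrA mulfV ?mul1r// pnatr_eq0; lia.
  move=> i _; rewrite ExZ; last exact: bmfM.
  by congr (_ * _); apply: pexch_row => //; lia.
have [M PM] := bP.2.
have M0 : 0 <= M by apply: le_trans (PM point).
have h : (fun N => \int[mu]_pi (Phi pi * S' N pi)) @ \oo -->
    \int[mu]_pi (Phi pi * cluster_freq R pi l).
  apply: (@Ex_dct _ _ _ _ _ _ M).
  - by move=> N; have [] := bmfM bP (bS' N).
  - by have [] := bmfM bP (bmf_freq R l).
  - move=> N pi; rewrite normrM -[leRHS]mulr1; apply: ler_pM => //.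
    rewrite /S' normrM normfV normr_nat; case: N => [|N]; first by rewrite invr0 mulr0.
    rewrite ler_pdivrMr// mul1r (le_trans (ler_norm_sum _ _ _))//.
    rewrite [leRHS](_ : _ = \sum_(i < N.+1) 1); last by rewrite sumr_const card_ord.
    by apply: ler_sum => i _; rewrite /xi; case: (same_cluster _ _ _); rewrite ?normr1 ?normr0.
  have [N [mN N0 NC]] := pexch_cvg; exists N; split=> // pi /= h; apply: NC => /= c; apply: h.
  apply: cvgM; first exact: cvg_cst.
  apply: (cvg_close _ c); apply: cvg0_le (cvg_div_nat b%:R) => m.
  rewrite avg_sum -mulrBl normrM normfV normr_nat ler_wpM2r//.
  have := @shift_sum_le R (fun y => xi y pi) b m.
  by apply => // y; rewrite /xi; case: (same_cluster _ _ _).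
rewrite -(cvg_lim _ h)//; symmetry; apply: cvg_lim => //.
apply: cvg_near_cst; exists 1%N => // N /= N0; exact: E.
Qed.

(** The bound does not depend on the law, as the variance of an average of
    exchangeable indicators is controlled by their number only. *)
Lemma Ex_avg_freq c N : 0 < c -> (0 < N)%N ->
  \int[mu]_pi `|avg R pi l N - cluster_freq R pi l| <=
  a%:R / N%:R + (c / N%:R + c^-1) / 2.
Proof.
move=> c0 N0.
have bSN := bmfB (bS N) (bmf_freq R l).
have h : \int[mu]_pi `|S N pi - cluster_freq R pi l| <= (c / N%:R + c^-1) / 2.
  have cv : (fun M => \int[mu]_pi `|S N pi - S M pi|) @ \oo -->
      \int[mu]_pi `|S N pi - cluster_freq R pi l|.
    apply: (@Ex_dct _ _ _ _ _ _ 2).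
    - by move=> M; have [] := bmf_norm (bmfB (bS N) (bS M)).
    - by have [] := bmf_norm bSN.
    - have S1 M pi : 0 <= S M pi <= 1.
        rewrite /S; have := T_incr pi (leq0n M).
        rewrite (_ : T 0 pi = 0); last by rewrite /T big_ord0.
        rewrite subn0 add0r => /andP[t0 tM]; rewrite divr_ge0//=.
        case: M t0 tM => [|M] t0 tM; first by rewrite invr0 mulr0.
        by rewrite ler_pdivrMr// mul1r.
      move=> M pi; have := S1 N pi; have := S1 M pi => /andP[? ?] /andP[? ?].
      by rewrite normr_id ler_norml; apply/andP; split; lra.
    have [Z [mZ Z0 ZC]] := ae_cvg_S; exists Z; split=> // pi /= h; apply: ZC => /= c'; apply: h.
    by apply: cvg_norm; apply: cvgB => //; exact: cvg_cst.
  rewrite -(cvg_lim _ cv)//; apply: limr_le; first by apply/cvg_ex; eexists; exact: cv.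
  exists N => // M /= NM; under eq_Rintegral do rewrite distrC.
  apply: (le_trans (Ex_abs c0 N0 NM)).
  have : 0 <= M%:R^-1 :> R by rewrite invr_ge0.
  rewrite ler_pM2r//; set u := M%:R^-1 => u0; rewrite lerD2r ler_pM2l//; lra.
rewrite -[X in X + _](Ex_cst mu); apply: le_trans (lerD (lexx _) h).
rewrite -ExD; [|exact: bmf_cst|exact: bmf_norm].
apply: Ex_le; [by apply/bmf_norm/bmfB; [exact: (bmf_avg R)|exact: bmf_freq]|
  by apply: bmfD; [exact: bmf_cst|exact: bmf_norm]|].
move=> pi; rewrite (_ : avg R pi l N - _ = (avg R pi l N - S N pi) + (S N pi - cluster_freq R pi l)); last by lra.
by apply: (le_trans (ler_normD _ _)); rewrite lerD2r distrC; exact: S_avg.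
Qed.

End LLN.

(** * The paintbox limit of shifted partitions *)

Section StarFreq.
Context (R : realType).
Implicit Types (pi : npart).

(** The frequencies of the clusters, each listed at the least element of its
    cluster; unlike the list in order of appearance this is a local operation. *)
Definition starfreq pi : nat -> R := fun l => (starter pi l)%:R * cluster_freq R pi l.

Definition powsum (k : nat) (x : nat -> R) : R := fine (\sum_(0 <= j <oo) (x j ^+ k)%:E)%E.

Lemma starfreq_ge0 pi l : 0 <= starfreq pi l.
Proof. by rewrite /starfreq mulr_ge0// freq_ge0. Qed.

Lemma starfreq_le1 pi l : starfreq pi l <= 1.
Proof. by rewrite /starfreq mulr_ile1 ?freq_ge0 ?freq_le1//; case: (starter _ _). Qed.

Lemma sum_starfreq_le1 pi n : \sum_(l < n) starfreq pi l <= 1.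
Proof.
rewrite (_ : \sum_(l < n) _ = \sum_(l <- [seq l <- iota 0 n | starter pi l]) cluster_freq R pi l).
  by apply: sum_freq_le1; [apply: filter_uniq; exact: iota_uniq|exact: filter_all].
rewrite big_filter [RHS]big_mkcond /= -(big_mkord xpredT (starfreq pi)) /index_iota subn0.
by apply: eq_bigr => l _; rewrite /starfreq; case: (starter _ _); rewrite ?mul1r ?mul0r.
Qed.

Lemma bmf_starfreq l : bmf (fun pi : npart => starfreq pi l).
Proof. by apply: bmfM; [exact: bmf_starter|exact: bmf_freq]. Qed.

Lemma powsum_sub (x : nat -> R) k n : (0 < k)%N -> (forall j, 0 <= x j) ->
  (forall n, \sum_(j < n) x j <= 1) -> 0 <= \sum_(j < n) x j ^+ k <= 1.
Proof.
move=> k0 x0 x1; apply/andP; split; first by apply: sumr_ge0 => j _; exact: exprn_ge0.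
apply: le_trans (x1 n); apply: ler_sum => j _; rewrite -(prednK k0) exprS ler_piMr//.
rewrite exprn_ile1//; apply: le_trans (x1 j.+1); rewrite big_ord_recr/= lerDr.
by apply: sumr_ge0.
Qed.

Lemma cvg_powsum (x : nat -> R) k : (0 < k)%N -> (forall j, 0 <= x j) ->
  (forall n, \sum_(j < n) x j <= 1) ->
  (fun n => \sum_(j < n) x j ^+ k) @ \oo --> powsum k x.
Proof.
move=> k0 x0 x1.
have c : cvgn (fun n => \sum_(j < n) x j ^+ k).
  apply: nondecreasing_is_cvgn.
    by apply/nondecreasing_seqP => n; rewrite big_ord_recr/= lerDl exprn_ge0.
  by exists 1 => _ [n _ <-]; have /andP[] := powsum_sub n k0 x0 x1.
rewrite /powsum (_ : (\sum_(0 <= j <oo) _)%E = (limn (fun n => \sum_(j < n) x j ^+ k))%:E)//.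
apply: cvg_lim => //.
rewrite (_ : (fun _ => _) = EFin \o (fun n => \sum_(j < n) x j ^+ k)).
  by apply: cvg_EFin => //; exact: nearW.
by apply/funext => n /=; rewrite sumEFin big_mkord.
Qed.

End StarFreq.

Section NewPairs.
Context (R : realType) (mu : probability npart R) (pe : pexch mu).

(** The probability that [n] starts a cluster to which a given later element
    belongs; it does not depend on the later element. *)
Definition pair_prob n : R := \int[mu]_pi ((starter pi n)%:R * (same_cluster pi n n.+1)%:R).

Lemma pair_probE n x : (n < x)%N ->
  \int[mu]_pi ((starter pi n)%:R * (same_cluster pi n x)%:R) = pair_prob n.
Proof.
move=> nx; apply: (@pexch_row R mu (fun pi => (starter pi n)%:R)) => //.
  exact: bmf_starter.
exact: fixed_from_starter.
Qed.

Lemma sum_starter_le1 (pi : npart) n x :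
  \sum_(l < n) (starter pi l)%:R * (same_cluster pi l x)%:R <= 1 :> R.
Proof.
have [sf fx _] := cluster_minP pi x.
have h l : (starter pi l)%:R * (same_cluster pi l x)%:R = (l == cluster_min pi x)%:R :> R.
  rewrite -natrM mulnb; congr (nat_of_bool _)%:R.
  by apply/andP/eqP => [[sl /(cluster_min_unique sl)->]//|->].
under eq_bigr do rewrite h.
have [fn|nf] := ltnP (cluster_min pi x) n.
  by rewrite (bigD1 (Ordinal fn))//= eqxx big1 ?addr0// => i /negbTE; rewrite -val_eqE /= => ->.
rewrite big1// => i _; rewrite (_ : (val i == _) = false)//.
by apply/eqP => e; move: (ltn_ord i); rewrite e ltnNge nf.
Qed.

(** A given element has only one cluster to join, so these probabilities are
    summable: late clusters are never joined by the near future. *)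
Lemma cvg_pair_prob : pair_prob @ \oo --> 0.
Proof.
apply: cvg_series_cvg_0; apply: nondecreasing_is_cvgn.
  apply/nondecreasing_seqP => n; rewrite -subr_ge0 seriesSB.
  by apply: Ex_ge0 => pi; rewrite mulr_ge0.
exists 1 => _ [n _ <-]; rewrite seriesEord /=.
rewrite (eq_bigr (fun k : 'I_n => \int[mu]_pi ((starter pi k)%:R * (same_cluster pi k n)%:R))).
  rewrite -Ex_sum; last by move=> i _; apply: bmfM; [exact: bmf_starter|exact: bmf_same].
  rewrite -[leRHS](Ex_cst mu); apply: Ex_le; last by move=> pi; exact: sum_starter_le1.
    by apply: bmf_sum => i _; apply: bmfM; [exact: bmf_starter|exact: bmf_same].
  exact: bmf_cst.
by move=> k _; rewrite pair_probE.
Qed.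

End NewPairs.

Section Coarser.
Context (R : realType) (m : nat) (S : {set {set 'I_m}}) (tS : finset.trivIset S).

(** In the paintbox limit these events factorize over the blocks of [S], unlike
    the events that the restriction is [S]. *)
Definition coarser (pi : npart) : bool :=
  [forall B in S, forall x in B, forall y in B, same_cluster pi (x : 'I_m) (y : 'I_m)].

Lemma coarserP pi : reflect (forall B x y, B \in S -> x \in B -> y \in B ->
  same_cluster pi (x : 'I_m) (y : 'I_m)) (coarser pi).
Proof.
apply: (iffP idP) => [h B x y BS xB yB|h].
  by move: h => /forall_inP /(_ B BS) /forall_inP /(_ x xB) /forall_inP /(_ y yB).
by apply/forall_inP => B BS; apply/forall_inP => x xB; apply/forall_inP => y yB; exact: h BS xB yB.
Qed.

Lemma coarser_agree pi rho : agree m pi rho -> coarser pi = coarser rho.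
Proof.
by move=> e; apply/coarserP/coarserP => h B x y BS xB yB; have := h B x y BS xB yB; rewrite e.
Qed.

(** The probability that the elements of each block of [S] fall together when
    they are thrown independently into clusters of frequencies [x]; an element
    in no cluster is alone, so that only blocks of size at least 2 matter. *)
Definition paintbox (x : nat -> R) : R := \prod_(B in S | (1 < #|B|)%N) powsum #|B| x.

Variables (mu : probability npart R) (pe : pexch mu).

Section Hybrid.
Variable n : nat.

(* Hybrids between the event that the blocks lie inside clusters older than n,
   for t = m, and the product of power sums, for t = 0: the elements from t on
   carry the frequency of the cluster l instead of the indicator of joining it. *)
Let theta t (x : 'I_m) (l : nat) (pi : npart) : R :=
  if (x < t)%N then (same_cluster pi l (n + x))%:R else cluster_freq R pi l.
Let G t (B : {set 'I_m}) (pi : npart) : R :=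
  \sum_(l < n) (starter pi l)%:R * \prod_(x in B) theta t x l pi.
Let H t pi : R := \prod_(B in S | (1 < #|B|)%N) G t B pi.

Let btheta t x l : bmf (theta t x l).
Proof. by rewrite /theta; case: (x < t)%N; [exact: bmf_same|exact: bmf_freq]. Qed.
Let bG t B : bmf (G t B).
Proof.
apply: bmf_sum => l _; apply: bmfM; first exact: bmf_starter.
by apply: bmf_prod => x _.
Qed.
Let bH t : bmf (H t). Proof. by apply: bmf_prod => B _. Qed.

Let theta_fixed t x l : (l < n)%N -> fixed_from (n + t) (theta t x l).
Proof.
move=> ln; rewrite /theta; case: ltnP => xt; last by apply: fixed_from_freq; lia.
by apply: fixed_from_same; lia.
Qed.

Let fixed_prod I (r : seq I) (Q : pred I) (F : I -> npart -> R) a :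
  (forall i, Q i -> fixed_from a (F i)) -> fixed_from a (fun pi => \prod_(i <- r | Q i) F i pi).
Proof. by move=> h y pi ay; apply: eq_bigr => i Qi; exact: h. Qed.

Let fixed_sum I (r : seq I) (Q : pred I) (F : I -> npart -> R) a :
  (forall i, Q i -> fixed_from a (F i)) -> fixed_from a (fun pi => \sum_(i <- r | Q i) F i pi).
Proof. by move=> h y pi ay; apply: eq_bigr => i Qi; exact: h. Qed.

Let fixed_G t B : fixed_from (n + t) (G t B).
Proof.
apply: fixed_sum => l _; apply: fixed_fromM; first by apply: fixed_from_starter; have := ltn_ord l; lia.
by apply: fixed_prod => x _; exact: theta_fixed.
Qed.

Let thetaS (t x : 'I_m) l pi : x != t -> theta t.+1 x l pi = theta t x l pi.
Proof.
move=> xt; rewrite /theta ltnS leq_eqVlt (_ : (val x == t) = false)//.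
exact/negbTE.
Qed.

(* The blocks are handled one element at a time: replacing the indicator that
   the element joins a cluster by the frequency of that cluster leaves the
   expectation unchanged. *)
Let Ex_H_step (t : 'I_m) : \int[mu]_pi H t.+1 pi = \int[mu]_pi H t pi.
Proof.
have GS (B : {set 'I_m}) pi : t \notin B -> G t.+1 B pi = G t B pi.
  move=> tB; apply: eq_bigr => l _; congr (_ * _); apply: eq_bigr => x xB.
  by apply: thetaS; apply: contraNneq tB => <-.
have [[A /and3P[AS A1 tA]]|nA] := pselect (exists A : {set 'I_m}, [&& A \in S, (1 < #|A|)%N & t \in A]); last first.
  apply: eq_Rintegral => pi _; apply: eq_bigr => B /andP[BS B1]; apply: GS.
  by apply/negP => tB; apply: nA; exists B; rewrite BS B1 tB.
have others (B : {set 'I_m}) : B \in S -> B != A -> t \notin B.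
  move=> BS BA; apply/negP => tB; move/negP: BA; apply; apply/eqP.
  by rewrite -(def_pblock tS BS tB) -(def_pblock tS AS tA).
pose Psi pi := \prod_(B in S | (1 < #|B|)%N && (B != A)) G t B pi.
pose Y (l : 'I_n) pi := Psi pi * ((starter pi l)%:R * \prod_(x in A | x != t) theta t x l pi).
have bPsi : bmf Psi by apply: bmf_prod => B _.
have bY l : bmf (Y l).
  apply: bmfM => //; apply: bmfM; first exact: bmf_starter.
  by apply: bmf_prod => x _.
have fY l : fixed_from (n + t) (Y l).
  apply: fixed_fromM; first by apply: fixed_prod => B _; exact: fixed_G.
  apply: fixed_fromM; first by apply: fixed_from_starter; have := ltn_ord l; lia.
  by apply: fixed_prod => x _; exact: theta_fixed.
have e1 pi : H t.+1 pi = \sum_(l < n) Y l pi * (same_cluster pi l (n + t))%:R.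
  rewrite /H (bigD1 A) /=; last by rewrite AS.
  rewrite (eq_bigr (G t ^~ pi)); last first.
    by move=> B /andP[/andP[BS _] BA]; apply: GS; exact: others.
  rewrite (eq_bigl (fun B : {set 'I_m} => (B \in S) && ((1 < #|B|)%N && (B != A)))); last by move=> B; rewrite andbA.
  rewrite -/(Psi pi) {1}/G mulr_suml; apply: eq_bigr => l _.
  rewrite (bigD1 t)//= {1}/theta ltnSn.
  rewrite (eq_bigr (fun x => theta t x l pi)); last by move=> x /andP[_ xt]; exact: thetaS.
  by rewrite /Y; lra.
have e2 pi : H t pi = \sum_(l < n) Y l pi * cluster_freq R pi l.
  rewrite /H (bigD1 A) /=; last by rewrite AS.
  rewrite (eq_bigl (fun B : {set 'I_m} => (B \in S) && ((1 < #|B|)%N && (B != A)))); last by move=> B; rewrite andbA.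
  rewrite -/(Psi pi) {1}/G mulr_suml; apply: eq_bigr => l _.
  by rewrite (bigD1 t)//= {1}/theta ltnn /Y; lra.
rewrite (eq_Rintegral _ (fun pi _ => e1 pi)) (eq_Rintegral _ (fun pi _ => e2 pi)).
rewrite !Ex_sum; [|by move=> l _; apply: bmfM => //; exact: bmf_freq|by move=> l _; apply: bmfM => //; exact: bmf_same].
apply: eq_bigr => l _; apply: pexch_freq => //.
by have := ltn_ord l; lia.
Qed.

Let Ex_H : \int[mu]_pi H m pi = \int[mu]_pi H 0 pi.
Proof.
suff h t : (t <= m)%N -> \int[mu]_pi H t pi = \int[mu]_pi H 0 pi by exact: h.
elim: t => // t IH tm; rewrite -IH; last exact: ltnW.
exact: (Ex_H_step (Ordinal tm)).
Qed.

Let H0E pi : H 0 pi = \prod_(B in S | (1 < #|B|)%N) \sum_(l < n) starfreq R pi l ^+ #|B|.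
Proof.
apply: eq_bigr => B /andP[_ B1]; apply: eq_bigr => l _.
rewrite /theta /= prodr_const /starfreq exprMn; congr (_ * _).
by case: (starter pi l); rewrite ?expr1n// expr0n; case: (#|_|) B1.
Qed.

(** Bounds the indicator that two of the elements [n], ..., [n + m - 1] lie in a
    cluster started by one of them. *)
Definition late_pairs pi : R := \sum_(z < m) \sum_(y < m | (z < y)%N)
  (starter pi (n + z))%:R * (same_cluster pi (n + z) (n + y))%:R.

Let GmE (B : {set 'I_m}) pi : G m B pi = \sum_(l < n) (starter pi l)%:R * \prod_(x in B) (same_cluster pi l (n + x))%:R.
Proof.
by apply: eq_bigr => l _; congr (_ * _); apply: eq_bigr => x _; rewrite /theta ltn_ord.
Qed.

Let Gm_bound (B : {set 'I_m}) pi : (1 < #|B|)%N -> 0 <= G m B pi <= 1.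
Proof.
move=> B1; rewrite GmE; apply/andP; split.
  by apply: sumr_ge0 => l _; rewrite mulr_ge0// prodr_ge0.
have /finset.set0Pn[x xB] : B != finset.set0 by rewrite -card_gt0; lia.
apply: le_trans (sum_starter_le1 R pi n (n + x)); apply: ler_sum => l _.
rewrite ler_wpM2l// (bigD1 x)//= ler_piMr//.
by apply: prodr_ile1 => y _; case: (same_cluster _ _ _); rewrite ?lexx ?ler01.
Qed.

Let late_pairs_ge pi z y : (z < y)%N -> (y < m)%N -> starter pi (n + z) ->
  same_cluster pi (n + z) (n + y) -> 1 <= late_pairs pi.
Proof.
move=> zy ym sz szy; have zm : (z < m)%N by lia.
rewrite /late_pairs (bigD1 (Ordinal zm))//= (bigD1 (Ordinal ym))//= sz szy mulr1.
by rewrite -addrA lerDl addr_ge0 ?sumr_ge0// => i _; rewrite ?mulr_ge0// sumr_ge0// => j _; rewrite mulr_ge0.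
Qed.

Let late_pairs_ge0 pi : 0 <= late_pairs pi.
Proof. by apply: sumr_ge0 => i _; apply: sumr_ge0 => j _; rewrite mulr_ge0. Qed.

Let coarser_H pi : `|(coarser (tail n pi))%:R - H m pi| <= late_pairs pi.
Proof.
have H1 : 0 <= H m pi <= 1.
  have h (B : {set 'I_m}) : (B \in S) && (1 < #|B|)%N -> 0 <= G m B pi <= 1 by move=> /andP[_ /Gm_bound].
  apply/andP; split; first by apply: prodr_ge0 => B /h /andP[].
  by apply: prodr_ile1.
have [/coarserP c|nc] := boolP (coarser (tail n pi)); last first.
  have [B [x [y [BS xB yB nxy]]]] : exists (B : {set 'I_m}) (x y : 'I_m),
      [/\ B \in S, x \in B, y \in B & ~~ same_cluster (tail n pi) (x : 'I_m) (y : 'I_m)].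
    apply: contrapT => h; move/coarserP: nc; apply => B x y BS xB yB.
    by apply: contrapT => nxy; apply: h; exists B, x, y; split=> //; apply/negP.
  have xy : x != y by apply: contraNneq nxy => ->; exact: npart_refl.
  have B1 : (1 < #|B|)%N by apply/card_gt1P; exists x, y.
  rewrite /H (bigD1 B) /= ?BS//.
  rewrite GmE big1 ?mul0r ?subrr ?normr0// => l _.
  rewrite (bigD1 x)//= (bigD1 y)/=; last by rewrite yB eq_sym.
  have [lx|nlx] := boolP (same_cluster pi l (n + x)); last by rewrite !(mul0r, mulr0).
  have [ly|nly] := boolP (same_cluster pi l (n + y)); last by rewrite !(mul0r, mulr0).
  by move: nxy; rewrite /= -(npart_eql _ lx) ly.
rewrite [X in `|X - _|](_ : _ = 1)//.
have [l1|l1] := lerP 1 (late_pairs pi).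
  by rewrite ger0_norm; [apply: le_trans l1|]; move: H1 => /andP[]; lra.
rewrite (_ : H m pi = 1) ?subrr ?normr0//.
apply: le_anti; rewrite (andP H1).2 /=.
rewrite [leLHS](_ : _ = \prod_(B in S | (1 < #|B|)%N) 1); last by rewrite big1_eq.
apply: ler_prod => B /andP[BS B1]; rewrite ler01 /=.
have [x [y [xB yB xy]]] : exists x y : 'I_m, [/\ x \in B, y \in B & (x < y)%N].
  move/card_gt1P: B1 => [x [y [xB yB]]]; rewrite neq_ltn => /orP[xy|yx].
    by exists x, y.
  by exists y, x.
have := cluster_minP pi (n + x); set f := cluster_min pi _; move=> [sf fx fle].
have rel (z : 'I_m) : z \in B -> same_cluster pi f (n + z).
  by move=> zB; apply: npart_trans fx _; have := c B x z BS xB zB.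
have fn : (f < n)%N.
  rewrite ltnNge; apply/negP => nf; move: l1; apply/negP; rewrite -leNgt.
  move: sf (rel y yB) fle; rewrite -(subnKC nf); set z := (f - n)%N => sf fy fle.
  by apply: (late_pairs_ge _ (ltn_ord y) sf fy); lia.
rewrite GmE (bigD1 (Ordinal fn))//= sf mul1r big1 ?lerDl; last first.
  by move=> z /rel ->.
by apply: sumr_ge0 => l _; rewrite mulr_ge0// prodr_ge0.
Qed.

Lemma coarser_tail_H : `|\int[mu]_pi (coarser (tail n pi))%:R -
  \int[mu]_pi (\prod_(B in S | (1 < #|B|)%N) \sum_(l < n) starfreq R pi l ^+ #|B|)| <=
  \sum_(z < m) \sum_(y < m | (z < y)%N) pair_prob mu (n + z).
Proof.
have bc : bmf (fun pi : npart => (coarser (tail n pi))%:R : R).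
  apply: (@bmf_determined _ (n + m)) => pi rho e; congr (nat_of_bool _)%:R.
  by apply: coarser_agree => i j im jm /=; apply: e; lia.
have bl z y : bmf (fun pi : npart => (starter pi (n + z))%:R * (same_cluster pi (n + z) (n + y))%:R : R).
  by apply: bmfM; [exact: bmf_starter|exact: bmf_same].
have -> : \sum_(z < m) \sum_(y < m | (z < y)%N) pair_prob mu (n + z) = \int[mu]_pi late_pairs pi.
  rewrite Ex_sum; last by move=> z _; apply: bmf_sum => y _; exact: bl.
  apply: eq_bigr => z _; rewrite Ex_sum; last by move=> y _; exact: bl.
  by apply: eq_bigr => y zy; rewrite pair_probE//; lia.
rewrite -(eq_Rintegral _ (fun pi _ => H0E pi)) -Ex_H -ExB//.
apply: (le_trans (Ex_norm _ _)); first exact: bmfB.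
apply: Ex_le => //; first by apply: bmf_norm; exact: bmfB.
by apply: bmf_sum => z _; apply: bmf_sum => y _; exact: bl.
Qed.

End Hybrid.

Lemma paintbox_partial_bound (x : nat -> R) n : (forall j, 0 <= x j) ->
  (forall n, \sum_(j < n) x j <= 1) ->
  0 <= \prod_(B in S | (1 < #|B|)%N) \sum_(l < n) x l ^+ #|B| <= 1.
Proof.
move=> x0 x1.
have h (B : {set 'I_m}) : (B \in S) && (1 < #|B|)%N -> 0 <= \sum_(l < n) x l ^+ #|B| <= 1.
  by move=> /andP[_ B1]; apply: powsum_sub => //; exact: ltnW.
apply/andP; split; first by apply: prodr_ge0 => B /h /andP[].
exact: prodr_ile1.
Qed.

Lemma cvg_paintbox_partial (x : nat -> R) : (forall j, 0 <= x j) ->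
  (forall n, \sum_(j < n) x j <= 1) ->
  (fun n => \prod_(B in S | (1 < #|B|)%N) \sum_(l < n) x l ^+ #|B|) @ \oo --> paintbox x.
Proof.
move=> x0 x1; apply: cvg_prodr => B /andP[_ B1].
by apply: cvg_powsum => //; exact: ltnW.
Qed.

(** In the far future, the partition looks as if its elements joined the
    clusters independently with the given frequencies. *)
Lemma coarser_tail_cvg :
  (fun n => \int[mu]_pi (coarser (tail n pi))%:R) @ \oo -->
  \int[mu]_pi paintbox (starfreq R pi).
Proof.
have bp n : bmf (fun pi : npart => \prod_(B in S | (1 < #|B|)%N) \sum_(l < n) starfreq R pi l ^+ #|B|).
  by apply: bmf_prod => B _; apply: bmf_sum => l _; apply: bmf_exp; exact: bmf_starfreq.
have cv : (fun n => \int[mu]_pi (\prod_(B in S | (1 < #|B|)%N) \sum_(l < n) starfreq R pi l ^+ #|B|)) @ \oo -->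
    \int[mu]_pi paintbox (starfreq R pi).
  have c pi := cvg_paintbox_partial (starfreq_ge0 R pi) (sum_starfreq_le1 R pi).
  apply: (@Ex_dct _ _ _ _ _ _ 1).
  - by move=> n; have [] := bp n.
  - apply: (@measurable_fun_cvg _ _ _ _
      (fun n pi => \prod_(B in S | (1 < #|B|)%N) \sum_(l < n) starfreq R pi l ^+ #|B|)).
      by move=> n; have [] := bp n.
    by move=> pi _; exact: c.
  - move=> n pi; rewrite ger0_norm; last first.
      by have /andP[] := paintbox_partial_bound n (starfreq_ge0 R pi) (sum_starfreq_le1 R pi).
    by have /andP[] := paintbox_partial_bound n (starfreq_ge0 R pi) (sum_starfreq_le1 R pi).
  - by apply: aeW => pi; exact: c.
apply: cvg_close cv.
apply: cvg0_le coarser_tail_H _.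
rewrite [X in _ --> X](_ : _ = \sum_(z < m) \sum_(y < m | (z < y)%N) 0); last first.
  by rewrite big1// => z _; rewrite big1.
apply: cvg_sumr => z _; apply: cvg_sumr => y _.
have := cvg_pair_prob pe; rewrite -(cvg_shiftn z).
by under eq_fun do rewrite addnC.
Qed.

End Coarser.

(** * Rearrangements and rankings *)

Section Rearrangement.
Context (R : realType).
Implicit Types (x y z : nat -> R).

(** The positive terms of both sequences agree with multiplicities, which is
    what a ranking retains of a sequence. *)
Definition rearr x y := forall t : R, 0 < t -> ([set j | x j = t] #= [set j | y j = t])%card.

Lemma rearr_sym x y : rearr x y -> rearr y x.
Proof. by move=> h t t0; rewrite card_eq_sym; exact: h. Qed.

Lemma rearr_trans y x z : rearr x y -> rearr y z -> rearr x z.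
Proof. by move=> h1 h2 t t0; apply: card_eq_trans (h1 t t0) (h2 t t0). Qed.

Lemma card_le_fun (A B : set nat) (f : nat -> nat) :
  (forall j, A j -> B (f j)) -> {in A &, injective f} -> (A #<= B)%card.
Proof.
move=> AB /inj_card_eq /card_eqPle[_ h]; apply: card_le_trans h _.
by apply: subset_card_le => _ [j Aj <-]; exact: AB.
Qed.

Lemma rearr_bij x y : rearr x y ->
  exists e : nat -> nat, set_bij [set j | 0 < x j] [set j | 0 < y j] e /\
    forall j, 0 < x j -> y (e j) = x j.
Proof.
move=> h.
have ex (t : R) : exists e : nat -> nat, 0 < t -> set_bij [set j | x j = t] [set j | y j = t] e.
  have [t0|] := boolP (0 < t); last by exists id.
  by have /pcard_eqP[f] := h t t0; exists f => _; exact: bij.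
pose E t := sval (cid (ex t)).
have EP t : 0 < t -> set_bij [set j | x j = t] [set j | y j = t] (E t).
  by rewrite /E; case: cid.
exists (fun j => E (x j) j).
have yE j : 0 < x j -> y (E (x j) j) = x j.
  by move=> /EP[hf _ _]; exact: (hf j).
split=> //; split.
- by move=> j /= xj; rewrite yE.
- move=> i j; rewrite !inE /= => xi xj e.
  have xx : x i = x j by rewrite -yE// e yE.
  by have [_ inj _] := EP _ xi; apply: inj; rewrite ?inE//= {2}xx.
- move=> j /= yj; have [_ _ sur] := EP _ yj; have [i xi <-] := sur j erefl.
  have xi' : x i = y j by [].
  by exists i => /=; rewrite xi'.
Qed.

Local Open Scope ereal_scope.

Definition terms x (h : seq nat) : realseq R := fun l => nth 0%R (map x h) l.

(** A function of the multiset of positive terms, by [tuple_sum_rearr]; tuples are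
    continued by zeros so that [G] acts on sequences. *)
Definition tuple_sum (k : nat) (G : realseq R -> \bar R) x : \bar R :=
  \esum_(h in [set h : seq nat | uniq h && (size h == k)]) G (terms x h).

Lemma esum_support (I : choiceType) (A B : set I) (a : I -> \bar R) :
  B `<=` A -> (forall i, A i -> ~ B i -> a i = 0) -> \esum_(i in A) a i = \esum_(i in B) a i.
Proof.
move=> BA a0; rewrite -[in RHS](setIidr BA) esum_mkcondr; apply: eq_esum => i Ai.
by case: (asboolP (B i)) => [Bi|nBi]; [rewrite mem_set|rewrite memNset// a0].
Qed.

(** A rearrangement matches the positive terms bijectively; tuples with a zero
    term must not contribute, as the numbers of zeros may differ. *)
Lemma tuple_sum_rearr k G x y : (forall j, 0 <= x j)%R -> (forall j, 0 <= y j)%R ->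
  (forall z l, (l < k)%N -> z l = 0%R -> G z = 0) ->
  rearr x y -> tuple_sum k G x = tuple_sum k G y.
Proof.
move=> x0 y0 G0 /rearr_bij[e [ebij eE]].
pose A := [set h : seq nat | uniq h && (size h == k)].
have supp z : (forall j, 0 <= z j)%R -> tuple_sum k G z =
    \esum_(h in A `&` [set h | all (fun j => 0 < z j)%R h]) G (terms z h).
  move=> z0; apply: esum_support => [h []//|h /andP[uh /eqP sh] nh].
  have /allPn[j jh zj] : ~~ all (fun j => 0 < z j)%R h.
    by apply/negP => ah; apply: nh; split; [rewrite /A /= uh sh eqxx|].
  apply: (G0 _ (index j h)); first by rewrite -sh index_mem.
  rewrite /terms (nth_map 0%N) ?index_mem// nth_index//.
  by apply/eqP; rewrite eq_le z0 leNgt zj.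
rewrite (supp x)// (supp y)//.
rewrite (@reindex_esum R _ _ (A `&` [set h | all (fun j => 0 < x j)%R h])
  (A `&` [set h | all (fun j => 0 < y j)%R h]) (map e)); last first.
  have [efun einj esur] := ebij; split.
  - move=> h [/= /andP[uh /eqP sh] ah]; split=> /=.
      rewrite /A /= size_map sh eqxx andbT map_inj_in_uniq// => i j ih jh.
      by apply: einj; rewrite inE /=; [exact: (allP ah)|exact: (allP ah)].
    by rewrite all_map; apply/allP => j jh /=; rewrite eE ?(allP ah j jh)//; exact: (allP ah).
  - move=> h h'; rewrite !inE => -[/= _ ah] [/= _ ah'].
    elim: h h' ah ah' => [|i h IH] [|i' h']//= /andP[xi ah] /andP[xi' ah'] [eii /IH ->]//.
    by congr (_ :: _); apply: einj; rewrite ?inE.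
  - move=> h [/= /andP[uh /eqP sh] ah].
    pose f j := xget 0%N [set i | (0 < x i)%R /\ e i = j].
    have fP j : (0 < y j)%R -> (0 < x (f j))%R /\ e (f j) = j.
      move=> yj; rewrite /f; case: xgetP => [i _ []//|no].
      by have [i xi eij] := esur j yj; case: (no i).
    have efh : map e (map f h) = h.
      rewrite -map_comp -[RHS]map_id; apply/eq_in_map => j jh /=.
      by have [] := fP j (allP ah j jh).
    exists (map f h) => //; split=> /=.
      rewrite /A /= size_map sh eqxx andbT.
      by apply: (@map_uniq _ _ e); rewrite efh.
    by rewrite all_map; apply/allP => j jh /=; have [] := fP j (allP ah j jh).
apply: eq_esum => h [_ /= ah]; congr G; apply/funext => l; rewrite /terms.
rewrite -map_comp; congr (nth _ _ l); apply/eq_in_map => j jh /=.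
by rewrite eE//; exact: (allP ah).
Qed.

Lemma tuple_sum_sum (g : R -> \bar R) x : (forall j, 0 <= g (x j)) ->
  \sum_(0 <= j <oo) g (x j) = tuple_sum 1 (fun z => g (z 0%N)) x.
Proof.
move=> g0; rewrite nneseries_esumT//.
rewrite /tuple_sum (@reindex_esum R nat _ setT _ (fun j => [:: j]))//.
split=> //; first by move=> i j _ _ [].
by move=> h /= /andP[_ /eqP]; case: h => [|j []]//= _; exists j.
Qed.

Lemma powsum_rearr k x y : (0 < k)%N -> (forall j, 0 <= x j)%R -> (forall j, 0 <= y j)%R ->
  rearr x y -> powsum k x = powsum k y.
Proof.
move=> k0 x0 y0 xy; rewrite /powsum.
rewrite (tuple_sum_sum (g := fun t => (t ^+ k)%:E)); last by move=> j; rewrite lee_fin exprn_ge0.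
rewrite (tuple_sum_sum (g := fun t => (t ^+ k)%:E)); last by move=> j; rewrite lee_fin exprn_ge0.
congr fine; apply: tuple_sum_rearr => //.
by move=> z [|l]// _ z0; rewrite z0 expr0n; case: k k0.
Qed.

End Rearrangement.

Section Ranking.
Context (R : realType) (x : nat -> R) (x_ge0 : forall j, 0 <= x j) (x_to0 : x @ \oo --> 0).

Let pickmax (F : seq nat) := xget 0%N [set i | i \notin F /\ forall l, l \notin F -> x l <= x i].

Let small (t : R) : 0 < t -> exists N, forall l, (N <= l)%N -> x l < t.
Proof.
move=> t0; have /cvgrPdist_lt /(_ _ t0) [N _ hN] := x_to0.
by exists N => l Nl; have := hN l Nl; rewrite /= sub0r normrN ger0_norm.
Qed.

Let fresh (F : seq nat) : exists i, i \notin F.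
Proof.
exists (\max_(j <- F) j).+1%N; apply/negP => h.
by have := @bigop.leq_bigmax_seq _ F xpredT id _ h isT; rewrite ltnn.
Qed.

Let pickmaxP F : pickmax F \notin F /\ forall l, l \notin F -> x l <= x (pickmax F).
Proof.
suff [i iP] : exists i, i \notin F /\ forall l, l \notin F -> x l <= x i.
  by rewrite /pickmax; case: xgetP => [j _ []//|/(_ i)].
have [[p [pF xp]]|none] := pselect (exists p, p \notin F /\ 0 < x p); last first.
  have [i iF] := fresh F; exists i; split=> // l lF.
  apply: le_trans (x_ge0 i); rewrite leNgt; apply/negP => xl.
  by apply: none; exists l.
have [N hN] := small xp.
have pM : (p < maxn N p.+1)%N by rewrite leq_max ltnSn orbT.
pose i0 := Ordinal pM.
have i0F : val i0 \notin F by [].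
have [i iF imax] := @arg_maxP _ R 'I_(maxn N p.+1) i0 (fun i => val i \notin F) (fun i => x i) i0F.
exists (i : nat); split=> // l lF; have [lM|Ml] := ltnP l (maxn N p.+1).
  exact: (imax (Ordinal lM)).
apply: le_trans (imax i0 pF); apply/ltW/hN; exact: leq_trans (leq_maxl _ _) Ml.
Qed.

Let used := fix used n := if n is k.+1 then rcons (used k) (pickmax (used k)) else [::].
Let idx n := pickmax (used n).

Let idx_used m n : (m < n)%N -> idx m \in used n.
Proof.
elim: n => // n IH; rewrite ltnS leq_eqVlt /= mem_rcons inE => /orP[/eqP ->|/IH ->].
  by rewrite eqxx.
by rewrite orbT.
Qed.

Let idx_inj : injective idx.
Proof.
have aux m n : (m < n)%N -> idx m <> idx n.
  by move=> /idx_used h e; have [] := pickmaxP (used n); rewrite -/(idx n) -e h.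
by move=> m n e; case: (ltngtP m n) => // /aux; rewrite e.
Qed.

Let used_uniq n : uniq (used n).
Proof. by elim: n => //= n IH; rewrite rcons_uniq IH andbT; case: (pickmaxP (used n)). Qed.

Let size_used n : size (used n) = n.
Proof. by elim: n => //= n IH; rewrite size_rcons IH. Qed.

Let mem_used n p : p \in used n -> exists2 m, (m < n)%N & idx m = p.
Proof.
elim: n => //= n IH; rewrite mem_rcons inE => /orP[/eqP ->|/IH[m mn <-]]; first by exists n.
by exists m => //; exact: leqW.
Qed.

Let idx_onto p : 0 < x p -> exists n, idx n = p.
Proof.
move=> xp; apply: contrapT => no; have [N hN] := small xp.
have ge n : x p <= x (idx n).
  have [_] := pickmaxP (used n); apply; apply/negP => /mem_used[m _ e].
  by apply: no; exists m.
have lt n : (idx n < N)%N.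
  by rewrite ltnNge; apply/negP => /hN; rewrite ltNge ge.
have := @uniq_leq_size _ (used N.+1) (iota 0 N) (used_uniq _).
rewrite size_used size_iota ltnn => h; suff : false by []; apply: h => p' /mem_used[m _ <-].
by rewrite mem_iota lt.
Qed.

(** List the indices by repeatedly choosing one with the largest remaining term,
    which exists as the sequence tends to zero. *)
Lemma exists_ranking : exists y, is_ranking x y.
Proof.
exists (x \o idx); split.
- by move=> j /=.
- move=> i j ij /=; elim: j ij => [|j IH]; first by rewrite leqn0 => /eqP ->.
  rewrite leq_eqVlt => /orP[/eqP -> //|/IH]; apply: le_trans.
  have [_] := pickmaxP (used j); apply; have [+ _] := pickmaxP (used j.+1).
  by apply: contra; rewrite /= mem_rcons inE => ->; rewrite orbT.
move=> t t0; rewrite card_eq_sym.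
have e : idx @` [set j | (x \o idx) j = t] = [set j | x j = t].
  apply/seteqP; split=> [_ [j /= xj <-]//|p /= xp].
  by have [|n np] := idx_onto (p := p); [rewrite xp|exists n => //=; rewrite np].
by rewrite -e card_eq_sym; apply: inj_card_eq => i j _ _; exact: idx_inj.
Qed.

End Ranking.

(** * Frequencies in order of appearance *)

Section Appearance.
Context (R : realType).
Implicit Types (pi : npart) (i j l n : nat) (t : R).

Definition app pi : realseq R := appearance_freq R 0 pi.

Lemma tail_0 pi : tail 0 pi = pi.
Proof. by apply: npart_ext. Qed.

Lemma cluster_startP pi j : match cluster_start pi j with
  | Some i => starter pi i /\ rank pi i = j
  | None => forall i, starter pi i -> rank pi i <> j end.
Proof.
rewrite /cluster_start; case: pselect => [ex|nex].
  by case: ex_minnP => i /andP[si /eqP ri] _.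
by move=> i si ri; apply: nex; exists i; rewrite /starts_cluster si -/(rank pi i) ri eqxx.
Qed.

Lemma cluster_start_some pi i : starter pi i -> cluster_start pi (rank pi i) = Some i.
Proof.
move=> si; have := cluster_startP pi (rank pi i); case: cluster_start => [k [sk rk]|/(_ i si)//].
by congr Some; apply: rank_inj sk si rk.
Qed.

Lemma appE pi j : app pi j = if cluster_start pi j is Some i then cluster_freq R pi i else 0.
Proof. by rewrite /app /appearance_freq tail_0; case: cluster_start. Qed.

(** The frequency of a cluster does not depend on its first elements, so that
    listing the clusters in their order of appearance from [n] on amounts to
    listing those of the tail. *)
Lemma appearance_tail n pi : appearance_freq R n pi = app (tail n pi).
Proof.
apply/funext => j; rewrite appE /appearance_freq; case: cluster_start => // i.
by rewrite freq_tail.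
Qed.

Lemma app_starfreq pi j : app pi j = if cluster_start pi j is Some i then starfreq R pi i else 0.
Proof.
rewrite appE; have := cluster_startP pi j; case: cluster_start => // i [si _].
by rewrite /starfreq si mul1r.
Qed.

Lemma app_ge0 pi j : 0 <= app pi j.
Proof. by rewrite app_starfreq; case: cluster_start => // i; exact: starfreq_ge0. Qed.

Lemma app_le1 pi j : app pi j <= 1.
Proof. by rewrite app_starfreq; case: cluster_start => // i; exact: starfreq_le1. Qed.

Lemma starfreq_gt0 pi l : 0 < starfreq R pi l -> starter pi l /\ 0 < cluster_freq R pi l.
Proof.
by rewrite /starfreq; case: (starter pi l); rewrite ?mul0r ?ltxx// mul1r.
Qed.

Lemma rearr_starfreq_app pi : rearr (starfreq R pi) (app pi).
Proof.
move=> t t0; have e : rank pi @` [set l | starfreq R pi l = t] = [set j | app pi j = t].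
  apply/seteqP; split=> [_ [l /= sl <-]|j /= aj].
    have [st _] := @starfreq_gt0 pi l ltac:(by rewrite sl).
    by rewrite app_starfreq cluster_start_some.
  move: aj; rewrite app_starfreq; have := cluster_startP pi j.
  case: cluster_start => [i [si ri] e|_ e]; first by exists i.
  by move: t0; rewrite -e ltxx.
rewrite -e card_eq_sym; apply: inj_card_eq => i j /set_mem /= ei /set_mem /= ej.
by apply: rank_inj; [have [] := @starfreq_gt0 pi i ltac:(by rewrite ei)|
  have [] := @starfreq_gt0 pi j ltac:(by rewrite ej)].
Qed.

Lemma freq_bounded_cluster pi l n :
  (forall y, (n <= y)%N -> ~~ same_cluster pi l y) -> cluster_freq R pi l = 0.
Proof.
move=> h; rewrite freqE; apply: cvg_lim => //; apply: cvg0_le (cvg_div_nat n%:R) => m.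
rewrite /avg normrM normfV !normr_nat ler_wpM2r// ler_nat.
have [mn|nm] := leqP m n.
  by apply: leq_trans (count_size _ _) _; rewrite size_iota.
rewrite -(subnKC (ltnW nm)) iotaD count_cat [X in (_ + X)%N](_ : _ = 0%N) ?addn0.
  by apply: leq_trans (count_size _ _) _; rewrite size_iota.
apply/eqP; rewrite -leqn0 leqNgt -has_count; apply/hasPn => y.
by rewrite mem_iota => /andP[ny _]; exact: h.
Qed.

(** A cluster of positive frequency is infinite, so that it meets every tail,
    where it has the same frequency. *)
Lemma rearr_starfreq_tail n pi : rearr (starfreq R (tail n pi)) (starfreq R pi).
Proof.
move=> t t0; apply/card_eqPle; split.
  apply: (@card_le_fun _ _ (fun l => cluster_min pi (n + l))).
    move=> l /= e; have [sl _] := @starfreq_gt0 (tail n pi) l ltac:(by rewrite e).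
    have [sf fl _] := cluster_minP pi (n + l).
    rewrite /starfreq sf (freq_related _ fl) mul1r.
    by move: e; rewrite /starfreq sl mul1r freq_tail.
  move=> i j /set_mem /= ei /set_mem /= ej e.
  have [si _] := @starfreq_gt0 (tail n pi) i ltac:(by rewrite ei).
  have [sj _] := @starfreq_gt0 (tail n pi) j ltac:(by rewrite ej).
  apply: starter_inj si sj _ => /=.
  have [_ fi _] := cluster_minP pi (n + i); have [_ fj _] := cluster_minP pi (n + j).
  by rewrite -(npart_eql _ fi) e.
pose Y k := xget 0%N [set y | (n <= y)%N /\ same_cluster pi k y].
have YP k : 0 < cluster_freq R pi k -> (n <= Y k)%N /\ same_cluster pi k (Y k).
  move=> fk; rewrite /Y; case: xgetP => [y _ []//|none].
  move: fk; rewrite (@freq_bounded_cluster pi k n) ?ltxx// => y ny.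
  by apply/negP => ky; apply: (none y).
pose g k := cluster_min (tail n pi) (Y k - n).
have gP k : starfreq R pi k = t -> starter pi k /\ [/\ starter (tail n pi) (g k),
    same_cluster pi (n + g k) k & 0 < cluster_freq R pi k].
  move=> e; have [sk fk] := @starfreq_gt0 pi k ltac:(by rewrite e).
  have [nY kY] := YP k fk; have [sg gY _] := cluster_minP (tail n pi) (Y k - n).
  split=> //; split=> //; move: gY; rewrite /= subnKC// => gY.
  by apply: npart_trans gY _; rewrite npart_sym.
apply: (@card_le_fun _ _ g).
  move=> k /= e; have [sk [sg gk _]] := gP k e.
  rewrite /starfreq sg mul1r freq_tail (freq_related _ gk).
  by move: e; rewrite /starfreq sk mul1r.
move=> i j /set_mem /= ei /set_mem /= ej e.
have [si [_ gi _]] := gP i ei; have [sj [_ gj _]] := gP j ej.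
apply: starter_inj si sj _; apply: npart_trans gj.
by rewrite -e npart_sym.
Qed.

Lemma starfreq_to0 pi : starfreq R pi @ \oo --> 0.
Proof.
apply: cvg_series_cvg_0; apply: nondecreasing_is_cvgn.
  by apply/nondecreasing_seqP => n; rewrite -subr_ge0 seriesSB; exact: starfreq_ge0.
by exists 1 => _ [n _ <-]; rewrite seriesEord/=; exact: sum_starfreq_le1.
Qed.

Lemma rank_leq pi x : (rank pi x <= x)%N.
Proof. by rewrite /rank (leq_trans (count_size _ _))// size_iota. Qed.

Lemma app_to0 pi : app pi @ \oo --> 0.
Proof.
apply/cvgrPdist_lt => e e0; have /cvgrPdist_lt /(_ _ e0)[N _ hN] := starfreq_to0 pi.
exists N => // j /= Nj; rewrite app_starfreq; have := cluster_startP pi j.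
case: cluster_start => [i [si ri]|_]; last by rewrite subrr normr0.
by apply: hN => /=; have := rank_leq pi i; lia.
Qed.

Lemma ranked_freqP pi : is_ranking (app pi) (ranked_freq R pi).
Proof.
rewrite /ranked_freq; case: xgetP => [y _ //|no].
by have [y yP] := exists_ranking (app_ge0 pi) (app_to0 pi); case: (no y).
Qed.

Lemma ranked_ge0 pi j : 0 <= ranked_freq R pi j.
Proof. by have [] := ranked_freqP pi. Qed.

Lemma rearr_ranked pi : rearr (starfreq R pi) (ranked_freq R pi).
Proof.
apply: rearr_trans (rearr_starfreq_app pi) _; have [_ _ h] := ranked_freqP pi.
by move=> t t0; exact: h.
Qed.

Lemma powsum_ranked k pi : (0 < k)%N -> powsum k (ranked_freq R pi) = powsum k (starfreq R pi).
Proof.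
move=> k0; symmetry; apply: powsum_rearr => //; last exact: rearr_ranked.
- by move=> j; exact: starfreq_ge0.
- by move=> j; exact: ranked_ge0.
Qed.

Lemma paintbox_ranked m (S : {set {set 'I_m}}) pi :
  paintbox S (ranked_freq R pi) = paintbox S (starfreq R pi).
Proof. by apply: eq_bigr => B /andP[_ B1]; apply: powsum_ranked; exact: ltnW. Qed.

(** A swap that preserves the order of appearance moves the least elements of
    the clusters without changing the order of the clusters. *)
Lemma app_oswap b pi : app (oswap b pi) = app pi.
Proof.
have [ts|nts] := boolP (two_starters b pi); first by rewrite /oswap ts.
have key rho : ~~ two_starters b rho -> forall i, starter rho i -> exists i',
   [/\ starter (oswap b rho) i', rank (oswap b rho) i' = rank rho i &
       cluster_freq R (oswap b rho) i' = cluster_freq R rho i].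
  move=> nt i si.
  have out x : (x <= b)%N || (b.+2 <= x)%N -> rank (oswap b rho) x = rank rho x.
    elim: x => [|x IH]; first by [].
    move=> xb; have [xb1|xb1] := eqVneq x b.+1; last first.
      have xb2 : (x < b)%N || (b.+1 < x)%N by move/eqP: xb1 => xb1; move: xb => /orP[]; lia.
      by rewrite !rankS starter_oswap// IH//; lia.
    have [s1 s2] := starter_pull_swap2 nt.
    have eb : rank (oswap b rho) b = rank rho b.
      have : forall y, (y <= b)%N -> rank (oswap b rho) y = rank rho y.
        elim=> // y IHy yb; rewrite !rankS starter_oswap ?IHy//; lia.
      by apply.
    rewrite xb1 !rankS eb /oswap (negbTE nt) s1 s2.
    move: nt; rewrite /two_starters.
    by case: (starter rho b); case: (starter rho b.+1) => //= _;
      case: (same_cluster rho b b.+1) => /=; lia.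
  have fr x : cluster_freq R (oswap b rho) x = cluster_freq R rho (swap b x).
    by rewrite freq_oswap (negbTE nt).
  have [s1 s2] := starter_pull_swap2 nt.
  have osE : oswap b rho = pull (swap b) rho by rewrite /oswap (negbTE nt).
  have [ib|bi|ib] := ltngtP i b.
  - exists i; split; [by rewrite starter_oswap ?ib|by apply: out; lia|by rewrite fr swap_lt].
  - have [ib1|b1i|ib1] := ltngtP i b.+1; first by lia.
      exists i; split; [by rewrite starter_oswap ?b1i ?orbT|by apply: out; lia|by rewrite fr swap_gt].
    subst i; exists b; split.
    + by rewrite osE s1 si.
    + rewrite out ?leqnn// rankS; move: nt; rewrite /two_starters si andbT => /negbTE ->.
      by rewrite addn0.
    + by rewrite fr swapl.
  - subst i; have nb1 : starter rho b.+1 = false.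
      by move: nt; rewrite /two_starters si /= => /negbTE.
    case bb1 : (same_cluster rho b b.+1).
      exists b; split; [by rewrite osE s1 si bb1 orbT|by apply: out; rewrite leqnn|].
      by rewrite fr swapl (freq_related _ bb1).
    exists b.+1; split; [by rewrite osE s2 si bb1| |by rewrite fr swapr].
    by rewrite rankS osE s1 si bb1 nb1 addn0 -osE out ?leqnn.
apply/funext => j; rewrite !appE.
have := cluster_startP pi j; case E : (cluster_start pi j) => [i|].
  move=> [si ri]; have [i' [si' ri' fi']] := key pi nts i si.
  by rewrite -ri -ri' cluster_start_some.
move=> none; have := cluster_startP (oswap b pi) j; case: cluster_start => // i [si ri].
have nts' : ~~ two_starters b (oswap b pi) by rewrite /oswap (negbTE nts) two_starters_pull.
have [i' [si' ri' _]] := key _ nts' i si; rewrite oswapK in si' ri'.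
by case: (none i' si'); rewrite ri' ri.
Qed.

Lemma bmf_app j : bmf (fun pi : npart => app pi j).
Proof.
split; last by exists 1 => pi; rewrite ger0_norm ?app_ge0 ?app_le1.
apply: (@measurable_fun_cvg _ _ _ _ (fun n pi =>
  \sum_(l < n) (starter pi l && (rank pi l == j))%:R * cluster_freq R pi l)).
  move=> n; suff [] : bmf (fun pi : npart => \sum_(l < n) (starter pi l && (rank pi l == j))%:R * cluster_freq R pi l : R) by [].
  apply: bmf_sum => l _; apply: bmfM; last exact: bmf_freq.
  apply: (@bmf_determined _ l.+1) => pi rho e; rewrite (starter_agree e)//.
  congr (nat_of_bool (_ && (_ == _)))%:R; apply: eq_in_count => x; rewrite mem_iota => xl.
  by apply: (starter_agree e); lia.
move=> pi _; rewrite appE; have := cluster_startP pi j.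
case: cluster_start => [i [si ri]|none].
  apply: cvg_near_cst; exists i.+1 => // n /= li.
  rewrite (bigD1 (Ordinal li))//= si ri eqxx mul1r big1 ?addr0// => l.
  rewrite -val_eqE /= => li'; case: (boolP (starter pi l)) => sl; last by rewrite mul0r.
  case: eqP => rl; last by rewrite mul0r.
  by move/eqP: li'; case; apply: (rank_inj sl si); rewrite rl.
apply: cvg_near_cst; exists 0%N => // n _; rewrite big1// => l _.
by case: (boolP (starter pi l)) => sl; rewrite ?mul0r//; case: eqP => [/(none _ sl)//|]; rewrite mul0r.
Qed.

Lemma measurable_app : measurable_fun setT app.
Proof.
apply: (@measurability _ _ npart (realseq R) setT app (@coord_events R)) => //.
move=> _ [_ [i [B [mB ->]]] <-].
by have [m _] := bmf_app i; exact: m.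
Qed.

End Appearance.

(** * Functionals of the law of a sequence *)

Section LawTransfer.
Context (R : realType).

(** Stated for measurable composites with [h]: those with the ranked frequencies
    are functions of the partition known to be measurable. *)
Lemma eq_law_integral d d' dE (T : measurableType d) (T' : measurableType d')
    (E : measurableType dE) (P : probability T R) (X : T -> E) (P' : probability T' R)
    (X' : T' -> E) (h : E -> \bar R) :
  eq_law P X P' X' -> measurable_fun setT h -> (forall e, 0 <= h e)%E ->
  measurable_fun setT (h \o X) -> measurable_fun setT (h \o X') ->
  (\int[P]_w h (X w) = \int[P']_w h (X' w))%E.
Proof.
move=> e mh h0 mX mX'.
pose pos (y : \bar R) := maxe y 0%E.
have mpos : measurable_fun setT pos by apply: measurable_maxe => //; exact: measurable_cst.
have pos0 y : (0 <= pos y)%E by rewrite /pos le_max lexx orbT.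
have posh y : pos (h y) = h y by rewrite /pos; apply/max_idPl.
transitivity (\int[pushforward P (h \o X)]_y pos y)%E.
  rewrite ge0_integral_pushforward//.
  by apply: eq_integral => w _ /=; rewrite posh.
transitivity (\int[pushforward P' (h \o X')]_y pos y)%E; last first.
  rewrite ge0_integral_pushforward//.
  by apply: eq_integral => w _ /=; rewrite posh.
apply: eq_measure_integral => A mA _; rewrite /pushforward.
by apply: (e (h @^-1` A)); rewrite -[X in measurable X]setTI; exact: mh.
Qed.

Lemma measurable_prodr d (T : measurableType d) I (r : seq I) (Q : pred I) (F : I -> T -> R) :
  (forall i, Q i -> measurable_fun setT (F i)) ->
  measurable_fun setT (fun x => \prod_(i <- r | Q i) F i x).
Proof.
move=> mF; elim: r => [|i r IH].
  by under eq_fun do rewrite big_nil; exact: measurable_cst.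
under eq_fun do rewrite big_cons.
by case: (boolP (Q i)) => Qi //; apply: measurable_funM => //; exact: mF.
Qed.

Lemma measurable_coord i : measurable_fun setT (fun x : realseq R => x i).
Proof.
move=> _ B mB; rewrite setTI; apply: sub_gen_smallest.
by exists i, B.
Qed.

Lemma measurable_powsum_norm k :
  measurable_fun setT (fun x : realseq R => powsum k (fun j => `|x j|)).
Proof.
apply: measurableT_comp => //; apply: ge0_emeasurable_sum => [j x _ _|j _].
  by rewrite lee_fin exprn_ge0.
by apply/measurable_EFinP; apply: measurable_funX; apply: measurableT_comp => //; exact: measurable_coord.
Qed.

Lemma measurable_paintbox_norm m (S : {set {set 'I_m}}) :
  measurable_fun setT (fun x : realseq R => paintbox S (fun j => `|x j|)).
Proof.
by apply: measurable_prodr => B _; exact: measurable_powsum_norm.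
Qed.

Lemma paintbox_ge0 m (S : {set {set 'I_m}}) (x : nat -> R) :
  (forall j, 0 <= x j) -> 0 <= paintbox S x.
Proof.
move=> x0; apply: prodr_ge0 => B _; apply/fine_ge0/nneseries_ge0 => j _ _.
by rewrite lee_fin exprn_ge0.
Qed.

Lemma bmf_paintbox m (S : {set {set 'I_m}}) :
  bmf (fun pi : npart => paintbox S (starfreq R pi)).
Proof.
have c pi := cvg_paintbox_partial (S := S) (starfreq_ge0 R pi) (sum_starfreq_le1 R pi).
split.
  apply: (@measurable_fun_cvg _ _ _ _
    (fun n pi => \prod_(B in S | (1 < #|B|)%N) \sum_(l < n) starfreq R pi l ^+ #|B|)) => [n|pi _].
    suff [] : bmf (fun pi : npart => \prod_(B in S | (1 < #|B|)%N) \sum_(l < n) starfreq R pi l ^+ #|B|) by [].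
    by apply: bmf_prod => B _; apply: bmf_sum => l _; apply: bmf_exp; exact: bmf_starfreq.
  exact: c.
exists 1 => pi; rewrite -(cvg_lim _ (c pi))//.
have cc : cvgn (fun n => \prod_(B in S | (1 < #|B|)%N) \sum_(l < n) starfreq R pi l ^+ #|B|) by apply/cvg_ex; eexists; exact: c.
have b n := paintbox_partial_bound S n (starfreq_ge0 R pi) (sum_starfreq_le1 R pi).
rewrite ger0_norm; last by apply: limr_ge; [exact: cc|apply: nearW => n; have /andP[] := b n].
by apply: limr_le; [exact: cc|apply: nearW => n; have /andP[] := b n].
Qed.

(** By [paintbox_ranked] both sides are integrals of the same measurable function
    of the ranked frequencies. *)
Lemma Ex_paintbox_ranked d d' (T : measurableType d) (T' : measurableType d')
    (P : probability T R) (Pi : T -> npart) (P' : probability T' R) (Pi' : T' -> npart)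
    m (S : {set {set 'I_m}}) :
  measurable_fun setT Pi -> measurable_fun setT Pi' ->
  eq_law P' (@ranked_freq R \o Pi') P (@ranked_freq R \o Pi) ->
  \int[P]_w paintbox S (starfreq R (Pi w)) = \int[P']_w paintbox S (starfreq R (Pi' w)).
Proof.
move=> mPi mPi' e; congr fine; symmetry.
pose h (x : realseq R) := (`|paintbox S (fun j => `|x j|)|)%:E.
have hE (pi : npart) : (paintbox S (starfreq R pi))%:E = h (ranked_freq R pi).
  rewrite /h (_ : (fun j => `|ranked_freq R pi j|) = ranked_freq R pi); last first.
    by apply/funext => j; rewrite ger0_norm// ranked_ge0.
  by rewrite paintbox_ranked ger0_norm// paintbox_ge0// => j; exact: starfreq_ge0.
have mS (d0 : measure_display) (T0 : measurableType d0) (X : T0 -> npart) :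
    measurable_fun setT X -> measurable_fun setT (h \o (@ranked_freq R \o X)).
  move=> mX; rewrite (_ : _ \o _ = (fun pi => (paintbox S (starfreq R pi))%:E) \o X).
    by apply: measurableT_comp => //; apply/measurable_EFinP; case: (bmf_paintbox S).
  by apply/funext => w /=; rewrite hE.
under eq_integral do rewrite hE; under [RHS]eq_integral do rewrite hE.
apply: (eq_law_integral e); [|by move=> x; rewrite lee_fin|exact: mS|exact: mS].
apply/measurable_EFinP; apply: measurableT_comp => //; exact: measurable_paintbox_norm.
Qed.

End LawTransfer.

(** * Moebius inversion, exchangeability and stationarity *)

Section Moebius.
Context (R : realType) (m : nat).
Implicit Types (S : {set {set 'I_m}}) (pi : npart).

Definition refines S S' := [forall B in S, forall x in B, forall y in B,
  y \in finset.pblock S' x].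

Lemma coarser_refines S pi : coarser S pi = refines S (restriction m pi).
Proof.
apply/coarserP/idP => [h|h B x y BS xB yB].
  apply/forall_inP => B BS; apply/forall_inP => x xB; apply/forall_inP => y yB.
  by rewrite in_restriction; exact: h BS xB yB.
rewrite -in_restriction.
by move: h => /forall_inP /(_ B BS) /forall_inP /(_ x xB) /forall_inP /(_ y yB).
Qed.

Let pairs S := [set p : 'I_m * 'I_m | p.2 \in finset.pblock S p.1]%SET.

Lemma Ex_coarser (mu : probability npart R) S :
  \int[mu]_pi (coarser S pi)%:R =
  \sum_S' (refines S S')%:R * \int[mu]_pi (restriction m pi == S')%:R.
Proof.
apply: Ex_determined => pi; rewrite (bigD1 (restriction m pi))//= eqxx mulr1.
rewrite coarser_refines big1 ?addr0// => S' /negbTE; rewrite eq_sym => ->.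
by rewrite mulr0.
Qed.

(** Moebius inversion, by induction from the coarse to the fine: being coarser
    than [S] means having a restriction equal to [S] or strictly coarser. *)
Lemma restriction_cvg (nu : nat -> probability npart R) (nu' : probability npart R) :
  (forall S, finset.partition S [set: 'I_m] ->
    (fun n => \int[nu n]_pi (coarser S pi)%:R) @ \oo --> \int[nu']_pi (coarser S pi)%:R) ->
  forall S, (fun n => \int[nu n]_pi (restriction m pi == S)%:R) @ \oo -->
    \int[nu']_pi (restriction m pi == S)%:R.
Proof.
move=> h S; have [k] := ubnP (m * m - #|pairs S|)%N; elim: k S => // k IH S Sk.
have unreal S' : ~ (exists rho : npart, restriction m rho = S') ->
    forall mu : probability npart R, \int[mu]_pi (restriction m pi == S')%:R = 0.
  move=> no mu; rewrite -(Ex_cst mu 0); apply: eq_Rintegral => pi _.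
  by case: eqP => // e; case: no; exists pi.
have [[rho rhoS]|no] := pselect (exists rho : npart, restriction m rho = S); last first.
  by rewrite unreal//; under eq_fun do rewrite unreal//; exact: cvg_cst.
have refSS : refines S S by rewrite -{2}rhoS -coarser_refines; apply/coarserP => B x y;
  rewrite -rhoS => BS xB yB; rewrite -in_restriction (def_pblock _ BS xB)//;
  by case/and3P: (restriction_partition m rho).
have aE (mu : probability npart R) : \int[mu]_pi (restriction m pi == S)%:R =
    \int[mu]_pi (coarser S pi)%:R -
    \sum_(S' | S' != S) (refines S S')%:R * \int[mu]_pi (restriction m pi == S')%:R.
  by rewrite Ex_coarser (bigD1 S)//= refSS mul1r addrK.
rewrite aE; under eq_fun do rewrite aE; apply: cvgB.
  by apply: h; rewrite -rhoS; exact: restriction_partition.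
apply: cvg_sumr => S' S'S.
have [ref|nref] := boolP (refines S S'); last first.
  by under eq_fun do rewrite mul0r; rewrite mul0r; exact: cvg_cst.
apply: cvgM; first exact: cvg_cst.
have [[rho' rhoS']|no] := pselect (exists rho : npart, restriction m rho = S'); last first.
  by rewrite unreal//; under eq_fun do rewrite unreal//; exact: cvg_cst.
apply: IH.
have finer (i j : 'I_m) : rho i j -> rho' i j.
  rewrite -in_restriction rhoS => ij; move: ref; rewrite -rhoS' -coarser_refines => /coarserP.
  move=> /(_ (finset.pblock S i)); apply => //.
    rewrite -rhoS; apply: pblock_mem.
    by have /and3P[/eqP -> _ _] := restriction_partition m rho; rewrite finset.in_setT.
  by rewrite -rhoS in_restriction npart_refl.
have lt : (#|pairs S| < #|pairs S'|)%N.
  apply: proper_card; rewrite finset.properEneq; apply/andP; split; last first.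
    apply/fintype.subsetP => -[i j]; rewrite !inE /= -rhoS -rhoS' !in_restriction.
    exact: finer.
  apply: contraNneq S'S => e; rewrite -rhoS -rhoS'; apply/eqP/restriction_agree => i j i_m j_m.
  have /setP /(_ (Ordinal i_m, Ordinal j_m)) := e.
  by rewrite !inE /= -rhoS -rhoS' !in_restriction.
have le : (#|pairs S'| <= m * m)%N.
  by apply: leq_trans (max_card _) _; rewrite card_prod card_ord.
by lia.
Qed.

End Moebius.

Section Exchangeable.
Context (R : realType).
Implicit Types (mu : probability npart R).

Lemma act_restriction n (s : 'S_n) (g : nat -> nat) (pi : npart0) :
  (forall i : 'I_n, g (s i) = i) ->
  act_partition s (restriction n pi) = restriction n (pull g pi).
Proof.
move=> gs; rewrite /act_partition /restriction /equivalence_partition.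
have e (i : 'I_n) : [set s y | y in [set y in [set: 'I_n] | pi i y]%SET]%SET =
    [set y in [set: 'I_n] | pull g pi (s i) y]%SET.
  apply/setP => y; rewrite !inE /= gs; apply/imsetP/idP => [[z]|].
    by rewrite !inE => iz ->; rewrite gs.
  move=> iy; exists ((s^-1)%g y); last by rewrite permKV.
  by rewrite !inE -[X in pi _ X]gs permKV.
apply/setP => A; apply/imsetP/imsetP => [[B /imsetP[i _ ->] ->]|[i _ ->]].
  by exists (s i); rewrite ?inE// e.
exists [set y in [set: 'I_n] | pi ((s^-1)%g i) y]%SET; first by apply/imsetP; exists ((s^-1)%g i); rewrite ?inE.
by rewrite e permKV.
Qed.

Lemma exch_pull mu n (s : 'S_n) (g : nat -> nat) (f : npart -> R) :
  exchangeable mu lawid -> (forall i : 'I_n, g (s i) = i) ->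
  (forall pi rho, agree n pi rho -> f pi = f rho) ->
  \int[mu]_pi f (pull g pi) = \int[mu]_pi f pi.
Proof.
move=> ex gs /(determined_expand (n := n))[c cE].
have mg : measurable_fun setT (pull g : npart -> npart) by exact: measurable_pull.
rewrite -(Ex_law mu mg); last first.
  by rewrite (funext cE); apply: bmf_sum => S _; apply: bmfM; [exact: bmf_cst|exact: bmf_restriction].
rewrite !(Ex_determined _ cE); apply: eq_bigr => S _; congr (_ * _).
apply: EFin_inj; rewrite !Ex_restriction.
change (mu [set pi | restriction n (pull g pi) = S] = mu [set pi | restriction n pi = S]).
rewrite -(ex n s S); congr (mu _); apply/seteqP.
by split=> pi /=; rewrite /lawid (act_restriction pi gs).
Qed.

Lemma exch_swap mu b n (f : npart -> R) : exchangeable mu lawid -> (b.+1 < n)%N ->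
  (forall pi rho, agree n pi rho -> f pi = f rho) ->
  \int[mu]_pi f (pull (swap b) pi) = \int[mu]_pi f pi.
Proof.
move=> ex bn; have b0 : (b < n)%N by exact: ltnW.
apply: (exch_pull (s := tperm (Ordinal b0) (Ordinal bn)) ex) => i.
case: tpermP => [->|->|/eqP + /eqP] /=; rewrite ?swapl ?swapr//.
by rewrite -!val_eqE /= /swap => /negbTE -> /negbTE ->.
Qed.

(** The event that two neighbours both start clusters is symmetric in them, so
    that the swap may be restricted to its complement. *)
Lemma exch_pexch mu : exchangeable mu lawid -> pexch mu.
Proof.
move=> ex b; suff h : forall A, measurable A -> law mu (measurable_oswap b) A = mu A by exact: h.
apply: (@npart_law_ext _ b.+2) => n S bn; rewrite -!Ex_restriction.
rewrite (Ex_law mu (measurable_oswap b)); last exact: bmf_restriction.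
congr EFin; pose f (pi : npart) : R := (restriction n pi == S)%:R.
pose t (pi : npart) : R := (two_starters b pi)%:R.
have df pi rho : agree n pi rho -> f pi = f rho.
  by move=> /restriction_agree; rewrite /f => ->.
have dt pi rho : agree n pi rho -> t pi = t rho.
  by move=> e; rewrite /t /two_starters !(starter_agree e)//; lia.
have bf : bmf f := bmf_determined df.
have bt : bmf t := bmf_determined dt.
have dh pi rho : agree n pi rho -> f pi * (1 - t pi) = f rho * (1 - t rho).
  by move=> e; rewrite (df _ _ e) (dt _ _ e).
have bh := bmf_determined dh.
have bfs : bmf (fun pi : npart => f (pull (swap b) pi) * (1 - t (pull (swap b) pi))).
  by apply: (bmf_comp bh); exact: measurable_pull.
have split (pi : npart) : f (oswap b pi) = f pi * t pi + f (pull (swap b) pi) * (1 - t (pull (swap b) pi)).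
  by rewrite /t two_starters_pull /oswap; case: ifP => _; rewrite /= ?subrr ?subr0; lra.
rewrite (eq_Rintegral _ (fun pi _ => split pi)) ExD//; last exact: bmfM.
rewrite (exch_swap ex bn dh) -ExD//; last exact: bmfM.
by apply: eq_Rintegral => pi _; rewrite -/(f pi); lra.
Qed.

(** A shift of [n] elements extends to a cyclic permutation of [n.+1] elements. *)
Lemma exch_tail1 mu A : exchangeable mu lawid -> measurable A -> mu (tail 1 @^-1` A) = mu A.
Proof.
move=> ex; move: A; suff h : forall A, measurable A -> law mu (measurable_tail 1) A = mu A by exact: h.
apply: (@npart_law_ext _ 0) => n S _; rewrite -!Ex_restriction.
rewrite (Ex_law mu (measurable_tail 1)); last exact: bmf_restriction.
congr EFin; pose f (pi : npart) : R := (restriction n pi == S)%:R.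
have df pi rho : agree n pi rho -> f pi = f rho.
  by move=> /restriction_agree; rewrite /f => ->.
pose g x := (x.+1 %% n.+1)%N.
have gs (i : 'I_n.+1) : g ((perm (@ordS_inj n.+1))^-1%g i) = i.
  by rewrite -[in RHS](permKV (perm (@ordS_inj n.+1)) i) permE.
rewrite -(exch_pull ex gs (f := f)); last by move=> pi rho e; apply: df; apply: agreeW e; lia.
apply: eq_Rintegral => pi _; apply: df => i j i_n j_n /=.
by rewrite /g !modn_small//; lia.
Qed.

Lemma tailS n (pi : npart) : tail n.+1 pi = tail 1 (tail n pi).
Proof.
have e z : (n.+1 + z = n + (1 + z))%N by lia.
by apply: npart_ext => x y; rewrite /= -!e.
Qed.

Lemma stationary_tail mu n : (forall A, measurable A -> mu (tail 1 @^-1` A) = mu A) ->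
  forall A, measurable A -> mu (tail n @^-1` A) = mu A.
Proof.
move=> h; elim: n => [|n IH] A mA.
  by congr (mu _); apply/seteqP; split=> pi /=; rewrite tail_0.
rewrite (_ : tail n.+1 @^-1` A = tail n @^-1` (tail 1 @^-1` A)).
  by rewrite IH ?h// -[X in measurable X]setTI; exact: measurable_tail.
by apply/funext => pi; rewrite /preimage /mkset tailS.
Qed.

(** The sequence of [coarser_tail_cvg] is constant under stationarity. *)
Lemma stationary_coarser mu m (S : {set {set 'I_m}}) : pexch mu -> finset.trivIset S ->
  (forall n A, measurable A -> mu (tail n @^-1` A) = mu A) ->
  \int[mu]_pi (coarser S pi)%:R = \int[mu]_pi paintbox S (starfreq R pi).
Proof.
move=> pe tS st; have c := coarser_tail_cvg tS pe.
rewrite -(cvg_lim _ c)//; symmetry; apply: cvg_lim => //.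
rewrite (_ : (fun n => _) = (fun=> \int[mu]_pi (coarser S pi)%:R)); first exact: cvg_cst.
apply/funext => n.
have bc : bmf (fun pi : npart => (coarser S pi)%:R : R).
  by apply: (@bmf_determined _ m) => pi rho e; rewrite (coarser_agree S e).
rewrite -(Ex_law mu (measurable_tail n) bc); congr fine.
by apply: eq_measure_integral => A mA _; exact: st.
Qed.

Lemma part_trivIset m (S : {set {set 'I_m}}) : finset.partition S [set: 'I_m] -> finset.trivIset S.
Proof. by case/and3P. Qed.

(** A stationary partially exchangeable partition is exchangeable: it already
    looks like its own far future, where the blocks matter only by their sizes. *)
Lemma stationary_exch mu : pexch mu ->
  (forall n A, measurable A -> mu (tail n @^-1` A) = mu A) -> exchangeable mu lawid.
Proof.
move=> pe st n s S.
pose g x := if insub x is Some i then val ((s^-1)%g i) else x.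
have gs (i : 'I_n) : g (s i) = i by rewrite /g valK /= permK.
have mg : measurable_fun setT (pull g : npart -> npart) by exact: measurable_pull.
suff h : \int[law mu mg]_pi (restriction n pi == S)%:R = \int[mu]_pi (restriction n pi == S)%:R.
  move: (congr1 EFin h); rewrite !Ex_restriction => h'.
  rewrite -[RHS]h'; change (mu [set pi | act_partition s (restriction n (lawid pi)) = S] =
    mu [set pi | restriction n (pull g pi) = S]).
  by congr (mu _); apply/seteqP; split=> pi /=; rewrite /lawid (act_restriction pi gs).
have := @restriction_cvg R n (fun=> law mu mg) mu _ S => /(_ _)/(cvg_lim (@Rhausdorff R)) <-.
  by symmetry; apply: cvg_lim => //; exact: cvg_cst.
move=> S' pS'; have tS' := part_trivIset pS'.
rewrite [X in _ --> X](_ : _ = \int[law mu mg]_pi (coarser S' pi)%:R); first exact: cvg_cst.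
have bc : bmf (fun pi : npart => (coarser S' pi)%:R : R).
  by apply: (@bmf_determined _ n) => pi rho e; rewrite (coarser_agree S' e).
rewrite (Ex_law mu mg bc).
pose u := ((s^-1)%g : 'S_n).
have guE (i : 'I_n) : g i = u i by rewrite /g valK.
have cE (pi : npart) : coarser S' (pull g pi) = coarser (act_partition u S') pi.
  apply/coarserP/coarserP => [h B x y /imsetP[C CS ->] /imsetP[x' xC ->] /imsetP[y' yC ->]|h B x y BS xB yB].
    by have := h C x' y' CS xC yC; rewrite /= !guE.
  rewrite /= !guE; apply: (h (u @: B)%SET).
  - by apply/imsetP; exists B.
  - by apply/imsetP; exists x.
  - by apply/imsetP; exists y.
have uI : injective (fun B : {set 'I_n} => u @: B)%SET by apply: imset_inj; exact: perm_inj.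
have tu : finset.trivIset (act_partition u S').
  apply/finset.trivIsetP => A B /imsetP[A' A'S ->] /imsetP[B' B'S ->] AB.
  rewrite imset_disjoint; last exact: perm_inj.
  have /finset.trivIsetP dis := tS'; apply: (dis _ _ A'S B'S).
  by apply: contraNneq AB => ->.
rewrite (eq_Rintegral _ (fun pi _ => congr1 (fun b : bool => b%:R) (cE pi))).
rewrite !stationary_coarser//; apply: eq_Rintegral => pi _; symmetry.
transitivity (\prod_(B in [set (u @: C)%SET | C : {set 'I_n} in S']%SET)
    if (1 < #|B|)%N then powsum #|B| (starfreq R pi) else 1).
  by rewrite /paintbox big_mkcondr.
rewrite big_imset /=; last by move=> A B _ _; exact: uI.
rewrite /paintbox [RHS]big_mkcondr; apply: eq_bigr => B _.
by rewrite (card_imset _ (@perm_inj _ u)).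
Qed.

End Exchangeable.

(** * PEPPFs and laws; convergence of restrictions *)

Section Compositions.
Implicit Types (c : seq nat) (f : nat -> nat).

Lemma sizes_composition n f : growing n f -> (0 < n)%N -> composition (sizes n f).
Proof.
move=> gf n0; apply/andP; split.
  by rewrite -size_eq0 size_sizes -lt0n (leq_ltn_trans _ (lt_nclusters f n0)).
have /andP[/and3P[_ _ nz] _] := clusters_in_orderP gf.
apply/negP => /mapP[A AC /esym/eqP]; rewrite cards_eq0 => /eqP A0.
by move: nz; rewrite inE -A0 AC.
Qed.

(** List the elements cluster by cluster. *)
Lemma growing_of_sizes c : 0%N \notin c -> exists n f, growing n f /\ sizes n f = c.
Proof.
elim/last_ind: c => [_|c k IH].
  by exists 0%N, id; split=> //; apply/size0nil; rewrite size_sizes /nclusters big_ord0.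
rewrite mem_rcons inE negb_or eq_sym => /andP[k0 /IH[n [f [gf szf]]]].
have Kf : nclusters n f = size c by rewrite -szf size_sizes.
pose g x := if (x < n)%N then f x else size c.
exists (n + k)%N, g; have gg : growing (n + k) g.
  move=> x i xn; rewrite /g; have [xn'|xn'] := ltnP x n => ci.
    by have [y yx fy] := gf x i xn' ci; exists y; rewrite ?(ltn_trans yx xn').
  have [y yn fy] : exists2 y, (y < n)%N & f y = i by apply: growing_onto => //; rewrite Kf.
  by exists y; rewrite ?yn//; exact: leq_trans yn xn'.
split=> //.
have mapE : [seq g x | x <- iota 0 (n + k)] = [seq f x | x <- iota 0 n] ++ nseq k (size c).
  rewrite iotaD map_cat; congr (_ ++ _).
    by apply/eq_in_map => x; rewrite mem_iota /g => /andP[_ ->].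
  apply: (@eq_from_nth _ 0%N); rewrite size_map size_iota ?size_nseq// => i ik.
  rewrite (nth_map 0%N) ?size_iota// nth_iota// nth_nseq ik /g add0n ltnNge leq_addr//.
have Kg : nclusters (n + k) g = (size c).+1.
  apply/eqP; rewrite eqn_leq; apply/andP; split.
    apply/bigmax_leqP => x _; rewrite ltnS /g; have [xn|//] := ltnP x n.
    by apply: ltnW; rewrite -Kf lt_nclusters.
  have nk : (n < n + k)%N by rewrite -ltn_subLR ?subnn ?lt0n.
  by have := lt_nclusters g nk; rewrite /g ltnn.
apply: (@eq_from_nth _ 0%N); first by rewrite size_sizes Kg size_rcons.
rewrite size_sizes Kg => i; rewrite ltnS leq_eqVlt => ic.
rewrite nth_sizes mapE count_cat -nth_sizes szf nth_rcons count_nseq /=.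
case/orP: ic => [/eqP ->|ic]; first by rewrite ltnn eqxx nth_default// mul1n.
by rewrite ic (_ : (size c == i) = false) ?addn0//; apply/eqP; lia.
Qed.

End Compositions.

Section PeppfValues.
Context (R : realType).

Section OneLaw.
Context (d : measure_display) (T : measurableType d) (P : probability T R) (Pi : T -> npart).
Hypothesis mPi : measurable_fun setT Pi.

Lemma peppfP : partially_exchangeable P Pi -> is_peppf P Pi (peppf P Pi).
Proof. by move=> [p hp]; rewrite /peppf; case: xgetP => [q _//|/(_ p)]. Qed.

Lemma pexch_of_law : partially_exchangeable P Pi <-> pexch (law P mPi).
Proof.
split=> [[p hp]|pe]; first exact: (@peppf_pexch R (law P mPi) p).
by have [p hp] := pexch_peppf pe; exists p.
Qed.

Lemma peppf_restriction n f : partially_exchangeable P Pi -> growing n f ->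
  peppf P Pi (sizes n f) = \int[law P mPi]_pi (restriction n pi == restriction n (kernel f))%:R.
Proof.
move=> pe gf; apply: EFin_inj; rewrite Ex_restriction restriction_kernel//.
by have := peppfP pe (clusters_in_orderP gf).
Qed.

End OneLaw.

(** The restrictions to the nonempty sets [n] determine the law, and their
    probabilities are the values of the PEPPF at compositions. *)
Lemma peppf_law d d' (T : measurableType d) (T' : measurableType d')
    (P : probability T R) (Pi : T -> npart) (P' : probability T' R) (Pi' : T' -> npart)
    (mPi : measurable_fun setT Pi) (mPi' : measurable_fun setT Pi') :
  partially_exchangeable P Pi -> partially_exchangeable P' Pi' ->
  eq_on_compositions (peppf P Pi) (peppf P' Pi') -> eq_law P Pi P' Pi'.
Proof.
move=> pe pe' e.
suff h : forall A, measurable A -> law P mPi A = law P' mPi' A by exact: h.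
apply: (@npart_law_ext _ 1) => n S n0.
have [[rho <-]|no] := pselect (exists rho : npart, restriction n rho = S); last first.
  rewrite (_ : [set pi | _] = set0) ?measure0//.
  by apply/seteqP; split => // pi /= e'; apply: no; exists pi.
have gf : growing n (label rho) by exact: label_growing.
rewrite -(kernel_label rho) -!Ex_restriction.
by rewrite -!peppf_restriction// e//; exact: sizes_composition.
Qed.

Lemma eq_law_peppf d d' (T : measurableType d) (T' : measurableType d')
    (P : probability T R) (Pi : T -> npart) (P' : probability T' R) (Pi' : T' -> npart) :
  eq_law P Pi P' Pi' -> peppf P Pi = peppf P' Pi'.
Proof.
move=> e; rewrite /peppf; congr (xget _ _); apply/funext => p; apply/propext.
have h n (S : {set {set 'I_n}}) : P [set w | restriction n (Pi w) = S] =
    P' [set w | restriction n (Pi' w) = S] by exact: (e _ (measurable_restriction S)).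
by split=> hp n C /hp; rewrite h.
Qed.

Lemma law_pexch_tail d (T : measurableType d) (P : probability T R) (Pi : T -> npart) n
    (mPi : measurable_fun setT Pi) : partially_exchangeable P Pi ->
  partially_exchangeable P (tail n \o Pi).
Proof.
move=> /(pexch_of_law P mPi) /(pexch_tail n) /pexch_peppf[p hp].
by exists p.
Qed.

End PeppfValues.

Section Convergence.
Context (R : realType) (mu mu' : probability npart R).
Hypotheses (pe : pexch mu) (ex' : exchangeable mu' lawid).
Hypothesis ranked_eq : eq_law mu' (@ranked_freq R) mu (@ranked_freq R).

Lemma exch_stationary n A : measurable A -> mu' (tail n @^-1` A) = mu' A.
Proof. by move=> mA; apply: stationary_tail => // B mB; exact: exch_tail1. Qed.

(** The probabilities of being coarser than a partition converge to values that
    depend on the ranked frequencies only, and which the exchangeable law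
    attains exactly. *)
Lemma restriction_tail_cvg m (S : {set {set 'I_m}}) :
  (fun n => \int[law mu (measurable_tail n)]_pi (restriction m pi == S)%:R) @ \oo -->
  \int[mu']_pi (restriction m pi == S)%:R.
Proof.
apply: (restriction_cvg (nu := fun n => law mu (measurable_tail n))) => S' pS'.
have tS' := part_trivIset pS'.
rewrite (stationary_coarser (exch_pexch ex') tS'); last exact: exch_stationary.
have bc : bmf (fun pi : npart => (coarser S' pi)%:R : R).
  by apply: (@bmf_determined _ m) => pi rho e; rewrite (coarser_agree S' e).
rewrite -(Ex_paintbox_ranked (P := mu) (Pi := id) S' _ _ ranked_eq); [|exact: measurable_id|exact: measurable_id].
under eq_fun do rewrite (Ex_law mu (measurable_tail _) bc).
exact: coarser_tail_cvg.
Qed.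

Lemma determined_tail_cvg m (f : npart -> R) : (forall pi rho, agree m pi rho -> f pi = f rho) ->
  (fun n => \int[mu]_pi f (tail n pi)) @ \oo --> \int[mu']_pi f pi.
Proof.
move=> df; have bf := bmf_determined df; have [c cE] := determined_expand df.
rewrite (Ex_determined _ cE).
under eq_fun do rewrite -(Ex_law mu (measurable_tail _) bf) (Ex_determined _ cE).
apply: cvg_sumr => S _; apply: cvgM; first exact: cvg_cst.
exact: restriction_tail_cvg.
Qed.

End Convergence.

(** * Continuous functions of finitely many coordinates *)

Section Rows.
Context (R : realType).

Lemma row_ball k (x y : 'rV[R]_k) (e : R) :
  0 < e -> (forall j, `|x ord0 j - y ord0 j| < e) -> ball x e y.
Proof.
by move=> e0 h; split => // i j; rewrite !ord1; exact: h.
Qed.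

Lemma ball_row k (x y : 'rV[R]_k) (e : R) : ball x e y -> forall j, `|x ord0 j - y ord0 j| < e.
Proof. by move=> [_ h] j; exact: (h ord0 j). Qed.

Lemma continuous_row k (f : 'rV[R]_k -> R) (x : 'rV[R]_k) (e : R) :
  continuous f -> 0 < e -> exists n : nat, forall y : 'rV[R]_k,
    (forall j, `|x ord0 j - y ord0 j| < n.+1%:R^-1) -> `|f x - f y| < e.
Proof.
move=> cf e0; have /cvgrPdist_lt /(_ _ e0) /nbhs_ballP[d /= d0 hd] := cf x.
have [n nd] := invn_lt d0; exists n => y hy; apply: hd; apply: row_ball => // j.
exact: lt_trans (hy j) nd.
Qed.

(** Heine-Cantor on the unit cube. *)
Lemma unif_continuous_row k (f : 'rV[R]_k -> R) (e : R) :
  continuous f -> 0 < e -> exists2 d : R, 0 < d & forall x y : 'rV[R]_k,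
    (forall j, 0 <= x ord0 j <= 1) ->
    (forall j, `|x ord0 j - y ord0 j| < d) -> `|f x - f y| < e.
Proof.
move=> cf e0.
have K : compact [set v : 'rV[R]_k | forall j, `[0, 1]%classic (v ord0 j : R)].
  by apply: (@rV_compact _ k (fun=> (`[0, 1]%classic : set R))) => j; exact: segment_compact.
pose P (n : nat) (x : 'rV[R]_k) := forall y : 'rV[R]_k,
  (forall j, `|x ord0 j - y ord0 j| < n.+1%:R^-1) -> `|f x - f y| < e.
have : \forall n \near \oo, [set v : 'rV[R]_k | forall j, `[0, 1]%classic (v ord0 j : R)] `<=` P n.
  move/compact_near_coveringP : K; apply => x _.
  have e2 : 0 < e / 2 by rewrite divr_gt0.
  have [n hn] := continuous_row x cf e2.
  have n0 : 0 < n.+1%:R^-1 / 2 :> R by rewrite divr_gt0// invr_gt0.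
  have [m hm] := invn_lt n0.
  exists (ball x (n.+1%:R^-1 / 2), [set i | (m <= i)%N]) => /=.
    by split; [exact: nbhsx_ballx|exists m].
  move=> [x' i] /= [/ball_row xx' mi] y hy.
  have im : i.+1%:R^-1 <= m.+1%:R^-1 :> R by rewrite lef_pV2 ?posrE ?ltr0n// ler_nat.
  rewrite (_ : f x' - f y = (f x - f y) - (f x - f x')); last by lra.
  apply: (le_lt_trans (ler_normB _ _)).
  have h1 : `|f x - f x'| < e / 2.
    by apply: hn => j; have := xx' j; move: n0; set u := n.+1%:R^-1; lra.
  have h2 : `|f x - f y| < e / 2.
    apply: hn => j; rewrite (_ : x ord0 j - y ord0 j = (x ord0 j - x' ord0 j) + (x' ord0 j - y ord0 j)); last by lra.
    apply: (le_lt_trans (ler_normD _ _)); have := xx' j; have := hy j; move: im hm.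
    by set u := n.+1%:R^-1; set v := i.+1%:R^-1; set w := m.+1%:R^-1; lra.
  by lra.
move=> [n _ /(_ n (leqnn n)) hn]; exists n.+1%:R^-1; first by rewrite invr_gt0.
move=> x y x01 hy; apply: hn => // j /=; rewrite in_itv /=; exact: x01.
Qed.

Lemma measurable_countable d (T : measurableType d) (I : countType) (h : T -> I) (F : I -> R) :
  (forall i, measurable [set w | h w = i]) -> measurable_fun setT (F \o h).
Proof.
move=> mh _ B mB; rewrite setTI.
rewrite (_ : _ @^-1` _ = \bigcup_n (if unpickle n is Some i then
   (if `[< B (F i) >] then [set w | h w = i] else set0) else set0)).
  apply: bigcupT_measurable => n; case: (unpickle n) => // i.
  by case: ifP => _; [exact: mh|exact: measurable0].
apply/seteqP; split=> [w Bw|w [n _]].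
  by exists (pickle (h w)) => //; rewrite pickleK asboolT.
by case: (unpickle n) => // i; case: asboolP => // Bi /= hw; rewrite /= hw.
Qed.

(** [f] is the limit of its values at the truncations of the coordinates to
    multiples of [n.+1%:R^-1], which take countably many values. *)
Lemma measurable_row d (T : measurableType d) k (f : 'rV[R]_k -> R) (X : T -> nat -> R) :
  continuous f -> (forall j, measurable_fun setT (X ^~ j)) ->
  (forall w j, 0 <= X w j) -> measurable_fun setT (fun w => f (\row_(j < k) X w j)).
Proof.
move=> cf mX X0.
pose q (n : nat) (w : T) (j : nat) : nat := Num.trunc (X w j * n.+1%:R).
have qP n w j : (q n w j)%:R <= X w j * n.+1%:R < (q n w j).+1%:R.
  by apply: truncn_itv; rewrite mulr_ge0.
pose Y n w : 'rV[R]_k := \row_(j < k) ((q n w j)%:R / n.+1%:R).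
have near_Y n w j : `|(\row_(j < k) X w j) ord0 j - Y n w ord0 j| <= n.+1%:R^-1.
  rewrite !mxE; have /andP[q1 q2] := qP n w j.
  have n0 : 0 < n.+1%:R :> R by rewrite ltr0n.
  rewrite ger0_norm; last by rewrite subr_ge0 ler_pdivrMr.
  rewrite lerBlDr -[X in _ <= X + _]mul1r -mulrDl ler_pdivlMr// addrC natr1.
  exact: ltW.
apply: (@measurable_fun_cvg _ _ _ _ (fun n w => f (Y n w))) => [n|w _]; last first.
  apply/cvgrPdist_lt => e e0; have [m hm] := continuous_row (\row_(j < k) X w j) cf e0.
  exists m.+1 => // n /= mn; apply: hm => j; apply: (le_lt_trans (near_Y n w j)).
  by rewrite ltf_pV2 ?posrE ?ltr0n// ltr_nat.
pose Q w : {ffun 'I_k -> nat} := [ffun j : 'I_k => q n w j].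
rewrite (_ : (fun w => f (Y n w)) =
    (fun g : {ffun 'I_k -> nat} => f (\row_j ((g j)%:R / n.+1%:R))) \o Q); last first.
  by apply/funext => w /=; congr f; apply/rowP => j; rewrite !mxE ffunE.
apply: measurable_countable => g.
rewrite (_ : [set w | _] = \bigcap_(j in [set: 'I_k]) [set w | q n w j = g j]); last first.
  apply/seteqP; split=> [w /= <- j _ /=|w h]; first by rewrite ffunE.
  by apply/ffunP => j; rewrite ffunE; exact: h.
apply: fin_bigcap_measurable => [|j _]; first exact: finite_finset.
rewrite (_ : [set w | _] = [set w | (g j)%:R <= X w j * n.+1%:R] `&` [set w | X w j * n.+1%:R < (g j).+1%:R]).
  have mXn : measurable_fun setT (fun w => X w j * n.+1%:R).
    by apply: measurable_funM => //; exact: measurable_cst.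
  apply: measurableI.
    by rewrite -[X in measurable X]setTI; apply: (measurable_fun_ler (measurable_cst _) mXn).
  by rewrite -[X in measurable X]setTI; apply: (measurable_fun_ltr mXn (measurable_cst _)).
apply/seteqP; split=> [w /= <-|w /= [h1 h2]]; first exact/andP/qP.
by apply: truncn_def; rewrite h1 h2.
Qed.

End Rows.

(** * Empirical frequencies in order of appearance *)

Lemma at_most_one (R : numDomainType) (I : finType) (b : I -> bool) (c : R) (F : I -> R) :
  (forall i i', b i -> b i' -> i = i') -> 0 <= c -> (forall i, b i -> F i <= c) ->
  \sum_i (b i)%:R * F i <= c.
Proof.
move=> uni c0 Fc; have [[i bi]|no] := pselect (exists i, b i); last first.
  by rewrite big1// => i _; case E : (b i); rewrite ?mul0r//; case: no; exists i.
rewrite (bigD1 i)//= bi mul1r big1 ?addr0 ?Fc// => k ki.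
by case E : (b k); rewrite ?mul0r//; move/eqP: ki; case; exact: uni.
Qed.

Section Empirical.
Context (R : realType) (j : nat).
Implicit Types (pi : npart) (mu : probability npart R).

Let at_rank s pi : R := (starter pi s && (rank pi s == j))%:R.

(** The proportion of the [j]-th cluster among the first [N] elements. *)
Definition emp (N : nat) pi : R := \sum_(s < N) at_rank s pi * avg R pi s N.

Lemma rank_agree n pi rho x : agree n pi rho -> (x <= n)%N -> rank pi x = rank rho x.
Proof.
move=> e xn; apply: eq_in_count => y; rewrite mem_iota => /andP[_ yx].
by apply: (starter_agree e); lia.
Qed.

Let at_rank_agree n s pi rho : agree n pi rho -> (s < n)%N -> at_rank s pi = at_rank s rho.
Proof.
by move=> e sn; rewrite /at_rank (starter_agree e)// (rank_agree e)// ltnW.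
Qed.

Lemma emp_agree N pi rho : agree N pi rho -> emp N pi = emp N rho.
Proof.
move=> e; apply: eq_bigr => s _; rewrite (at_rank_agree e)//; congr (_ * _).
by rewrite !avg_sum; congr (_ / _); apply: eq_bigr => y _; rewrite e.
Qed.

Lemma bmf_emp N : bmf (emp N).
Proof. exact: (bmf_determined (@emp_agree N)). Qed.

Let bat s : bmf (at_rank s).
Proof. by apply: (@bmf_determined _ s.+1) => pi rho e; exact: at_rank_agree e (ltnSn s). Qed.

Let at_rank_ge0 s pi : 0 <= at_rank s pi. Proof. by []. Qed.
Let at_rank_le1 s pi : at_rank s pi <= 1. Proof. by rewrite /at_rank; case: (_ && _). Qed.

(* The indicator that x is in none of the clusters started before t, these
   being at most j in number. *)
Let outside t x pi : R :=
  (rank pi t <= j)%N%:R * (1 - \sum_(l < t) (starter pi l)%:R * (same_cluster pi l x)%:R).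

Let few t pi : R := (rank pi t <= j)%N%:R.

Let bfew t : bmf (few t).
Proof. by apply: (@bmf_determined _ t) => pi rho e; rewrite /few (rank_agree e). Qed.

Let boutside t x : bmf (outside t x).
Proof.
apply: bmfM; first exact: bfew.
apply: bmfB; first exact: bmf_cst.
by apply: bmf_sum => l _; apply: bmfM; [exact: bmf_starter|exact: bmf_same].
Qed.

Let outside_ge0 t x pi : 0 <= outside t x pi.
Proof. by rewrite mulr_ge0// subr_ge0 sum_starter_le1. Qed.

Let fixed_few t : fixed_from t (few t).
Proof.
move=> y pi ty; rewrite /few; congr (_ <= _)%N%:R.
by apply: eq_in_count => x; rewrite mem_iota => /andP[_ xt]; rewrite starter_oswap//; lia.
Qed.

Let v mu t : R := \int[mu]_pi outside t t pi.

Let Ex_outside mu (Y : nat -> npart -> R) t :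
  (forall l, bmf (Y l)) ->
  \int[mu]_pi (few t pi * (1 - \sum_(l < t) (starter pi l)%:R * Y l pi)) =
  \int[mu]_pi few t pi - \sum_(l < t) \int[mu]_pi (few t pi * (starter pi l)%:R * Y l pi).
Proof.
move=> bY; have b1 l : bmf (fun pi : npart => few t pi * (starter pi l)%:R * Y l pi).
  by apply: bmfM => //; apply: bmfM => //; exact: bmf_starter.
rewrite -Ex_sum// -ExB//; last by apply: bmf_sum.
apply: eq_Rintegral => pi _; rewrite mulrBr mulr1 mulr_sumr; congr (_ - _).
by apply: eq_bigr => l _; rewrite mulrA.
Qed.

Let fixed_few_starter t (l : 'I_t) : fixed_from t (fun pi => few t pi * (starter pi l)%:R).
Proof. by apply: fixed_fromM => //; exact: fixed_from_starter. Qed.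

Let bfew_starter t l : bmf (fun pi : npart => few t pi * (starter pi l)%:R).
Proof. by apply: bmfM => //; exact: bmf_starter. Qed.

Let v_const mu t x : pexch mu -> (t <= x)%N -> \int[mu]_pi outside t x pi = v mu t.
Proof.
move=> pe tx; rewrite /v /outside.
rewrite (Ex_outside mu (Y := fun l pi => (same_cluster pi l x)%:R)); last by move=> l; exact: bmf_same.
rewrite (Ex_outside mu (Y := fun l pi => (same_cluster pi l t)%:R)); last by move=> l; exact: bmf_same.
by congr (_ - _); apply: eq_bigr => l _; apply: pexch_row.
Qed.

Let v_freq mu t : pexch mu ->
  \int[mu]_pi (few t pi * (1 - \sum_(l < t) starfreq R pi l)) = v mu t.
Proof.
move=> pe; rewrite /v /outside.
rewrite (Ex_outside mu (Y := fun l pi => cluster_freq R pi l)); last by move=> l; exact: bmf_freq.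
rewrite (Ex_outside mu (Y := fun l pi => (same_cluster pi l t)%:R)); last by move=> l; exact: bmf_same.
by congr (_ - _); apply: eq_bigr => l _; rewrite pexch_freq.
Qed.

Let v_decr mu t : pexch mu -> v mu t.+1 <= v mu t.
Proof.
move=> pe; rewrite -(v_const (x := t.+1) pe (leqnSn t)); apply: Ex_le => // pi.
rewrite /outside big_ord_recr /=; have := sum_starter_le1 R pi t.+1 t.+1.
rewrite big_ord_recr /= rankS.
set a := \sum_(_ < _) _; set b := _ * _; move=> ab.
have b0 : 0 <= b by rewrite mulr_ge0.
have [h|h] := leqP (rank pi t + starter pi t) j.
  by rewrite (leq_trans (leq_addr _ _) h) !mul1r; lra.
by rewrite mul0r mulr_ge0//; lra.
Qed.

Let vE mu t : v mu t = \int[mu]_pi (few t pi * (starter pi t)%:R).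
Proof.
apply: eq_Rintegral => pi _; rewrite /outside -/(few t pi); congr (_ * _).
have [st|nst] := boolP (starter pi t).
  rewrite big1 ?subr0// => l _; rewrite (starterF st)// mulr0//.
have [sf ft fle] := cluster_minP pi t.
have fl : (cluster_min pi t < t)%N.
  rewrite ltn_neqAle fle andbT; apply: contraNneq nst => <-; exact: sf.
rewrite (bigD1 (Ordinal fl))//= sf ft mulr1 big1 ?addr0 ?subrr// => l lf.
have [sl|] := boolP (starter pi l); last by rewrite mul0r.
have [lt|] := boolP (same_cluster pi l t); last by rewrite mulr0.
by move/eqP: lf; case; apply: val_inj => /=; rewrite (cluster_min_unique sl lt).
Qed.

Let sum_few t pi : \sum_(u < t) few u pi * (starter pi u)%:R <= j.+1%:R.
Proof.
suff -> : \sum_(u < t) few u pi * (starter pi u)%:R = (minn (rank pi t) j.+1)%:R :> R.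
  by rewrite ler_nat geq_minr.
elim: t => [|t IH]; first by rewrite big_ord0 /rank /= min0n.
rewrite big_ord_recr /= IH rankS /few -natrM -natrD; congr _%:R.
by case: (starter pi t); case: leqP; lia.
Qed.

(** At most [j.+1] elements start one of the first [j.+1] clusters, so that a
    given late element is unlikely to; the bound is uniform over the laws. *)
Let v_bound mu t : pexch mu -> v mu t <= j.+1%:R / t.+1%:R.
Proof.
move=> pe; rewrite ler_pdivlMr ?ltr0n//.
have mono s : (s <= t)%N -> v mu t <= v mu s.
  elim: t => [|t' IH]; first by rewrite leqn0 => /eqP ->.
  rewrite leq_eqVlt => /orP[/eqP ->//|/IH]; exact: le_trans (v_decr _ pe).
apply: (@le_trans _ _ (\sum_(u < t.+1) v mu u)).
  rewrite mulrC mulr_natl -[X in _ *+ X](card_ord t.+1) -sumr_const.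
  by apply: ler_sum => u _; apply: mono; rewrite -ltnS.
under eq_bigr do rewrite vE.
rewrite -Ex_sum; last by move=> u _; exact: bfew_starter.
rewrite -[leRHS](Ex_cst mu); apply: Ex_le => [| |pi]; last exact: sum_few.
- by apply: bmf_sum => u _; exact: bfew_starter.
- exact: bmf_cst.
Qed.

Let late t s pi := (t <= s)%N && (starter pi s && (rank pi s == j)).

Let late_few t s pi : late t s pi -> few t pi = 1.
Proof. by move=> /andP[/(rank_le pi) ts /andP[_ /eqP rs]]; rewrite /few -rs ts. Qed.

Let late_inj t s s' pi : late t s pi -> late t s' pi -> s = s'.
Proof.
move=> /andP[_ /andP[ss /eqP rs]] /andP[_ /andP[ss' /eqP rs']].
by apply: (rank_inj ss ss'); rewrite rs rs'.
Qed.

Let emp_split t N pi : (t <= N)%N -> emp N pi =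
  \sum_(s < t) at_rank s pi * avg R pi s N + \sum_(s < N) (late t s pi)%:R * avg R pi s N.
Proof.
move=> tN; rewrite /emp (bigID (fun s : 'I_N => (s < t)%N))/=; congr (_ + _).
  by rewrite (big_ord_narrow tN).
rewrite big_mkcond; apply: eq_bigr => s _; rewrite -leqNgt /late /at_rank.
by case: (t <= s)%N; rewrite ?mul0r.
Qed.

Let Ex_late_avg mu t N : pexch mu ->
  \int[mu]_pi (\sum_(s < N) (late t s pi)%:R * avg R pi s N) <= v mu t.
Proof.
move=> pe; have blate s : bmf (fun pi : npart => (late t s pi)%:R : R).
  apply: (@bmf_determined _ s.+1) => pi rho e; rewrite /late (starter_agree e)//.
  by rewrite (rank_agree e).
have v0 : 0 <= v mu t by apply: Ex_ge0.
have [->|N0] := posnP N.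
  by rewrite (eq_Rintegral _ (g := fun=> 0)) ?Ex_cst// => pi _; rewrite big_ord0.
rewrite (_ : \int[mu]_pi _ = \int[mu]_pi (N%:R^-1 * \sum_(x < N) \sum_(s < N) (late t s pi)%:R * (same_cluster pi s x)%:R)).
  have bb x s : bmf (fun pi : npart => (late t s pi)%:R * (same_cluster pi s x)%:R : R).
    by apply: bmfM => //; exact: bmf_same.
  rewrite ExZ; last by apply: bmf_sum => x _; apply: bmf_sum.
  rewrite Ex_sum; last by move=> x _; apply: bmf_sum.
  rewrite mulrC ler_pdivrMr ?ltr0n//.
  rewrite mulrC mulr_natl -[X in _ *+ X](card_ord N) -sumr_const; apply: ler_sum => x _.
  have [tx|xt] := leqP t x.
    rewrite -(v_const pe tx); apply: Ex_le => [| |pi]; [by apply: bmf_sum|exact: boutside|].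
    apply: (@at_most_one _ _ (fun s : 'I_N => late t s pi)) => [s s'|//|s ls].
    - by move=> ls ls'; apply: val_inj; exact: late_inj ls ls'.
    rewrite /outside -/(few t pi) (late_few ls) mul1r.
    have [sx|] := boolP (same_cluster pi s x); last first.
      by rewrite subr_ge0 => _; exact: sum_starter_le1.
    rewrite big1 ?subr0// => l _; have /andP[ts /andP[ss _]] := ls.
    have e : same_cluster pi l x = false.
      move: sx; rewrite (npart_sym pi s x) => /npart_eqr ->.
      by apply: (starterF ss); exact: leq_trans (ltn_ord l) ts.
    by rewrite e mulr0.
  rewrite (eq_Rintegral _ (g := fun=> 0)) ?Ex_cst// => pi _; rewrite big1// => s _.
  case ls : (late t s pi); last by rewrite mul0r.
  have /andP[ts /andP[ss _]] := ls.
  have e : same_cluster pi s x = false.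
    by rewrite (npart_sym pi s x); apply: (starterF ss); exact: leq_trans xt ts.
  by rewrite e mulr0.
apply: eq_Rintegral => pi _; rewrite exchange_big mulr_sumr; apply: eq_bigr => s _ /=.
by rewrite avg_sum -mulr_sumr [RHS]mulrC mulrA.
Qed.

Let app_head t pi : 0 <= app R pi j - \sum_(s < t) at_rank s pi * cluster_freq R pi s <=
  few t pi * (1 - \sum_(l < t) starfreq R pi l).
Proof.
have sf1 : 0 <= 1 - \sum_(l < t) starfreq R pi l by rewrite subr_ge0 sum_starfreq_le1.
rewrite appE; have := cluster_startP pi j; case: cluster_start => [i [si ri]|none]; last first.
  rewrite big1 ?subr0 ?lexx ?mulr_ge0// => s _; rewrite /at_rank.
  by case E : (starter pi s); rewrite ?mul0r//=; case: eqP; rewrite ?mul0r// => /(none _ E).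
have zero s : s <> i -> at_rank s pi = 0.
  move=> si'; rewrite /at_rank; case: (boolP (starter pi s)) => //= ss.
  by case: eqP => // rs; case: si'; apply: (rank_inj ss si); rewrite rs ri.
have [it|ti] := ltnP i t.
  rewrite (bigD1 (Ordinal it))//= big1 ?addr0; last first.
    by move=> s /eqP si'; rewrite zero ?mul0r// => e; apply: si'; exact: val_inj.
  by rewrite /at_rank si ri eqxx mul1r subrr lexx mulr_ge0.
rewrite big1 ?subr0; last by move=> s _; rewrite zero ?mul0r// => e; move: (ltn_ord s); rewrite e ltnNge ti.
rewrite freq_ge0 /= /few -ri (rank_le pi ti) mul1r lerBrDr.
have := sum_starfreq_le1 R pi i.+1; rewrite big_ord_recr /= {2}/starfreq si mul1r addrC.
apply: le_trans; rewrite lerD2l -[i in leRHS](subnKC ti) big_split_ord /= lerDl.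
by apply: sumr_ge0 => l _; exact: starfreq_ge0.
Qed.

(** Only finitely many least elements matter, up to a small probability, and
    for each of them the averages converge at a rate that does not depend on
    the law; so the approximation survives the shift of the partition. *)
Lemma emp_app_uniform (e : R) : 0 < e ->
  exists N0, forall N mu, (N0 <= N)%N -> pexch mu ->
    \int[mu]_pi `|emp N pi - app R pi j| <= e.
Proof.
move=> e0.
have [t ht] : exists t : nat, j.+1%:R / t.+1%:R < e / 4.
  have /cvgrPdist_lt /(_ (e / 4)) := @cvg_div_nat R j.+1%:R.
  case=> [|t _ /(_ t.+1 (leqnSn t))]; first by lra.
  by rewrite /= sub0r normrN ger0_norm ?divr_ge0//; exists t.
pose q : R := t%:R / e; pose c : R := 2 * q + 1.
have t0 : 0 <= t%:R :> R by [].
have q0 : 0 <= q by rewrite divr_ge0// ltW.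
have qe : e * q = t%:R by rewrite /q mulrC divfK// gt_eqF.
have c0 : 0 < c by rewrite /c; lra.
have tc : t%:R * (c^-1 / 2) <= e / 4.
  by rewrite mulrA ler_pdivrMr// ler_pdivrMr// /c -qe; nra.
have [N1 hN] : exists N1 : nat, forall N, (N1 <= N)%N -> t%:R * (t%:R + c) / N%:R < e / 4.
  have /cvgrPdist_lt /(_ (e / 4)) := @cvg_div_nat R (t%:R * (t%:R + c)).
  case=> [|N1 _ h]; first by lra.
  exists N1 => N /h; rewrite /= sub0r normrN ger0_norm// divr_ge0// mulr_ge0//; lra.
exists (maxn 1 (maxn t N1)) => N mu; rewrite !geq_max => /and3P[N0 tN N1N] pe.
have bl s : bmf (fun pi => `|avg R pi s N - cluster_freq R pi s|).
  by apply: bmf_norm; apply: bmfB; [exact: bmf_avg|exact: bmf_freq].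
have blate : bmf (fun pi : npart => \sum_(s < N) (late t s pi)%:R * avg R pi s N).
  apply: bmf_sum => s _; apply: bmfM; last exact: bmf_avg.
  apply: (@bmf_determined _ s.+1) => pi rho ag; rewrite /late (starter_agree ag)//.
  by rewrite (rank_agree ag).
have btop : bmf (fun pi : npart => few t pi * (1 - \sum_(l < t) starfreq R pi l)).
  apply: bmfM => //; apply: bmfB; first exact: bmf_cst.
  by apply: bmf_sum => l _; exact: bmf_starfreq.
have bsum : bmf (fun pi : npart => \sum_(s < t) `|avg R pi s N - cluster_freq R pi s|).
  exact: bmf_sum.
have split pi : `|emp N pi - app R pi j| <=
    \sum_(s < t) `|avg R pi s N - cluster_freq R pi s| +
    \sum_(s < N) (late t s pi)%:R * avg R pi s N +
    few t pi * (1 - \sum_(l < t) starfreq R pi l).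
  have /andP[h0 h1] := app_head t pi; rewrite (emp_split _ tN).
  have h2 : `|\sum_(s < t) at_rank s pi * avg R pi s N -
      \sum_(s < t) at_rank s pi * cluster_freq R pi s| <=
      \sum_(s < t) `|avg R pi s N - cluster_freq R pi s|.
    rewrite -sumrB; apply: le_trans (ler_norm_sum _ _ _) _; apply: ler_sum => s _.
    by rewrite -mulrBr normrM ger0_norm// ler_piMl.
  have h3 : 0 <= \sum_(s < N) (late t s pi)%:R * avg R pi s N.
    apply: sumr_ge0 => s _; rewrite mulr_ge0// avg_sum divr_ge0//.
    by apply: sumr_ge0 => x _.
  by move: h2; rewrite !ler_norml => /andP[h2 h2']; apply/andP; split; lra.
apply: (@le_trans _ _ (\int[mu]_pi (\sum_(s < t) `|avg R pi s N - cluster_freq R pi s| +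
    \sum_(s < N) (late t s pi)%:R * avg R pi s N +
    few t pi * (1 - \sum_(l < t) starfreq R pi l)))).
  apply: Ex_le => //; last by do 2?apply: bmfD.
  by apply: bmf_norm; apply: bmfB; [exact: bmf_emp|exact: bmf_app].
rewrite ExD//; last exact: bmfD.
rewrite ExD// v_freq// Ex_sum//.
have vt := v_bound t pe.
have lt := Ex_late_avg t N pe.
have st : \sum_(s < t) \int[mu]_pi `|avg R pi s N - cluster_freq R pi s| <=
    t%:R * (t%:R / N%:R + (c / N%:R + c^-1) / 2).
  rewrite mulr_natl -[X in _ *+ X](card_ord t) -sumr_const; apply: ler_sum => s _.
  apply: le_trans (Ex_avg_freq pe s c0 N0) _; rewrite lerD2r.
  by rewrite ler_wpM2r ?invr_ge0// ler_nat.
have {}hN := hN N N1N.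
have : t%:R * (t%:R / N%:R + (c / N%:R + c^-1) / 2) <= t%:R * (t%:R + c) / N%:R + t%:R * (c^-1 / 2).
  rewrite -mulrA -mulrDr ler_wpM2l//.
  have : 0 <= c / N%:R by rewrite divr_ge0// ltW.
  set u := N%:R^-1; set c' := c^-1; nra.
have v2 : v mu t <= e / 4 by apply: le_trans vt (ltW ht).
lra.
Qed.
End Empirical.

(** * Convergence of the finite dimensional distributions *)

Section FiniteDimensional.
Context (R : realType) (k : nat) (f : 'rV[R]_k -> R) (M : R).
Hypotheses (cf : continuous f) (fM : forall x, `|f x| <= M).
Implicit Types (mu : probability npart R) (pi : npart).

Let F pi := f (\row_(j < k) app R pi j).
Let FN N pi := f (\row_(j < k) emp R j N pi).

Let bF : bmf F.
Proof.
split; last by exists M => x; exact: fM.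
apply: (@measurable_row R _ _ k f (fun pi : npart => app R pi)) .
- exact: cf.
- by move=> j; have [m _] := bmf_app R j.
- by move=> w j; exact: app_ge0.
Qed.

Let FN_agree N pi rho : agree N pi rho -> FN N pi = FN N rho.
Proof. by move=> e; congr f; apply/rowP => j; rewrite !mxE; exact: emp_agree. Qed.

Let bFN N : bmf (FN N). Proof. exact: (bmf_determined (@FN_agree N)). Qed.

(** By uniform continuity and Markov's inequality, the law of the first
    frequencies is approximated by that of the empirical ones. *)
Let approx (e : R) : 0 < e -> exists N, forall mu, pexch mu ->
  `|\int[mu]_pi F pi - \int[mu]_pi FN N pi| <= e.
Proof.
move=> e0; have M0 : 0 <= M by apply: le_trans (fM 0).
have [d d0 hd] := unif_continuous_row cf (divr_gt0 e0 (ltr0n R 2)).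
pose K : R := 2 * M / d.
have K0 : 0 <= K by rewrite divr_ge0 ?mulr_ge0// ltW.
have k0 : 0 <= k%:R :> R by [].
have Kk0 : 0 <= K * k%:R by rewrite mulr_ge0.
pose dl : R := e / 2 / (K * k%:R + 1).
have dl0 : 0 < dl by rewrite divr_gt0 ?divr_gt0//; lra.
have dlE : dl * (K * k%:R + 1) = e / 2 by rewrite divfK// gt_eqF//; lra.
have /choice[N0 hN0] : forall j : nat, exists N0, forall N mu, (N0 <= N)%N -> pexch mu ->
    \int[mu]_pi `|emp R j N pi - app R pi j| <= dl by move=> j; exact: emp_app_uniform.
exists (\max_(j < k) N0 j)%N; set N := (X in FN X) => mu pe.
have bd (j : 'I_k) : bmf (fun pi => `|emp R j N pi - app R pi j|).
  by apply: bmf_norm; apply: bmfB; [exact: bmf_emp|exact: bmf_app].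
have bs : bmf (fun pi => \sum_(j < k) `|emp R j N pi - app R pi j|) by apply: bmf_sum.
rewrite -ExB//; apply: le_trans (Ex_norm _ (bmfB bF (bFN N))) _.
apply: (@le_trans _ _ (\int[mu]_pi (e / 2 + K * \sum_(j < k) `|emp R j N pi - app R pi j|))).
  apply: Ex_le => [| |pi].
  - by apply: bmf_norm; exact: bmfB.
  - by apply: bmfD; [exact: bmf_cst|apply: bmfM => //; exact: bmf_cst].
  have s0 : 0 <= \sum_(j < k) `|emp R j N pi - app R pi j| by apply: sumr_ge0.
  have [h|] := pselect (forall j : 'I_k, `|app R pi j - emp R j N pi| < d).
    apply: ler_wpDr; first exact: mulr_ge0.
    apply: ltW; apply: (hd (\row_(j < k) app R pi j) (\row_(j < k) emp R j N pi)) => j; rewrite !mxE//.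
    by rewrite app_ge0 app_le1.
  move=> /existsNP[j /negP]; rewrite -leNgt => dj.
  apply: (@le_trans _ _ (K * d)).
    rewrite /K divfK ?gt_eqF//; apply: le_trans (ler_normB _ _) _.
    by have := fM (\row_(j < k) app R pi j); have := fM (\row_(j < k) emp R j N pi); rewrite /F /FN; lra.
  apply: ler_wpDl; first by rewrite divr_ge0// ltW.
  apply: ler_wpM2l => //; apply: le_trans dj _.
  by rewrite distrC (bigD1 j)//= lerDl sumr_ge0.
rewrite ExD//; [|exact: bmf_cst|by apply: bmfM => //; exact: bmf_cst].
rewrite Ex_cst ExZ// Ex_sum//.
have : \sum_(j < k) \int[mu]_pi `|emp R j N pi - app R pi j| <= k%:R * dl.
  rewrite mulr_natl -[X in _ *+ X](card_ord k) -sumr_const; apply: ler_sum => j _.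
  by apply: hN0 => //; apply: bigop.leq_bigmax.
set s := \sum_(_ < _) _ => sk.
have : K * s <= K * (k%:R * dl) by rewrite ler_wpM2l.
rewrite mulrA mulrC; nra.
Qed.

Lemma Ex_app_tail_cvg mu mu' : pexch mu -> exchangeable mu' lawid ->
  eq_law mu' (@ranked_freq R) mu (@ranked_freq R) ->
  (fun n => \int[mu]_pi F (tail n pi)) @ \oo --> \int[mu']_pi F pi.
Proof.
move=> pe ex' rk; apply/cvgrPdist_le => e e0.
have [N hN] := approx (divr_gt0 e0 (ltr0n R 3)).
have := determined_tail_cvg pe ex' rk (@FN_agree N).
move=> /cvgrPdist_le /(_ _ (divr_gt0 e0 (ltr0n R 3))) [n0 _ h].
exists n0 => // n /= /h.
have := hN _ (exch_pexch ex').
have := hN _ (pexch_tail n pe).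
rewrite !Ex_law//.
rewrite !ler_norml => /andP[a1 a2] /andP[b1 b2] /andP[c1 c2].
by apply/andP; split; lra.
Qed.

End FiniteDimensional.

(** * Comparison of weighted laws *)

Import HBNNSimple.

Section Weighted.
Context (R : realType) (dE : measure_display) (E : measurableType dE).
Local Open Scope ereal_scope.

Section OneSide.
Context (d : measure_display) (T : measurableType d) (P : probability T R) (X : T -> E)
  (f : T -> R) (phi : E -> \bar R).
Hypotheses (mX : measurable_fun setT X) (mf : measurable_fun setT f) (f0 : forall w, (0 <= f w)%R).
Hypotheses (mphi : measurable_fun setT phi) (phi0 : forall x, 0 <= phi x).

Let g := nnsfun_approx measurableT mphi.

Let mind (B : set E) : measurable B -> measurable_fun setT (fun w => (\1_B (X w))%:E * (f w)%:E).
Proof.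
move=> mB; apply/measurable_EFinP; apply: measurable_funM => //.
by apply: measurableT_comp => //; exact: measurable_indic.
Qed.

Let gf n : E -> R := g n.
Let fin n : finite_set (range (gf n)). Proof. exact: (fimfunP (g n)). Qed.
Let mgf n : measurable_fun setT (gf n). Proof. exact: (measurable_funPT (g n)). Qed.
Let gf0 n x : (0 <= gf n x)%R. Proof. exact: fun_ge0. Qed.
Let part n y : \bar R := \int[P]_w ((\1_(gf n @^-1` [set y]) (X w))%:E * (f w)%:E).

Lemma weighted_approx :
  (fun n => \sum_(y \in range (gf n)) y%:E * part n y) @ \oo --> \int[P]_w (phi (X w) * (f w)%:E).
Proof.
pose h n w := (gf n (X w))%:E * (f w)%:E.
have e : (fun n => \sum_(y \in range (gf n)) y%:E * part n y) = fun n => \int[P]_w h n w.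
  apply/funext => n.
  transitivity (\sum_(y \in range (gf n)) \int[P]_w (y%:E * ((\1_(gf n @^-1` [set y]) (X w))%:E * (f w)%:E))).
    apply: eq_fsbigr => y; rewrite inE => -[x _ gy]; rewrite ge0_integralZl//.
    - by apply: mind.
    - by move=> w _; rewrite mule_ge0// lee_fin.
    - by rewrite lee_fin -gy.
  rewrite -ge0_integral_fsum//; first last.
  - move=> y w _; rewrite muleA mule_ge0// ?lee_fin//.
    exact: (nnfun_muleindic_ge0 (g n) y (X w)).
  - move=> y; apply/measurable_EFinP; apply: measurable_funM; first exact: measurable_cst.
    by apply/measurable_EFinP; exact: mind.
  apply: eq_integral => w _.
  rewrite /h [in RHS]/gf [in RHS]fimfunE -fsumEFin// ge0_mule_fsuml; last first.
    by move=> y; exact: (nnfun_muleindic_ge0 (g n) y (X w)).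
  by apply: eq_fsbigr => y _; rewrite muleA EFinM.
rewrite e (_ : \int[P]_w _ = \int[P]_w limn (h ^~ w)).
  apply: cvg_monotone_convergence => //.
  - move=> n; apply/measurable_EFinP; apply: measurable_funM => //.
    exact: measurableT_comp.
  - by move=> n w _; rewrite mule_ge0// lee_fin.
  - move=> w _ m n mn; rewrite lee_wpmul2r ?lee_fin//.
    exact/lefP/nd_nnsfun_approx.
apply: eq_integral => w _; apply/esym/cvg_lim => //; apply: cvgeZr => //.
by apply: cvg_nnsfun_approx.
Qed.
End OneSide.

(** By monotone approximation with simple functions, which are combinations of
    indicators. *)
Lemma weighted_le d d' (T : measurableType d) (T' : measurableType d')
    (P : probability T R) (X : T -> E) (f : T -> R)
    (P' : probability T' R) (X' : T' -> E) (f' : T' -> R) (phi : E -> \bar R) :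
  measurable_fun setT X -> measurable_fun setT f -> (forall w, (0 <= f w)%R) ->
  measurable_fun setT X' -> measurable_fun setT f' -> (forall w, (0 <= f' w)%R) ->
  (forall B, measurable B -> \int[P]_w ((\1_B (X w))%:E * (f w)%:E) <=
     \int[P']_w ((\1_B (X' w))%:E * (f' w)%:E)) ->
  measurable_fun setT phi -> (forall x, 0 <= phi x) ->
  \int[P]_w (phi (X w) * (f w)%:E) <= \int[P']_w (phi (X' w) * (f' w)%:E).
Proof.
move=> mX mf f0 mX' mf' f0' le mphi phi0.
have c := weighted_approx (P := P) mX mf f0 mphi phi0.
have c' := weighted_approx (P := P') mX' mf' f0' mphi phi0.
rewrite -(cvg_lim _ c)// -(cvg_lim _ c')//; apply: lee_lim.
- by apply/cvg_ex; eexists; exact: c.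
- by apply/cvg_ex; eexists; exact: c'.
apply: nearW => n; apply: lee_fsum; first exact: fimfunP.
move=> y [x _ <-]; apply: lee_wpmul2l; first by rewrite lee_fin.
by apply: le; rewrite -[X in measurable X]setTI; apply: measurable_funPT.
Qed.

End Weighted.

(** * Sums over tuples of distinct terms *)

Section Prefix.
Context (R : realType).
Implicit Types (x z : realseq R) (k l n : nat) (h : seq nat) (B : set (realseq R)).

Lemma measurable_realseq d (T : measurableType d) (X : T -> realseq R) :
  (forall i, measurable_fun setT (fun w => X w i)) -> measurable_fun setT X.
Proof.
move=> mX; apply: (@measurability _ _ T (realseq R) setT X (@coord_events R)) => //.
by move=> _ [_ [i [B [mB ->]]] <-]; exact: mX.
Qed.

Definition prefix k x : realseq R := fun l => if (l < k)%N then x l else 0.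

Definition mass l x : R := \sum_(i < l) x i.

(** The factor [1 - mass l x] is the probability that a draw with frequencies
    given by [x] avoids the first [l] terms; the maximum keeps the product
    nonnegative on arbitrary sequences. *)
Definition discovery k x : R := \prod_(l < k) Num.max 0 (1 - mass l x).

Lemma prefix_lt k x l : (l < k)%N -> prefix k x l = x l.
Proof. by rewrite /prefix => ->. Qed.

Lemma measurable_prefix k : measurable_fun setT (prefix k).
Proof.
apply: measurable_realseq => i; rewrite /prefix.
by case: (i < k)%N; [exact: measurable_coord|exact: measurable_cst].
Qed.

Lemma measurable_mass l : measurable_fun setT (mass l).
Proof. by apply: measurable_sum => i; exact: measurable_coord. Qed.

Lemma measurable_discovery k : measurable_fun setT (discovery k).
Proof.
apply: measurable_prodr => l _; apply: measurable_maxr; first exact: measurable_cst.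
by apply: measurable_funB; [exact: measurable_cst|exact: measurable_mass].
Qed.

Lemma discovery_ge0 k x : 0 <= discovery k x.
Proof. by apply: prodr_ge0 => l _; rewrite le_max lexx. Qed.

Lemma mass_prefix k l x : (l <= k)%N -> mass l (prefix k x) = mass l x.
Proof. by move=> lk; apply: eq_bigr => i _; rewrite prefix_lt// (leq_trans (ltn_ord i)). Qed.

Lemma discovery_prefix k x : discovery k.+1 (prefix k x) = discovery k.+1 x.
Proof. by apply: eq_bigr => l _; rewrite mass_prefix// -ltnS. Qed.

Lemma prefix_prefix k l x : (k <= l)%N -> prefix k (prefix l x) = prefix k x.
Proof.
move=> kl; apply/funext => i; rewrite /prefix; case: ltnP => // ik.
by rewrite (leq_trans ik kl).
Qed.

Lemma measurable_terms h : measurable_fun setT (fun x => terms x h).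
Proof.
apply: measurable_realseq => i; rewrite /terms.
have [ih|hi] := ltnP i (size h).
  rewrite (_ : (fun _ => _) = fun x : realseq R => x (nth 0%N h i)); first exact: measurable_coord.
  by apply/funext => x; rewrite (nth_map 0%N).
rewrite (_ : (fun _ => _) = fun=> 0); first exact: measurable_cst.
by apply/funext => x; rewrite nth_default// size_map.
Qed.

Lemma prefix_terms x h : prefix (size h) (terms x h) = terms x h.
Proof.
apply/funext => i; rewrite /prefix; case: ltnP => // hi.
by rewrite /terms nth_default// size_map.
Qed.

Local Open Scope ereal_scope.

(** An enumeration by integers of the tuples of distinct indices, by which sums
    over tuples become series. *)
Definition tuple_code n : seq nat := odflt [::] (unpickle n).
Definition is_tuple_code k n := [&& uniq (tuple_code n), size (tuple_code n) == k & pickle (tuple_code n) == n].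

Lemma tuple_sum_series k (G : realseq R -> \bar R) x : (forall z, 0 <= G z) ->
  tuple_sum k G x = \sum_(0 <= n <oo) (if is_tuple_code k n then G (terms x (tuple_code n)) else 0).
Proof.
move=> G0; rewrite -[RHS](eseries_mkcondr _ xpredT)/=.
rewrite nneseries_esum//= /tuple_sum.
rewrite (@reindex_esum R nat _ [set n | is_tuple_code k n] _ tuple_code)//.
split.
- by move=> n /= /and3P[-> ->].
- by move=> m n /[!inE] /and3P[_ _ /eqP em] /and3P[_ _ /eqP en] e; rewrite -em -en e.
- move=> h /= uh; exists (pickle h); last by rewrite /tuple_code pickleK.
  by rewrite /= /is_tuple_code /tuple_code pickleK /= eqxx andbT.
Qed.

Lemma measurable_tuple_sum k (G : realseq R -> \bar R) :
  (forall z, 0 <= G z) -> measurable_fun setT G ->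
  measurable_fun setT (fun x : realseq R => tuple_sum k G x).
Proof.
move=> G0 mG.
rewrite (_ : (fun _ => _) = fun x : realseq R =>
    \sum_(0 <= n <oo) (if is_tuple_code k n then G (terms x (tuple_code n)) else 0)); last first.
  by apply/funext => x; rewrite tuple_sum_series.
apply: ge0_emeasurable_sum => [n x _ _|n _]; first by case: ifP.
case: (is_tuple_code k n); last exact: measurable_cst.
exact: (measurableT_comp mG (measurable_terms (tuple_code n))).
Qed.

Lemma integral_tuple_sum d (T : measurableType d) (P : probability T R) (X : T -> realseq R) k
    (G : realseq R -> \bar R) :
  (forall z, 0 <= G z) -> measurable_fun setT G -> measurable_fun setT X ->
  \int[P]_w tuple_sum k G (X w) =
  \sum_(0 <= n <oo) (if is_tuple_code k n then \int[P]_w G (terms (X w) (tuple_code n)) else 0).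
Proof.
move=> G0 mG mX; under eq_integral do rewrite tuple_sum_series//.
rewrite integral_nneseries//; first last.
- by move=> n w _; case: ifP.
- move=> n; case: (is_tuple_code k n); last exact: measurable_cst.
  exact: (measurableT_comp mG (measurableT_comp (measurable_terms (tuple_code n)) mX)).
by apply: eq_eseriesr => n _; case: (is_tuple_code k n); rewrite ?integral0.
Qed.

Lemma tuple_sum_ge_sum k (G : realseq R -> \bar R) x (r : seq (seq nat)) :
  (forall z, 0 <= G z) -> uniq r -> (forall h, h \in r -> uniq h && (size h == k)) ->
  \sum_(h <- r) G (terms x h) <= tuple_sum k G x.
Proof.
move=> G0 ur rk; apply: esum_ge; exists [set` r].
  by split=> [|h /= /rk //]; exact: finite_seq.
by rewrite -fsbig_seq.
Qed.

(** Summed over the [k]-tuples of distinct terms of a sequence of frequencies,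
    this is the probability that [k] independent draws give distinct terms
    forming a sequence in [B]; the absolute values make it nonnegative on
    arbitrary sequences. *)
Definition drawn B k z : \bar R := (\1_B z * \prod_(l < k) `|z l|)%:E.

Lemma drawn_ge0 B k z : 0 <= drawn B k z.
Proof. by rewrite lee_fin mulr_ge0// prodr_ge0. Qed.

Lemma measurable_drawn B k : measurable B -> measurable_fun setT (drawn B k).
Proof.
move=> mB; apply/measurable_EFinP; apply: measurable_funM; first exact: measurable_indic.
apply: measurable_prodr => l _; apply: measurableT_comp => //; exact: measurable_coord.
Qed.

Lemma drawn_eq0 B k z l : (l < k)%N -> z l = 0%R -> drawn B k z = 0.
Proof.
by move=> lk zl; rewrite /drawn (bigD1 (Ordinal lk))//= zl normr0 mul0r mulr0.
Qed.

End Prefix.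

(** * Discovery of clusters by a stationary partition *)

Section Discovery.
Context (R : realType) (mu : probability npart R).
Hypothesis pe : pexch mu.
Implicit Types (Phi : npart -> R) (pi : npart) (k l n : nat) (B : set (realseq R)).

Let starters k pi : R := \prod_(l < k) (starter pi l)%:R.

Let starters01 k pi : starters k pi = 0 \/ starters k pi = 1 /\ forall l, (l < k)%N -> starter pi l.
Proof.
elim: k => [|k IH]; first by right; rewrite /starters big_ord0.
rewrite /starters big_ord_recr /= -/(starters k pi).
case: IH => [->|[-> h]]; first by left; rewrite mul0r.
rewrite mul1r; case E : (starter pi k); last by left.
by right; split=> // l; rewrite ltnS leq_eqVlt => /orP[/eqP ->//|/h].
Qed.

Let bstarters k : bmf (starters k).
Proof. by apply: bmf_prod => l _; exact: bmf_starter. Qed.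

Let rank_starters k l pi : (forall l, (l < k)%N -> starter pi l) -> (l <= k)%N -> rank pi l = l.
Proof.
move=> h; elim: l => [//|l IH] lk; rewrite rankS h// IH ?addn1//; exact: ltnW.
Qed.

Let app_starters k l pi : (forall l, (l < k)%N -> starter pi l) -> (l < k)%N ->
  app R pi l = cluster_freq R pi l.
Proof.
by move=> h lk; rewrite appE -{1}(rank_starters h (ltnW lk)) cluster_start_some// h.
Qed.

Lemma bmf_mass l : bmf (fun pi : npart => mass l (app R pi)).
Proof. by apply: bmf_sum => i _; exact: bmf_app. Qed.

Lemma bmf_discovery k : bmf (fun pi : npart => discovery k (app R pi)).
Proof.
apply: bmf_prod => l _; have [m [M hM]] := bmf_mass l; split.
  by apply: measurable_maxr; [exact: measurable_cst|apply: measurable_funB => //; exact: measurable_cst].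
exists (1 + M) => pi; have := hM pi; rewrite ler_norml => /andP[h1 h2].
by rewrite ger0_norm ?le_max ?lexx// ge_max; apply/andP; split; lra.
Qed.

Let fixed_starters k : fixed_from k (starters k).
Proof.
by move=> y pi ky; apply: eq_bigr => l _; rewrite starter_oswap//; have := ltn_ord l; lia.
Qed.

(* While the first k elements start clusters, the first k frequencies in order
   of appearance are theirs, and the next element starts a cluster with
   probability one minus these frequencies. *)
Let discovery_starters k Phi : bmf Phi -> (forall b pi, Phi (oswap b pi) = Phi pi) ->
  \int[mu]_pi (Phi pi * discovery k (app R pi)) = \int[mu]_pi (Phi pi * starters k pi).
Proof.
elim: k Phi => [|k IH] Phi bPhi inv.
  by apply: eq_Rintegral => pi _; rewrite /discovery /starters !big_ord0.
pose c pi := Num.max 0 (1 - mass k (app R pi)).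
have bc : bmf c.
  have [m [M hM]] := bmf_mass k; split.
    by apply: measurable_maxr; [exact: measurable_cst|apply: measurable_funB => //; exact: measurable_cst].
  exists (1 + M) => pi; have := hM pi; rewrite ler_norml => /andP[h1 h2].
  by rewrite /c ger0_norm ?le_max ?lexx// ge_max; apply/andP; split; lra.
rewrite (eq_Rintegral _ (g := fun pi => (Phi pi * c pi) * discovery k (app R pi))); last first.
  by move=> pi _; rewrite /discovery big_ord_recr /= mulrCA mulrC.
rewrite IH; first last.
- by move=> b pi; rewrite inv /c app_oswap.
- exact: bmfM.
have bY l : bmf (fun pi => Phi pi * starters k pi * (same_cluster pi l k)%:R).
  by apply: bmfM; [exact: bmfM|exact: bmf_same].
have bZ l : bmf (fun pi => Phi pi * starters k pi * cluster_freq R pi l).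
  by apply: bmfM; [exact: bmfM|exact: bmf_freq].
transitivity (\int[mu]_pi (Phi pi * starters k pi - \sum_(l < k) Phi pi * starters k pi * cluster_freq R pi l)).
  apply: eq_Rintegral => pi _; rewrite -mulr_sumr -{1}[Phi pi * starters k pi]mulr1 -mulrBr mulrAC.
  have [->|[-> h]] := starters01 k pi; first by rewrite !(mulr0, mul0r).
  rewrite !mulr1; congr (_ * _).
  have -> : \sum_(l < k) cluster_freq R pi l = mass k (app R pi).
    by apply: eq_bigr => l _; rewrite (app_starters h).
  apply/max_idPr; rewrite subr_ge0.
  rewrite (_ : mass _ _ = \sum_(l < k) starfreq R pi l) ?sum_starfreq_le1//.
  by apply: eq_bigr => l _; rewrite (app_starters h)// /starfreq h// mul1r.
rewrite ExB; [|exact: bmfM|by apply: bmf_sum].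
rewrite Ex_sum//.
transitivity (\int[mu]_pi (Phi pi * starters k pi - \sum_(l < k) Phi pi * starters k pi * (same_cluster pi l k)%:R)).
  rewrite ExB; [|exact: bmfM|by apply: bmf_sum].
  rewrite Ex_sum//; congr (_ - _); apply: eq_bigr => l _; rewrite pexch_freq//.
    exact: bmfM.
  by apply: fixed_fromM => // y pi _; exact: inv.
apply: eq_Rintegral => pi _; rewrite -mulr_sumr -{1}[Phi pi * starters k pi]mulr1 -mulrBr.
rewrite [in RHS]/starters big_ord_recr /= -/(starters k pi) mulrA.
have [->|[-> h]] := starters01 k pi; first by rewrite !(mulr0, mul0r).
congr (_ * _); case: (boolP (starter pi k)) => sk.
  by rewrite big1 ?subr0// => l _; rewrite (starterF sk).
have [sf fx fle] := cluster_minP pi k.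
have fk : (cluster_min pi k < k)%N.
  by rewrite ltn_neqAle fle andbT; apply: contraNneq sk => <-.
rewrite (bigD1 (Ordinal fk))//= fx big1 ?addr0 ?subrr// => l lf.
case lk : (same_cluster pi l k) => //; move/eqP: lf; case; apply: val_inj => /=.
by rewrite (cluster_min_unique (h _ (ltn_ord l)) lk).
Qed.

Let found n k (h : {ffun 'I_k -> 'I_n}) pi : R :=
  \prod_(l < k) ((starter pi (h l))%:R * (same_cluster pi (h l) (n + l))%:R).

Let hseq n k (h : {ffun 'I_k -> 'I_n}) : seq nat := map (fun l : 'I_k => val (h l)) (enum 'I_k).

Let size_hseq n k (h : {ffun 'I_k -> 'I_n}) : size (hseq h) = k.
Proof. by rewrite size_map size_enum_ord. Qed.

Let nth_hseq n k (h : {ffun 'I_k -> 'I_n}) (l : 'I_k) : nth 0%N (hseq h) l = h l.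
Proof.
rewrite (nth_map l) ?size_enum_ord//; congr (val (h _)).
by apply: val_inj; rewrite /= nth_enum_ord.
Qed.

Let terms_hseq n k (h : {ffun 'I_k -> 'I_n}) (x : nat -> R) (l : 'I_k) : terms x (hseq h) l = x (h l).
Proof. by rewrite /terms (nth_map 0%N) ?size_hseq// nth_hseq. Qed.

(* Either an element from n on starts a cluster, or the k clusters have least
   elements h before n, and these are distinct. *)
Let starters_split n k B pi :
  \1_B (prefix k (app R (tail n pi))) * starters k (tail n pi) <=
  \sum_(l < k) (starter pi (n + l))%:R +
  \sum_(h : {ffun 'I_k -> 'I_n} | injectiveb h)
    \1_B (terms (starfreq R pi) (hseq h)) * found h pi.
Proof.
have ind0 x : 0 <= \1_B x :> R by [].
have f0 (h : {ffun 'I_k -> 'I_n}) : 0 <= \1_B (terms (starfreq R pi) (hseq h)) * found h pi.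
  by rewrite mulr_ge0// prodr_ge0.
have s1 : 0 <= \sum_(l < k) (starter pi (n + l))%:R :> R by apply: sumr_ge0.
have s2 : 0 <= \sum_(h : {ffun 'I_k -> 'I_n} | injectiveb h)
    \1_B (terms (starfreq R pi) (hseq h)) * found h pi by apply: sumr_ge0.
have [->|[-> st]] := starters01 k (tail n pi); first by rewrite mulr0 addr_ge0.
rewrite mulr1.
have [[l sl]|/forallNP no] := pselect (exists l : 'I_k, starter pi (n + l)).
  apply: (@le_trans _ _ 1); first by rewrite indicE; case: (_ \in _).
  apply: ler_wpDr => //; rewrite (bigD1 l)//= sl lerDl.
  by apply: sumr_ge0.
have lt l : (l < k)%N -> (cluster_min pi (n + l) < n)%N.
  move=> lk; have [sf fx fle] := cluster_minP pi (n + l); rewrite ltnNge; apply/negP => nf.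
  pose l' := (cluster_min pi (n + l) - n)%N.
  have e : cluster_min pi (n + l) = (n + l')%N by rewrite subnKC.
  have ll' : (l' <= l)%N by rewrite -(leq_add2l n) -e.
  move: ll'; rewrite leq_eqVlt => /orP[/eqP ll'|ll'].
    by case: (no (Ordinal lk)) => /=; rewrite -ll' -e.
  have z : same_cluster pi (n + l')%N (n + l)%N = false := starterF (st _ lk) ll'.
  by move: z; rewrite -e fx.
pose h : {ffun 'I_k -> 'I_n} := [ffun l : 'I_k => Ordinal (lt l (ltn_ord l))].
have hE (l : 'I_k) : h l = cluster_min pi (n + l) :> nat by rewrite ffunE.
have hinj : injectiveb h.
  apply/injectiveP => l l' /(congr1 val) /=; rewrite !hE => e; apply: val_inj.
  have [_ fx _] := cluster_minP pi (n + l); have [_ fx' _] := cluster_minP pi (n + l').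
  apply: (starter_inj (st _ (ltn_ord l)) (st _ (ltn_ord l'))).
  change (same_cluster pi (n + l) (n + l')).
  by apply: npart_trans fx'; rewrite -e npart_sym.
apply: ler_wpDl => //; rewrite (bigD1 h)//= -[leLHS]addr0; apply: lerD; last exact: sumr_ge0.
have -> : found h pi = 1.
  by rewrite /found big1// => l _; have [sf fx _] := cluster_minP pi (n + l); rewrite hE sf fx mulr1.
rewrite mulr1 (_ : prefix _ _ = terms (starfreq R pi) (hseq h))//.
apply/funext => l; rewrite /prefix; case: ltnP => [lk|kl]; last first.
  by rewrite /terms nth_default// size_map size_hseq.
rewrite (terms_hseq h _ (Ordinal lk)) (app_starters st)// freq_tail /starfreq hE /=.
have [sf fx _] := cluster_minP pi (n + l).
by rewrite sf mul1r (freq_related R fx).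
Qed.

Let found_freq n k (h : {ffun 'I_k -> 'I_n}) Phi : bmf Phi -> fixed_from n Phi ->
  \int[mu]_pi (Phi pi * found h pi) = \int[mu]_pi (Phi pi * \prod_(l < k) starfreq R pi (h l)).
Proof.
suff claim i : (i <= k)%N -> forall Psi, bmf Psi -> fixed_from n Psi ->
    \int[mu]_pi (Psi pi * \prod_(l < k | (l < i)%N) (same_cluster pi (h l) (n + l))%:R) =
    \int[mu]_pi (Psi pi * \prod_(l < k | (l < i)%N) cluster_freq R pi (h l)).
  move=> bPhi fPhi.
  have := claim k (leqnn k) (fun pi => Phi pi * \prod_(l < k) (starter pi (h l))%:R).
  have bp : bmf (fun pi => Phi pi * \prod_(l < k) (starter pi (h l))%:R).
    by apply: bmfM => //; apply: bmf_prod => l _; exact: bmf_starter.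
  have fp : fixed_from n (fun pi => Phi pi * \prod_(l < k) (starter pi (h l))%:R).
    apply: fixed_fromM => // y pi ny; apply: eq_bigr => l _.
    by rewrite starter_oswap//; have := ltn_ord (h l); lia.
  move=> /(_ bp fp) e.
  transitivity (\int[mu]_pi (Phi pi * \prod_(l < k) (starter pi (h l))%:R *
      \prod_(l < k | (l < k)%N) (same_cluster pi (h l) (n + l))%:R)).
    apply: eq_Rintegral => pi _; rewrite /found big_split /= mulrA; congr (_ * _).
    by apply: eq_bigl => l; rewrite ltn_ord.
  rewrite e; apply: eq_Rintegral => pi _; rewrite -mulrA /starfreq big_split /=; congr (_ * (_ * _)).
  by apply: eq_bigl => l; rewrite ltn_ord.
elim: i => [|i IH] ik Psi bPsi fPsi.
  by apply: eq_Rintegral => pi _; rewrite !big_pred0.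
have bs (j : nat) : bmf (fun pi : npart => \prod_(l < k | (l < j)%N) (same_cluster pi (h l) (n + l))%:R : R).
  by apply: bmf_prod => l _; exact: bmf_same.
have split (F : 'I_k -> R) : \prod_(l < k | (l < i.+1)%N) F l =
    (\prod_(l < k | (l < i)%N) F l) * F (Ordinal ik).
  rewrite (bigD1 (Ordinal ik))//= mulrC; congr (_ * _); apply: eq_bigl => l.
  by rewrite ltnS -(inj_eq val_inj) /= [RHS]ltn_neqAle andbC.
transitivity (\int[mu]_pi (Psi pi * \prod_(l < k | (l < i)%N) (same_cluster pi (h l) (n + l))%:R *
    (same_cluster pi (h (Ordinal ik)) (n + i))%:R)).
  by apply: eq_Rintegral => pi _; rewrite split mulrA.
rewrite pexch_freq//; first last.
- apply: fixed_fromM; first by apply: fixed_fromW fPsi; exact: leq_addr.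
  move=> y pi ny; apply: eq_bigr => l li.
  by apply: (@fixed_from_same R (n + i)) => //; have := ltn_ord (h l); lia.
- exact: bmfM.
- by have := ltn_ord (h (Ordinal ik)); lia.
transitivity (\int[mu]_pi (Psi pi * cluster_freq R pi (h (Ordinal ik)) *
    \prod_(l < k | (l < i)%N) (same_cluster pi (h l) (n + l))%:R)).
  by apply: eq_Rintegral => pi _; rewrite mulrAC.
rewrite IH; [|exact: ltnW|by apply: bmfM => //; exact: bmf_freq|]; last first.
  by apply: fixed_fromM => //; apply: fixed_from_freq; exact: ltn_ord.
by apply: eq_Rintegral => pi _; rewrite split -mulrA; congr (_ * _); exact: mulrC.
Qed.

Hypothesis stat : forall n A, measurable A -> mu (tail n @^-1` A) = mu A.
Hypothesis proper : {ae mu, forall pi, powsum 1 (starfreq R pi) = 1}.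

Let new n : R := \int[mu]_pi (starter pi n)%:R.

Let cvg_new : new @ \oo --> 0.
Proof.
have newE n : new n = \int[mu]_pi (1 - \sum_(l < n) starfreq R pi l).
  rewrite ExB; [|exact: bmf_cst|by apply: bmf_sum => l _; exact: bmf_starfreq].
  rewrite Ex_sum; last by move=> l _; exact: bmf_starfreq.
  transitivity (\int[mu]_pi (1 - \sum_(l < n) (starter pi l)%:R * (same_cluster pi l n)%:R)).
    apply: eq_Rintegral => pi _; case: (boolP (starter pi n)) => sn.
      by rewrite big1 ?subr0// => l _; rewrite (starterF sn)// mulr0.
    have [sf fx fle] := cluster_minP pi n.
    have fn : (cluster_min pi n < n)%N.
      by rewrite ltn_neqAle fle andbT; apply: contraNneq sn => <-.
    rewrite (bigD1 (Ordinal fn))//= sf fx mulr1 big1 ?addr0 ?subrr// => l lf.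
    case sl : (starter pi l); last by rewrite mul0r.
    case ln : (same_cluster pi l n); last by rewrite mulr0.
    by move/eqP: lf; case; apply: val_inj; rewrite /= (cluster_min_unique sl ln).
  have b l : bmf (fun pi : npart => (starter pi l)%:R * (same_cluster pi l n)%:R : R).
    by apply: bmfM; [exact: bmf_starter|exact: bmf_same].
  rewrite ExB; [|exact: bmf_cst|by apply: bmf_sum].
  rewrite Ex_sum//; congr (_ - _); apply: eq_bigr => l _; apply: pexch_freq => //.
    exact: bmf_starter.
  exact: fixed_from_starter.
rewrite (funext newE).
rewrite -[X in _ --> X](Ex_cst mu 0).
apply: (@Ex_dct _ _ _ mu (fun n pi => 1 - \sum_(l < n) starfreq R pi l) (fun=> 0) 1).
- move=> n; have [m _] : bmf (fun pi : npart => 1 - \sum_(l < n) starfreq R pi l).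
    by apply: bmfB; [exact: bmf_cst|apply: bmf_sum => l _; exact: bmf_starfreq].
  exact: m.
- exact: measurable_cst.
- move=> n pi; have s1 := sum_starfreq_le1 R pi n.
  have s0 : 0 <= \sum_(l < n) starfreq R pi l by apply: sumr_ge0 => l _; exact: starfreq_ge0.
  by rewrite ger0_norm; lra.
- apply: filterS proper => pi p1; rewrite -[X in _ --> X](subrr 1).
  apply: cvgB; first exact: cvg_cst.
  rewrite -[X in _ --> X]p1.
  exact: (cvg_powsum (x := starfreq R pi) (ltn0Sn 0) (starfreq_ge0 R pi) (sum_starfreq_le1 R pi)).
Qed.

(** The weight is the probability that the first [k] elements start clusters.
    By stationarity these may be the elements [n], ..., [n + k - 1]: their
    clusters are older than [n] with a probability that tends to one, since
    the frequencies add up to one, and are then found independently, by the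
    prediction rule. *)
Lemma discovery_le k B : measurable B ->
  (\int[mu]_pi (\1_B (prefix k (app R pi)) * discovery k (app R pi))%:E <=
   \int[mu]_pi tuple_sum k (drawn B k) (app R pi))%E.
Proof.
move=> mB; pose Phi (pi : npart) : R := \1_B (prefix k (app R pi)).
have mpa : measurable_fun setT (fun pi : npart => prefix k (app R pi)).
  by apply: (measurableT_comp (measurable_prefix k)); exact: measurable_app.
have bPhi : bmf Phi by exact: (@bmf_comp R _ _ npart (realseq R) (\1_B) _ (bmf_indic R mB) mpa).
rewrite -EFin_Ex; last by apply: bmfM => //; exact: bmf_discovery.
rewrite discovery_starters//; last by move=> b pi; rewrite /Phi app_oswap.
have bterms n (h : {ffun 'I_k -> 'I_n}) : bmf (fun pi : npart => \1_B (terms (starfreq R pi) (hseq h)) : R).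
  have ms : measurable_fun setT (fun pi : npart => terms (starfreq R pi) (hseq h)).
    apply: (measurableT_comp (measurable_terms (R := R) (hseq h))).
    by apply: measurable_realseq => i; have [m _] := bmf_starfreq R i; exact: m.
  exact: (@bmf_comp R _ _ npart (realseq R) (\1_B) _ (bmf_indic R mB) ms).
have bound n : ((\int[mu]_pi (Phi pi * starters k pi))%:E <=
    (\sum_(l < k) new (n + l))%:E + \int[mu]_pi tuple_sum k (drawn B k) (app R pi))%E.
  have bfound (h : {ffun 'I_k -> 'I_n}) : bmf (found h).
    apply: bmf_prod => l _; apply: bmfM; [exact: bmf_starter|exact: bmf_same].
  have bpf (h : {ffun 'I_k -> 'I_n}) : bmf (fun pi => \1_B (terms (starfreq R pi) (hseq h)) * found h pi).
    exact: bmfM.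
  have bps (h : {ffun 'I_k -> 'I_n}) : bmf (fun pi : npart =>
      \1_B (terms (starfreq R pi) (hseq h)) * \prod_(l < k) starfreq R pi (h l)).
    by apply: bmfM => //; apply: bmf_prod => l _; exact: bmf_starfreq.
  apply: (@le_trans _ _ ((\sum_(l < k) new (n + l))%:E +
     (\int[mu]_pi \sum_(h : {ffun 'I_k -> 'I_n} | injectiveb h)
       \1_B (terms (starfreq R pi) (hseq h)) * \prod_(l < k) starfreq R pi (h l))%:E)%E).
    rewrite -EFinD lee_fin Ex_sum//.
    rewrite (eq_bigr (fun h : {ffun 'I_k -> 'I_n} => \int[mu]_pi (\1_B (terms (starfreq R pi) (hseq h)) * found h pi))); last first.
      move=> h _; rewrite found_freq// => y pi ny; congr (\1_B _).
      apply/funext => l; have [lk|kl] := ltnP l k; last by rewrite /terms !nth_default// size_map size_hseq.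
      rewrite !(terms_hseq h _ (Ordinal lk)).
      rewrite /starfreq; congr (_ * _).
        exact: (fixed_from_starter R (ltn_ord (h (Ordinal lk))) _ ny).
      exact: (fixed_from_freq R (ltn_ord (h (Ordinal lk))) _ ny).
    rewrite -[X in _ <= _ + X]Ex_sum// -[X in _ <= X + _]Ex_sum; last by move=> l _; exact: bmf_starter.
    rewrite -ExD; [|by apply: bmf_sum => l _; exact: bmf_starter|by apply: bmf_sum].
    have -> : \int[mu]_pi (Phi pi * starters k pi) =
        \int[mu]_pi (Phi (tail n pi) * starters k (tail n pi)).
      have bf : bmf (fun pi => Phi pi * starters k pi) by exact: bmfM.
      symmetry; apply: (eq_law_Ex (measurable_tail n) (@measurable_id _ npart setT) bf).
      by move=> A mA; rewrite /= stat.
    apply: Ex_le => [| |pi]; last exact: starters_split.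
    - exact: (bmf_comp (bmfM bPhi (bstarters k)) (measurable_tail n)).
    - by apply: bmfD; [apply: bmf_sum => l _; exact: bmf_starter|apply: bmf_sum].
  rewrite leeD2l// EFin_Ex; last by apply: bmf_sum.
  have ts (pi : npart) : tuple_sum k (drawn B k) (app R pi) = tuple_sum k (drawn B k) (starfreq R pi).
    apply: tuple_sum_rearr; [exact: app_ge0|exact: starfreq_ge0| |].
    - by move=> z l; exact: drawn_eq0.
    - by apply: rearr_sym; exact: rearr_starfreq_app.
  apply: ge0_le_integral => //.
  - move=> pi _; rewrite lee_fin; apply: sumr_ge0 => h _; rewrite mulr_ge0//.
    by apply: prodr_ge0 => l _; exact: starfreq_ge0.
  - apply/measurable_EFinP.
    have [m _] : bmf (fun pi : npart => \sum_(h : {ffun 'I_k -> 'I_n} | injectiveb h)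
       \1_B (terms (starfreq R pi) (hseq h)) * \prod_(l < k) starfreq R pi (h l)).
      exact: bmf_sum.
    exact: m.
  - have mt := @measurable_tuple_sum R k _ (@drawn_ge0 R B k) (@measurable_drawn R B k mB).
    exact: (@measurableT_comp _ _ _ _ _ _ (fun x : realseq R => tuple_sum k (drawn B k) x) _ (@app R) mt (@measurable_app R)).
  - move=> pi _; rewrite ts.
    rewrite (_ : (_%:E) = \sum_(s <- [seq hseq h | h <- enum (fun h : {ffun 'I_k -> 'I_n} => injectiveb h)])
        drawn B k (terms (starfreq R pi) s))%E.
      apply: tuple_sum_ge_sum; first exact: drawn_ge0.
        rewrite map_inj_uniq ?enum_uniq// => h h' e; apply/ffunP => l; apply: val_inj.
        by have := congr1 (fun s => nth 0%N s l) e; rewrite /= !nth_hseq.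
      move=> s /mapP[h]; rewrite mem_enum => /injectiveP hi ->; rewrite size_hseq eqxx andbT.
      by rewrite map_inj_uniq ?enum_uniq// => l l' /val_inj /hi.
    rewrite big_map big_enum_cond /= -sumEFin; apply: eq_big => h; first by rewrite ?andbT unfold_in.
    move=> _; rewrite /drawn; congr (_ * _)%:E; apply: eq_bigr => l _.
    by rewrite terms_hseq ger0_norm// starfreq_ge0.
apply/lee_addgt0Pr => e e0.
have : (fun n => \sum_(l < k) new (n + l)) @ \oo --> \sum_(l < k) (0 : R).
  by apply: cvg_sumr => l _; rewrite (cvg_shiftn l new).
rewrite big1// => /cvgrPdist_lt /(_ e e0) [N _ /(_ N (leqnn N))].
rewrite /= sub0r normrN => lte.
apply: le_trans (bound N) _; rewrite addeC leeD2l// lee_fin ltW//.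
exact: le_lt_trans (ler_norm _) lte.
Qed.
End Discovery.

(** * Successive size-biased draws *)

(** The inverse, with its value 0 at 0, is the pointwise limit of the continuous
    functions [x / (x ^+ 2 + n.+1%:R^-1)]. *)
Lemma measurable_invr (R : realType) : measurable_fun setT (fun x : R => x^-1).
Proof.
pose g (n : nat) (x : R) := x / (x ^+ 2 + n.+1%:R^-1).
have pos (n : nat) (x : R) : 0 < x ^+ 2 + n.+1%:R^-1.
  by rewrite ltr_wpDl ?sqr_ge0// invr_gt0.
apply: (@measurable_fun_cvg _ _ _ _ g) => [n|x _].
  apply: continuous_measurable_fun => x; apply: cvgM; first exact: cvg_id.
  apply: cvgV; first by rewrite gt_eqF.
  by apply: cvgD; [exact: exprn_continuous|exact: cvg_cst].
have [->|x0] := eqVneq x 0.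
  by rewrite invr0; under eq_fun do rewrite /g mul0r; exact: cvg_cst.
rewrite [X in _ --> X](_ : _ = x / (x ^+ 2 + 0)); last by rewrite addr0 expr2 invfM mulrA divff// mul1r.
apply: cvgM; first exact: cvg_cst.
apply: cvgV; first by rewrite addr0 expf_neq0.
by apply: cvgD; [exact: cvg_cst|exact: cvg_harmonic].
Qed.

Lemma measurable_select (R : realType) d (T : measurableType d) (h : T -> nat) (Y : nat -> T -> R) :
  (forall i, measurable [set w | h w = i]) -> (forall i, measurable_fun setT (Y i)) ->
  measurable_fun setT (fun w => Y (h w) w).
Proof.
move=> mh mY _ B mB; rewrite setTI.
rewrite (_ : _ @^-1` _ = \bigcup_i ([set w | h w = i] `&` Y i @^-1` B)); last first.
  by apply/seteqP; split=> [w Bw|w [i _ [/= <-]]//]; exists (h w).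
apply: bigcup_measurable => i _; apply: measurableI; first exact: mh.
by rewrite -[X in measurable X]setTI; exact: mY.
Qed.

Section Draws.
Context (R : realType) (d : measure_display) (T : measurableType d) (P : probability T R).
Context (Q : {RV P >-> realseq R}) (J : nat -> {RV P >-> nat}).
Hypotheses (draws : size_biased_draws P Q J) (proper : {ae P, forall w, proper_seq (Q w)}).
Implicit Types (w : T) (h : seq nat) (k : nat) (B : set (realseq R)).

Let mQ : measurable_fun setT Q. Proof. exact: measurable_funPT. Qed.

Let mQi i : measurable_fun setT (fun w => Q w i).
Proof. exact: (measurableT_comp (measurable_coord i) mQ). Qed.

Let mJ k j : measurable [set w | J k w = j].
Proof. by have := measurable_funPTI (J k) (Y := [set j]); apply. Qed.

Let came k h w : bool := [forall l : 'I_k, J l w == nth 0%N h l].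

Let mcame k h : measurable_fun setT (fun w => (came k h w)%:R : R).
Proof.
have [//] : bmf (fun w => (came k h w)%:R : R).
apply: bmf_bool; rewrite (_ : [set w | _] = \bigcap_(l in [set: 'I_k]) [set w | J l w = nth 0%N h l]).
  by apply: fin_bigcap_measurable => [|l _]; [exact: finite_finset|exact: mJ].
apply/seteqP; split=> [w /forallP /= c l _ /=|w /= c]; first exact/eqP/c.
by apply/forallP => l; apply/eqP; exact: c.
Qed.

Let came_rcons k h w : came k.+1 h w = came k h w && (J k w == nth 0%N h k).
Proof.
apply/forallP/andP => [c|[/forallP c e] l].
  split; last exact: (c ord_max).
  by apply/forallP => l; exact: (c (widen_ord (leqnSn k) l)).
have [lk|kl] := ltnP l k; first exact: (c (Ordinal lk)).
by have -> : l = k :> nat by have := ltn_ord l; lia.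
Qed.

Let mass_terms l h (x : realseq R) : (l <= size h)%N ->
  mass l (terms x h) = drawn_mass x (nth 0%N h) l.
Proof.
move=> lh; apply: eq_bigr => i _.
by rewrite /terms (nth_map 0%N)// (leq_trans (ltn_ord i)).
Qed.

Let mmass k h : measurable_fun setT (fun w => mass k (terms (Q w) h)).
Proof. exact: (measurableT_comp (measurable_mass k) (measurableT_comp (measurable_terms h) mQ)). Qed.

Let light k h w : bool := mass k (terms (Q w) h) < 1.

Let live k h w : R := (came k h w)%:R * (light k h w)%:R.

Let mlive k h : measurable_fun setT (live k h).
Proof.
apply: measurable_funM; first exact: mcame.
have [//] : bmf (fun w => (light k h w)%:R : R).
apply: bmf_bool; rewrite -[X in measurable X]setTI.
exact: (measurable_fun_ltr (mmass k h) (measurable_cst (1 : R)) measurableT (Y := [set true])).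
Qed.

Let live_ge0 k h w : 0 <= live k h w. Proof. by rewrite mulr_ge0. Qed.

Let next k h w : R := live k h w * (J k w == nth 0%N h k)%:R.
Let rate k h w : R := live k h w * (`|Q w (nth 0%N h k)| / (1 - mass k (terms (Q w) h))).

Let mnext k h : measurable_fun setT (next k h).
Proof.
apply: measurable_funM; first exact: mlive.
have [//] : bmf (fun w => (J k w == nth 0%N h k)%:R : R).
apply: bmf_bool; rewrite (_ : [set w | _] = [set w | J k w = nth 0%N h k])//.
by apply/seteqP; split=> w /eqP.
Qed.

Let next_ge0 k h w : 0 <= next k h w. Proof. by rewrite mulr_ge0// live_ge0. Qed.

Let mrate k h : measurable_fun setT (rate k h).
Proof.
apply: measurable_funM; first exact: mlive.
apply: measurable_funM; first exact: measurableT_comp.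
apply: (measurableT_comp (@measurable_invr R)).
by apply: measurable_funB => //; exact: measurable_cst.
Qed.

Let rate_ge0 k h w : 0 <= rate k h w.
Proof.
rewrite /rate /live /light; case: ltP => m1; last by rewrite mulr0 mul0r.
by rewrite mulr1 mulr_ge0// divr_ge0// subr_ge0 ltW.
Qed.

Local Open Scope ereal_scope.

Let next_rate_indic k h B : uniq h -> (k < size h)%N -> measurable B ->
  \int[P]_w ((\1_B (Q w))%:E * (next k h w)%:E) = \int[P]_w ((\1_B (Q w))%:E * (rate k h w)%:E).
Proof.
move=> uh kh mB.
have hk l : (l < k)%N -> nth 0%N h l <> nth 0%N h k.
  by move=> lk /eqP; rewrite nth_uniq//; [move=> /eqP; lia|exact: ltn_trans kh].
have := draws mB hk; cbv zeta; set E := [set w | _] => e.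
have EP w : E w <-> (\1_B (Q w) * live k h w = 1)%R.
  rewrite /live /light mass_terms ?(ltnW kh)// indicE.
  split=> [[Bw c m1]|].
    have -> : came k h w by apply/forallP => l; apply/eqP; exact: c.
    by rewrite mem_set// m1 !mulr1.
  have [Bw|] := boolP (Q w \in B); last by move=> _; rewrite mul0r => /esym/eqP; rewrite oner_eq0.
  case c : (came k h w); last by rewrite mul0r mulr0 => /esym/eqP; rewrite oner_eq0.
  case m1 : (_ < 1)%R; last by rewrite !mulr0 => /esym/eqP; rewrite oner_eq0.
  move=> _; split=> //; first by rewrite inE in Bw.
  by move=> l lk; move/forallP: c => /(_ (Ordinal lk)) /eqP.
have E0 w : ~ E w -> (\1_B (Q w) * live k h w = 0)%R.
  move=> /EP; rewrite indicE /live; case: (_ \in _); rewrite ?mul0r//.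
  by case: (came _ _ _); rewrite ?mul0r ?mulr0//; case: (light _ _ _); rewrite ?mulr0// !mulr1.
have mB' : measurable_fun setT (fun w => \1_B (Q w) : R).
  by apply: (measurableT_comp (@measurable_indic _ _ R _ _ mB)).
have mE : measurable E.
  rewrite (_ : E = (fun w => \1_B (Q w) * live k h w)%R @^-1` [set 1%R]); last first.
    by apply/seteqP; split=> w /EP.
  rewrite -[X in measurable X]setTI.
  by apply: (measurable_funM mB' (mlive k h)) => //; exact: measurable_set1.
have LHS : \int[P]_w ((\1_B (Q w))%:E * (next k h w)%:E) = P (E `&` [set w | J k w = nth 0%N h k]).
  rewrite -[X in P X]setIT -integral_indic//; last by apply: measurableI.
  apply: eq_integral => w _; rewrite -EFinM; congr (_%:E).
  rewrite /next mulrA [in RHS]indicE; have [Ew|nE] := pselect (E w); last first.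
    by rewrite E0// mul0r memNset// => -[].
  rewrite (EP w).1// mul1r; case: eqP => Jw; first by rewrite mem_set.
  by rewrite memNset// => -[].
rewrite LHS e integral_mkcond.
apply: ae_eq_integral => //.
- apply/(measurable_restrictT _ mE); apply: measurable_funTS; apply/measurable_EFinP.
  apply: measurable_funM => //; apply: (measurableT_comp (@measurable_invr R)).
  apply: measurable_funB; first exact: measurable_cst.
  by apply: measurable_sum => i; exact: mQi.
- apply/measurable_EFinP; exact: measurable_funM.
apply: filterS proper => w [q0 _] _; rewrite /patch.
have [Ew|nE] := pselect (E w).
  rewrite mem_set// -EFinM /rate mulrA (EP w).1// mul1r ger0_norm//.
  by rewrite mass_terms// ltnW.
by rewrite memNset// -EFinM /rate mulrA E0// mul0r.
Qed.

Lemma next_rate k h phi : uniq h -> (k < size h)%N -> measurable_fun setT phi ->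
  (forall x, 0 <= phi x) ->
  \int[P]_w (phi (Q w) * (next k h w)%:E) = \int[P]_w (phi (Q w) * (rate k h w)%:E).
Proof.
move=> uh kh mphi phi0; apply/eqP; rewrite eq_le; apply/andP; split; apply: weighted_le => //.
- by move=> B mB; rewrite next_rate_indic.
- by move=> B mB; rewrite next_rate_indic.
Qed.

(* Once the drawn mass is one, the other terms vanish. *)
Let exhausted k h w : proper_seq (Q w) -> uniq h -> (k < size h)%N ->
  (1 <= mass k (terms (Q w) h))%R -> Q w (nth 0%N h k) = 0%R.
Proof.
move=> [q0 q1] uh kh m1; apply/eqP; rewrite eq_le q0 andbT -(lerD2r 1) add0r.
apply: le_trans (_ : mass k.+1 (terms (Q w) h) <= _)%R.
  move: m1; rewrite mass_terms ?(ltnW kh)// mass_terms// /drawn_mass big_ord_recr /=.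
  by set q := Q w _; set s := (\sum_(_ < _) _)%R; lra.
rewrite -lee_fin -q1 mass_terms// /drawn_mass -sumEFin.
rewrite nneseries_esumT; last by move=> j; rewrite lee_fin.
rewrite (_ : \sum_(i < k.+1) _ = \sum_(i <- take k.+1 h) (Q w i)%:E).
  apply: esum_ge; exists [set` take k.+1 h]; first by split=> //; exact: finite_seq.
  by rewrite -fsbig_seq// take_uniq.
rewrite (big_nth 0%N) size_takel// big_mkord; apply: eq_bigr => i _.
by rewrite nth_take.
Qed.

(** Each factor of [discovery] cancels the denominator of the conditional
    probability of a draw; when it vanishes, the drawn mass is one and no
    positive term is left. *)
Lemma draws_identity k h phi : uniq h -> (k <= size h)%N -> measurable_fun setT phi ->
  (forall x, 0 <= phi x) ->
  \int[P]_w (phi (Q w) * ((came k h w)%:R * discovery k (terms (Q w) h))%:E) =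
  \int[P]_w (phi (Q w) * (\prod_(l < k) `|Q w (nth 0%N h l)|)%:E).
Proof.
move=> uh; elim: k phi => [|k IH] phi kh mphi phi0.
  apply: eq_integral => w _; rewrite /discovery !big_ord0 mulr1.
  by have -> : came 0 h w by apply/forallP => -[].
pose disc (x : realseq R) := discovery k.+1 (terms x h).
pose phi' x := phi x * (disc x)%:E.
have mdisc : measurable_fun setT disc.
  exact: (measurableT_comp (measurable_discovery k.+1) (measurable_terms h)).
have disc0 x : (0 <= disc x)%R by exact: discovery_ge0.
have mphi' : measurable_fun setT phi' by apply: emeasurable_funM => //; exact/measurable_EFinP.
have phi'0 x : 0 <= phi' x by rewrite mule_ge0// lee_fin.
have discE w : disc (Q w) = (discovery k (terms (Q w) h) * Num.max 0 (1 - mass k (terms (Q w) h)))%R.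
  by rewrite /disc /discovery big_ord_recr.
transitivity (\int[P]_w (phi' (Q w) * (next k h w)%:E)).
  apply: eq_integral => w _; rewrite /phi' -muleA -EFinM; congr (_ * _%:E).
  rewrite /next /live /light came_rcons -/(disc (Q w)) discE.
  case: ltP => m1; last first.
    have -> : Num.max 0%R (1 - mass k (terms (Q w) h))%R = 0%R by apply/max_idPl; rewrite subr_le0.
    by rewrite !(mulr0, mul0r).
  by case: (came k h w); case: (J k w == _); rewrite /= !(mul1r, mulr1, mul0r, mulr0).
rewrite next_rate//.
pose phi2 x := phi x * (`|x (nth 0%N h k)|)%:E.
have mabs : measurable_fun setT (fun x : realseq R => `|x (nth 0%N h k)|)%R.
  by apply: measurableT_comp => //; exact: measurable_coord.
transitivity (\int[P]_w (phi2 (Q w) * ((came k h w)%:R * discovery k (terms (Q w) h))%:E)).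
  apply: ae_eq_integral => //.
  - apply: emeasurable_funM; first exact: (measurableT_comp mphi').
    exact/measurable_EFinP.
  - apply: emeasurable_funM.
      apply: (measurableT_comp _ mQ); apply: emeasurable_funM => //; exact/measurable_EFinP.
    apply/measurable_EFinP; apply: measurable_funM => //.
    exact: (measurableT_comp (measurable_discovery k) (measurableT_comp (measurable_terms h) mQ)).
  apply: filterS proper => w pw _; rewrite /phi' /phi2 -!muleA -!EFinM; congr (_ * _%:E).
  rewrite discE /rate /live /light; case: ltP => m1; last first.
    by rewrite (exhausted pw uh kh m1) normr0 !(mulr0, mul0r).
  have -> : Num.max 0%R (1 - mass k (terms (Q w) h))%R = (1 - mass k (terms (Q w) h))%R.
    by apply/max_idPr; rewrite subr_ge0 ltW.
  rewrite mulr1.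
  have m0 : (1 - mass k (terms (Q w) h))%R != 0%R by rewrite gt_eqF// subr_gt0.
  set m := (1 - _)%R in m0 *; set a := `|_|%R; set b := discovery _ _.
  rewrite -[in RHS](divfK m0 a); set u := (a / m)%R; set c := ((came _ _ _)%:R)%R.
  lra.
rewrite IH//; first last.
- by move=> x; rewrite mule_ge0// lee_fin.
- by apply: emeasurable_funM => //; exact/measurable_EFinP.
- exact: ltnW.
apply: eq_integral => w _; rewrite /phi2 -muleA -EFinM big_ord_recr /=.
by rewrite [in RHS]mulrC.
Qed.

Variable S : T -> realseq R.
Hypothesis SE : forall w i, S w i =
  if (drawn_mass (Q w) (fun l => J l w) i < 1)%R then Q w (J i w) else 0%R.

Lemma measurable_size_biased : measurable_fun setT S.
Proof.
apply: measurable_realseq => i; under eq_fun do rewrite SE.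
apply: measurable_fun_ifT; last exact: measurable_cst.
  apply: measurable_fun_ltr; last exact: measurable_cst.
  apply: measurable_sum => l.
  exact: (@measurable_select R d T (J l) (fun j w => Q w j)).
exact: (@measurable_select R d T (J i) (fun j w => Q w j)).
Qed.

Let perm_terms k h w : size h = k -> came k h w -> discovery k (terms (Q w) h) <> 0%R ->
  prefix k (S w) = terms (Q w) h.
Proof.
move=> hk /forallP /= c dn; rewrite -(prefix_terms (Q w) h) hk.
apply/funext => l; rewrite /prefix; case: ltnP => // lk.
have m1 : (drawn_mass (Q w) (nth 0%N h) l < 1)%R.
  rewrite -mass_terms ?hk ?(ltnW lk)// ltNge; apply/negP => m1; apply: dn.
  by rewrite /discovery (bigD1 (Ordinal lk))//= (_ : Num.max _ _ = 0%R) ?mul0r//; apply/max_idPl; rewrite subr_le0.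
rewrite SE (_ : drawn_mass _ _ _ = drawn_mass (Q w) (nth 0%N h) l); last first.
  apply: eq_bigr => i _; congr (Q w _); apply/eqP.
  exact: (c (Ordinal (ltn_trans (ltn_ord i) lk))).
by rewrite m1 /terms (nth_map 0%N) ?hk//; congr (Q w _); apply/eqP; exact: (c (Ordinal lk)).
Qed.

(** The right-hand side is summed over the drawn indices; those which are
    pairwise distinct give the left-hand side by [draws_identity]. *)
Lemma discovery_ge k B : measurable B ->
  \int[P]_w tuple_sum k (drawn B k) (Q w) <=
  \int[P]_w (\1_B (prefix k (S w)) * discovery k (S w))%:E.
Proof.
move=> mB; rewrite integral_tuple_sum//; [|exact: drawn_ge0|exact: measurable_drawn].
pose a n w : R := (if is_tuple_code k n then (\1_B (terms (Q w) (tuple_code n)) *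
  ((came k (tuple_code n) w)%:R * discovery k (terms (Q w) (tuple_code n)))) else 0)%R.
have ma n : measurable_fun setT (a n).
  rewrite /a; case: (is_tuple_code k n); last exact: measurable_cst.
  have mp : measurable_fun setT (fun w => terms (Q w) (tuple_code n)) := measurableT_comp (measurable_terms (tuple_code n)) mQ.
  apply: measurable_funM; first exact: (measurableT_comp (@measurable_indic _ _ R _ _ mB) mp).
  by apply: measurable_funM => //; exact: (measurableT_comp (measurable_discovery k) mp).
have a0 n w : (0 <= a n w)%R.
  by rewrite /a; case: (is_tuple_code k n) => //; rewrite !mulr_ge0// discovery_ge0.
rewrite (_ : \sum_(0 <= n <oo) _ = \int[P]_w \sum_(0 <= n <oo) (a n w)%:E); last first.
  rewrite integral_nneseries//; first last.
  - by move=> n w _; rewrite lee_fin.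
  - by move=> n; exact/measurable_EFinP.
  apply: eq_eseriesr => n _; rewrite /a; case cn : (is_tuple_code k n); last by rewrite integral0.
  have /and3P[un /eqP sn _] := cn.
  have := draws_identity (k := k) (phi := fun x => (\1_B (terms x (tuple_code n)))%:E) un.
  rewrite sn => /(_ (leqnn k)) e.
  under eq_integral do rewrite EFinM.
  rewrite e; first last.
  - by move=> x; rewrite lee_fin.
  - apply/measurable_EFinP.
    exact: (measurableT_comp (@measurable_indic _ _ R _ _ mB) (measurable_terms (tuple_code n))).
  apply: eq_integral => w _; rewrite -EFinM /drawn; congr (_ * _)%:E.
  by apply: eq_bigr => l _; rewrite /terms (nth_map 0%N) ?sn.
have mS := measurable_size_biased.
apply: ge0_le_integral => //.
- by move=> w _; apply: nneseries_ge0 => n _ _; rewrite lee_fin.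
- apply: ge0_emeasurable_sum => [n w _ _|n _]; first by rewrite lee_fin.
  exact/measurable_EFinP.
- apply/measurable_EFinP; apply: measurable_funM.
    exact: (measurableT_comp (@measurable_indic _ _ R _ _ mB) (measurableT_comp (measurable_prefix k) mS)).
  exact: (measurableT_comp (measurable_discovery k) mS).
move=> w _.
have c0 : (0 <= \1_B (prefix k (S w)) * discovery k (S w) :> R)%R by rewrite mulr_ge0// discovery_ge0.
apply: lime_le; first by apply: is_cvg_nneseries => n _ _; rewrite lee_fin.
apply: nearW => N; rewrite sumEFin lee_fin big_mkord.
rewrite (eq_bigr (fun n : 'I_N => (is_tuple_code k n && came k (tuple_code n) w)%:R * a n w)%R); last first.
  move=> n _; rewrite /a; case: (is_tuple_code k n); rewrite /= ?mul0r//.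
  by case: (came _ _ _); rewrite ?mul1r// !(mul0r, mulr0).
apply: at_most_one => //.
  move=> n n' /andP[/and3P[_ /eqP sn /eqP en] c] /andP[/and3P[_ /eqP sn' /eqP en'] c'].
  apply: val_inj; rewrite /= -en -en'; congr pickle.
  apply: (@eq_from_nth _ 0%N); first by rewrite sn sn'.
  move=> l; rewrite sn => lk; move/forallP/(_ (Ordinal lk))/eqP: c => /= <-.
  by move/forallP/(_ (Ordinal lk))/eqP: c' => /= <-.
move=> n /andP[cn c]; rewrite /a cn c mul1r; have /and3P[_ /eqP sn _] := cn.
have [->|/eqP dn] := eqVneq (discovery k (terms (Q w) (tuple_code n))) 0%R; first by rewrite mulr0.
rewrite -(perm_terms sn c dn) (_ : discovery k (prefix k (S w)) = discovery k (S w))//.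
by apply: eq_bigr => l _; rewrite mass_prefix// ltnW.
Qed.

End Draws.

(** * Sequences determined by their discovery identities *)

Section SequenceLaw.
Context (R : realType).
Implicit Types (A B : set (realseq R)) (x : realseq R) (k : nat).

(** The events that depend on finitely many coordinates generate the
    sigma-algebra. *)
Lemma prefix_law_ext (mu nu : probability (realseq R) R) :
  (forall k A, measurable A -> mu (prefix k @^-1` A) = nu (prefix k @^-1` A)) ->
  forall A, measurable A -> mu A = nu A.
Proof.
move=> h A mA.
apply: (@measure_unique _ R (realseq R)
  [set B | measurable B /\ exists k, prefix k @^-1` B = B] (fun=> setT)) => //.
- apply/seteqP; split=> B; last first.
    by apply: smallest_sub => [|C [mC _] //]; exact: sigma_algebra_measurable.
  apply: smallest_sub; first exact: smallest_sigma_algebra.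
  move=> C CE; apply: sub_gen_smallest; split; first exact: sub_gen_smallest.
  case: CE => i [D [mD ->]]; exists i.+1.
  by apply/seteqP; split=> x /=; rewrite prefix_lt.
- have up (C : set (realseq R)) k l : (k <= l)%N -> prefix k @^-1` C = C -> prefix l @^-1` C = C.
    move=> kl e; rewrite -e; apply/seteqP; split=> x; by rewrite /preimage /= prefix_prefix.
  move=> B C [mB [k eB]] [mC [l eC]]; split; first exact: measurableI.
  exists (maxn k l); rewrite preimage_setI (up _ _ _ (leq_maxl _ _) eB).
  by rewrite (up _ _ _ (leq_maxr _ _) eC).
- by move=> _; split=> //; exists 0%N; rewrite preimage_setT.
- by rewrite bigcup_const.
- by move=> B [mB [k eB]]; have := h k B mB; rewrite eB.
- by move=> _; rewrite (le_lt_trans (probability_le1 _ _))// ltey.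
Qed.

Context (d d' : measure_display) (T : measurableType d) (T' : measurableType d')
  (P : probability T R) (X : T -> realseq R) (P' : probability T' R) (Y : T' -> realseq R).
Hypotheses (mX : measurable_fun setT X) (mY : measurable_fun setT Y).
Hypothesis le_discovery : forall k B, measurable B ->
  (\int[P']_w (\1_B (prefix k (Y w)) * discovery k (Y w))%:E <=
   \int[P]_w (\1_B (prefix k (X w)) * discovery k (X w))%:E)%E.
Hypotheses (stopX : forall k, {ae P, forall w, discovery k.+1 (X w) = 0 -> X w k = 0})
  (stopY : forall k, {ae P', forall w, discovery k.+1 (Y w) = 0 -> Y w k = 0}).

Let stopped k : set (realseq R) := [set x | discovery k.+1 x = 0].

Let mstopped k : measurable (stopped k).
Proof.
rewrite (_ : stopped k = discovery k.+1 @^-1` [set 0])//.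
by rewrite -[X in measurable X]setTI; apply: measurable_discovery => //; exact: measurable_set1.
Qed.

Let mpre e (V : measurableType e) (Z : V -> realseq R) A : measurable_fun setT Z -> measurable A ->
  measurable (Z @^-1` A).
Proof. by move=> mZ mA; rewrite -[X in measurable X]setTI; exact: mZ. Qed.

Let mprefix e (V : measurableType e) (Z : V -> realseq R) k : measurable_fun setT Z ->
  measurable_fun setT (fun v => prefix k (Z v)).
Proof. by move=> mZ; exact: (measurableT_comp (measurable_prefix k) mZ). Qed.

Let discovery_of_prefix k x : discovery k (prefix k x) = discovery k x.
Proof. by apply: eq_bigr => l _; rewrite mass_prefix// ltnW. Qed.

(* When no further term can be discovered the next one is zero. *)
Let law_stopped e (V : measurableType e) (M : probability V R) (Z : V -> realseq R) k A :
  measurable_fun setT Z -> measurable A ->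
  {ae M, forall w, discovery k.+1 (Z w) = 0 -> Z w k = 0} ->
  M [set w | (A `&` stopped k) (prefix k.+1 (Z w))] = M [set w | (A `&` stopped k) (prefix k (Z w))].
Proof.
move=> mZ mA st; have mAs := measurableI _ _ mA (mstopped k).
have m1 := mpre (mprefix k.+1 mZ) mAs; have m2 := mpre (mprefix k mZ) mAs.
rewrite -!Ex_indic//; congr EFin; apply: Ex_eq_ae; [exact: measurable_indic|exact: measurable_indic|].
apply: filterS st => w sw; rewrite !indicE; congr (nat_of_bool _)%:R.
have eq0 : discovery k.+1 (Z w) = 0 -> prefix k.+1 (Z w) = prefix k (Z w).
  move=> /sw Zk; apply/funext => l; rewrite /prefix ltnS leq_eqVlt.
  by case: eqP => [->|//]; rewrite Zk ltnn.
apply/idP/idP; rewrite !inE => -[].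
  by move=> Aw s; move: (s); rewrite /stopped /= discovery_of_prefix => /eq0 <-.
by move=> Aw s; move: (s); rewrite /stopped /= discovery_prefix => /eq0 ->.
Qed.

Let le_running k A : measurable A ->
  (P' [set w | (A `&` ~` stopped k) (prefix k.+1 (Y w))] <=
   P [set w | (A `&` ~` stopped k) (prefix k.+1 (X w))])%E.
Proof.
move=> mA.
pose phi x : \bar R := (\1_A x / discovery k.+1 x)%:E.
have mphi : measurable_fun setT phi.
  apply/measurable_EFinP; apply: measurable_funM; first exact: measurable_indic.
  by apply: (measurableT_comp (@measurable_invr R)); exact: measurable_discovery.
have phi0 x : (0 <= phi x)%E by rewrite lee_fin divr_ge0// discovery_ge0.
have main e (V : measurableType e) (M : probability V R) (Z : V -> realseq R) : measurable_fun setT Z ->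
    M [set w | (A `&` ~` stopped k) (prefix k.+1 (Z w))] =
    (\int[M]_w (phi (prefix k.+1 (Z w)) * (discovery k.+1 (Z w))%:E))%E.
  move=> mZ; have mr := measurableI _ _ mA (measurableC (mstopped k)).
  have mr' := mpre (mprefix k.+1 mZ) mr.
  rewrite -[X in M X]setIT -integral_indic//; apply: eq_integral => w _.
  rewrite -EFinM; congr EFin; rewrite discovery_of_prefix [LHS]indicE.
  have [d0|dn] := eqVneq (discovery k.+1 (Z w)) 0.
    by rewrite d0 mulr0 memNset// => -[_ /=]; rewrite /stopped /= discovery_of_prefix.
  rewrite divfK// indicE; congr (nat_of_bool _)%:R; apply/idP/idP; rewrite !inE; first by case.
  by move=> Aw; split=> //; rewrite /stopped /= discovery_of_prefix; exact/eqP.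
rewrite !main//; apply: (weighted_le (X := fun w => prefix k.+1 (Y w)) (X' := fun w => prefix k.+1 (X w))) => //.
- exact: mprefix.
- exact: (measurableT_comp (measurable_discovery k.+1) mY).
- by move=> w; exact: discovery_ge0.
- exact: mprefix.
- exact: (measurableT_comp (measurable_discovery k.+1) mX).
- by move=> w; exact: discovery_ge0.
- by move=> B mB; exact: le_discovery.
Qed.

(* By induction on k: where the next term can still be discovered its law is
   compared after division by the weight, elsewhere it is zero. An inequality
   that holds for an event and its complement is an equality. *)
Let law_prefix k A : measurable A ->
  P [set w | A (prefix k (X w))] = P' [set w | A (prefix k (Y w))].
Proof.
elim: k A => [|k IH] A mA.
  have p0 x : prefix 0 x = fun=> 0 by [].
  have [A0|nA0] := pselect (A (fun=> 0)).
    rewrite (_ : [set w | _] = setT) ?probability_setT; last by apply/seteqP; split.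
    by rewrite (_ : [set w | _] = setT) ?probability_setT//; apply/seteqP; split.
  rewrite (_ : [set w | _] = set0) ?measure0; last by apply/seteqP; split.
  by rewrite (_ : [set w | _] = set0) ?measure0//; apply/seteqP; split.
have le B : measurable B -> (P' [set w | B (prefix k.+1 (Y w))] <= P [set w | B (prefix k.+1 (X w))])%E.
  move=> mB.
  have dec e (V : measurableType e) (M : probability V R) (Z : V -> realseq R) : measurable_fun setT Z ->
      M [set w | B (prefix k.+1 (Z w))] = (M [set w | (B `&` stopped k) (prefix k.+1 (Z w))] +
        M [set w | (B `&` ~` stopped k) (prefix k.+1 (Z w))])%E.
    move=> mZ; have mp := mprefix k.+1 mZ; rewrite -measureU.
    - congr (M _); apply/seteqP; split=> w /=; last by case=> -[].
      by move=> Bw; have [s|s] := pselect (stopped k (prefix k.+1 (Z w))); [left|right].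
    - exact: (mpre mp (measurableI _ _ mB (mstopped k))).
    - exact: (mpre mp (measurableI _ _ mB (measurableC (mstopped k)))).
    - by apply/seteqP; split=> // w /= [[_ s] [_ ns]].
  rewrite !dec// (law_stopped mX)// (law_stopped mY)// IH; last exact: measurableI.
  by rewrite leeD2l// le_running.
apply/eqP; rewrite eq_le le// andbT.
have := le _ (measurableC mA).
have compl e (V : measurableType e) (M : probability V R) (Z : V -> realseq R) : measurable_fun setT Z ->
    M [set w | (~` A) (prefix k.+1 (Z w))] = (1 - M [set w | A (prefix k.+1 (Z w))])%E.
  move=> mZ; have mp := mpre (mprefix k.+1 mZ) mA.
  by rewrite -probability_setC.
rewrite !compl//.
have fX := fin_num_measure P _ (mpre (mprefix k.+1 mX) mA).
have fY := fin_num_measure P' _ (mpre (mprefix k.+1 mY) mA).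
by rewrite -(fineK fX) -(fineK fY) -!EFinB !lee_fin; lra.
Qed.

(** The weighted laws of the first terms determine the law of a sequence that
    stops when its mass is exhausted; inequalities between them suffice, since
    both laws have total mass one. *)
Lemma discovery_law_ext : eq_law P X P' Y.
Proof.
move=> A mA; rewrite -(lawE P mX) -(lawE P' mY).
by apply: prefix_law_ext => // k B mB; rewrite !lawE; exact: law_prefix.
Qed.

End SequenceLaw.

(** * Size-biased permutations and order of appearance *)

Section SizeBiased.
Context (R : realType).
Implicit Types (mu : probability npart R) (pi : npart) (k l n : nat).

Lemma sum_app_le1 pi n : \sum_(i < n) app R pi i <= 1.
Proof.
have e : (\sum_(0 <= j <oo) (app R pi j)%:E = \sum_(0 <= j <oo) (starfreq R pi j)%:E)%E.
  rewrite (tuple_sum_sum (g := EFin)); last by move=> j; rewrite lee_fin app_ge0.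
  rewrite (tuple_sum_sum (g := EFin)); last by move=> j; rewrite lee_fin starfreq_ge0.
  apply: tuple_sum_rearr; [exact: app_ge0|exact: starfreq_ge0| |].
  - by move=> z [|//] _ ->.
  - by apply: rearr_sym; exact: rearr_starfreq_app.
rewrite -lee_fin -sumEFin -(big_mkord xpredT (fun i => (app R pi i)%:E)).
apply: le_trans (nneseries_lim_ge _ _) _; first by move=> j _ _; rewrite lee_fin app_ge0.
rewrite e; apply: lime_le; first by apply: is_cvg_nneseries => j _ _; rewrite lee_fin starfreq_ge0.
by apply: nearW => m; rewrite sumEFin lee_fin big_mkord sum_starfreq_le1.
Qed.

Lemma discovery_eq0 k (x : realseq R) : discovery k x = 0 -> exists2 l, (l < k)%N & 1 <= mass l x.
Proof.
move=> /eqP; rewrite prodf_seq_eq0 => /hasP[l _ /=] /eqP m; exists l => //.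
by rewrite -subr_le0; apply/max_idPl.
Qed.

Lemma app_stop k pi : discovery k.+1 (app R pi) = 0 -> app R pi k = 0.
Proof.
move=> /discovery_eq0[l]; rewrite ltnS => lk ml; apply/eqP; rewrite eq_le app_ge0 andbT.
have := sum_app_le1 pi k.+1; rewrite big_ord_recr /=.
suff : mass l (app R pi) <= \sum_(i < k) app R pi i by lra.
rewrite -(subnKC lk) big_split_ord /= lerDl; apply: sumr_ge0 => i _; exact: app_ge0.
Qed.

Section Perm.
Context (d : measure_display) (T : measurableType d) (P : probability T R)
  (Q : {RV P >-> realseq R}) (S : T -> realseq R).
Hypothesis sb : size_biased_perm Q S.

Lemma size_biased_stop k : {ae P, forall w, discovery k.+1 (S w) = 0 -> S w k = 0}.
Proof.
have [proper [J [_ SE]]] := sb; apply: filterS proper => w [q0 _] /discovery_eq0[l].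
rewrite ltnS => lk; rewrite SE; case: ifP => // mk.
have lt i : (i <= k)%N -> drawn_mass (Q w) (fun l => J l w) i < 1.
  move=> ik; apply: le_lt_trans mk; rewrite /drawn_mass -(subnKC ik) big_split_ord /= lerDl.
  by apply: sumr_ge0.
suff -> : mass l (S w) = drawn_mass (Q w) (fun l => J l w) l by rewrite leNgt lt.
by apply: eq_bigr => i _; rewrite SE lt// ltnW// (leq_trans (ltn_ord i)).
Qed.

(** The discovery identities of a size-biased permutation and of the frequencies
    in order of appearance have the same right-hand side, which depends on the
    multiset of frequencies only. *)
Lemma size_biased_app mu : pexch mu ->
  (forall n A, measurable A -> mu (tail n @^-1` A) = mu A) ->
  {ae mu, forall pi, powsum 1 (starfreq R pi) = 1} ->
  (forall k B, measurable B -> (\int[P]_w tuple_sum k (drawn B k) (Q w) =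
     \int[mu]_pi tuple_sum k (drawn B k) (app R pi))%E) ->
  eq_law P S mu (@app R).
Proof.
move=> pe stat proper e; have [properQ [J [draws SE]]] := sb.
apply: discovery_law_ext.
- exact: (measurable_size_biased SE).
- exact: measurable_app.
- move=> k B mB; apply: le_trans (discovery_le pe stat proper k mB) _.
  rewrite -e//; exact: (discovery_ge draws properQ SE k mB).
- exact: size_biased_stop.
- by move=> k; apply: aeW => pi; exact: app_stop.
Qed.

End Perm.

Section Transfer.
Context (mu mu' : probability npart R).
Hypotheses (pe : pexch mu) (ex' : exchangeable mu' lawid).
Hypothesis ranked_eq : eq_law mu' (@ranked_freq R) mu (@ranked_freq R).

Let full : set npart := [set pi | powsum 1 (starfreq R pi) = 1].

Lemma measurable_full : measurable full.
Proof.
have m : measurable_fun setT (fun pi : npart => powsum 1 (starfreq R pi)).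
  apply: (@measurable_fun_cvg _ _ _ _ (fun n pi => \sum_(j < n) starfreq R pi j ^+ 1)) => [n|pi _].
    have [m _] : bmf (fun pi : npart => \sum_(j < n) starfreq R pi j ^+ 1).
      by apply: bmf_sum => j _; apply: bmf_exp; exact: bmf_starfreq.
    exact: m.
  by apply: cvg_powsum; [|exact: starfreq_ge0|exact: sum_starfreq_le1].
by rewrite (_ : full = (fun pi : npart => powsum 1 (starfreq R pi)) @^-1` [set 1])//
   -[X in measurable X]setTI; apply: m => //; exact: measurable_set1.
Qed.

(** Whether the frequencies add up to one can be read off the ranked ones. *)
Lemma full_transfer : mu (~` full) = 0%E -> {ae mu', forall pi, powsum 1 (starfreq R pi) = 1}.
Proof.
move=> h; exists (~` full); split; last by move=> pi.
  by apply: measurableC; exact: measurable_full.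
pose A : set (realseq R) := [set x | powsum 1 (fun j => `|x j|) <> 1].
have mA : measurable A.
  rewrite (_ : A = (fun x : realseq R => powsum 1 (fun j => `|x j|)) @^-1` (~` [set 1]))//.
  rewrite -[X in measurable X]setTI; apply: measurable_powsum_norm => //.
  by apply: measurableC; exact: measurable_set1.
have eA : @ranked_freq R @^-1` A = ~` full.
  apply/seteqP; split=> pi; rewrite /A /full /= (_ : (fun j => _) = ranked_freq R pi) ?powsum_ranked//;
    by apply/funext => j; rewrite ger0_norm// ranked_ge0.
by have := ranked_eq mA; rewrite eA h.
Qed.

Lemma size_biased_law d (T : measurableType d) (P : probability T R)
    (Q : {RV P >-> realseq R}) (S : T -> realseq R) (Z : npart -> realseq R) :
  mu (~` full) = 0%E -> size_biased_perm Q S ->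
  (forall pi, rearr (starfreq R pi) (Z pi)) -> (forall pi j, 0 <= Z pi j) ->
  eq_law P Q mu Z -> eq_law P S mu' (@app R).
Proof.
move=> h sb rZ Z0 eQ; apply: (size_biased_app sb).
- exact: exch_pexch.
- by move=> n A mA; exact: (exch_stationary ex').
- exact: full_transfer.
move=> k B mB.
have mt := @measurable_tuple_sum R k _ (@drawn_ge0 R B k) (@measurable_drawn R B k mB).
have t0 (x : realseq R) : (0 <= tuple_sum k (drawn B k) x)%E.
  by apply: esum_ge0 => s _; exact: drawn_ge0.
have rE pi (x : realseq R) : rearr (starfreq R pi) x -> (forall j, 0 <= x j) ->
    tuple_sum k (drawn B k) x = tuple_sum k (drawn B k) (app R pi).
  move=> rx x0; apply: tuple_sum_rearr => //; first exact: app_ge0.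
    by move=> z l; exact: drawn_eq0.
  by apply: (@rearr_trans R (starfreq R pi) x); [exact: rearr_sym|exact: rearr_starfreq_app].
have mapp : measurable_fun setT (fun pi : npart => tuple_sum k (drawn B k) (app R pi)).
  exact: (@measurableT_comp _ _ _ _ _ _ (fun x : realseq R => tuple_sum k (drawn B k) x) _ (@app R) mt (@measurable_app R)).
have mZ (Y : npart -> realseq R) : (forall pi, rearr (starfreq R pi) (Y pi)) -> (forall pi j, 0 <= Y pi j) ->
    measurable_fun setT ((fun x : realseq R => tuple_sum k (drawn B k) x) \o Y).
  by move=> rY Y0; rewrite (_ : _ \o _ = fun pi => tuple_sum k (drawn B k) (app R pi))//; apply/funext => pi; exact: rE.
have rk pi : rearr (starfreq R pi) (ranked_freq R pi) by exact: rearr_ranked.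
have rk0 pi j : 0 <= ranked_freq R pi j := ranked_ge0 R pi j.
transitivity (\int[mu]_pi tuple_sum k (drawn B k) (Z pi))%E.
  apply: (eq_law_integral eQ) => //; last exact: mZ.
  by apply: (measurableT_comp mt); exact: measurable_funPT.
transitivity (\int[mu]_pi tuple_sum k (drawn B k) (ranked_freq R pi))%E.
  by apply: eq_integral => pi _; rewrite (rE pi)// (rE pi (ranked_freq R pi)).
transitivity (\int[mu']_pi tuple_sum k (drawn B k) (ranked_freq R pi))%E.
  by symmetry; apply: (eq_law_integral ranked_eq) => //; exact: mZ.
by apply: eq_integral => pi _; rewrite (rE pi).
Qed.

End Transfer.
End SizeBiased.

(** * Convergence to the exchangeable partition, and stationarity *)

Theorem theorem1p1 (R : realType) (d : measure_display) (T : measurableType d)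
    (P : probability T R) (Pi : {RV P >-> npart})
    (Pi_pexch : partially_exchangeable P Pi) :
  (* Pit is the exchangeable random partition with the ranked frequencies of Pi. *)
  (forall (d' : measure_display) (T' : measurableType d')
      (P' : probability T' R) (Pit : {RV P' >-> npart}),
    exchangeable P' Pit ->
    eq_law P' (@ranked_freq R \o Pit) P (@ranked_freq R \o Pi) ->
    [/\ forall c : seq nat, composition c ->
          (fun n : nat => peppf P (tail n \o Pi) c) @ \oo --> peppf P' Pit c,
        fdd_weak_cvg P (fun n => @appearance_freq R n \o Pi)
          P' (@appearance_freq R 0 \o Pit)
      & {ae P, forall w, proper_seq (ranked_freq R (Pi w))} ->
        forall (d'' : measure_display) (T'' : measurableType d'')
          (P'' : probability T'' R) (Q : {RV P'' >-> realseq R})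
          (S : T'' -> realseq R),
          size_biased_perm Q S ->
          (eq_law P'' Q P (@ranked_freq R \o Pi) ->
             eq_law P'' S P' (@appearance_freq R 0 \o Pit)) /\
          (forall n : nat,
             eq_law P'' Q P (@appearance_freq R n \o Pi) ->
             eq_law P'' S P' (@appearance_freq R 0 \o Pit))])
  /\
  [<-> exchangeable P Pi;
       eq_law P (tail 1 \o Pi) P Pi;
       forall n : nat, (1 <= n)%N -> eq_law P (tail n \o Pi) P Pi;
       eq_on_compositions (peppf P (tail 1 \o Pi)) (peppf P Pi);
       forall n : nat, (1 <= n)%N ->
         eq_on_compositions (peppf P (tail n \o Pi)) (peppf P Pi)].
Proof.
have mPi : measurable_fun setT Pi by exact: measurable_funPT.
pose mu := law P mPi.
have pe : pexch mu by exact/pexch_of_law.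
have mt n : measurable_fun setT (tail n \o Pi) := measurableT_comp (measurable_tail n) mPi.
split.
  move=> d' T' P' Pit ex' ranked_eq.
  have mPit : measurable_fun setT Pit by exact: measurable_funPT.
  pose mu' := law P' mPit.
  have exm : exchangeable mu' lawid by exact: ex'.
  have rk : eq_law mu' (@ranked_freq R) mu (@ranked_freq R) by move=> A mA; rewrite (lawE P' mPit) (lawE P mPi); exact: (ranked_eq A mA).
  have pe' : partially_exchangeable P' Pit by apply/(pexch_of_law P' mPit); exact: exch_pexch.
  split.
  - move=> c cc; have /andP[_ c0] := cc.
    have [m [f [gf <-]]] := growing_of_sizes c0.
    rewrite (peppf_restriction mPit)//.
    rewrite (_ : (fun n => _) = fun n => \int[law mu (measurable_tail n)]_pi
        (restriction m pi == restriction m (kernel f))%:R); first exact: restriction_tail_cvg.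
    apply/funext => n; rewrite (peppf_restriction (mt n))//; last exact: law_pexch_tail.
  - move=> k f cf [M fM].
    pose F pi := f (\row_(j < k) app R pi j).
    have bF : bmf F.
      split; last by exists M => pi; exact: fM.
      apply: (@measurable_row R _ _ k f (fun pi : npart => app R pi)); [exact: cf| |].
      + by move=> j; have [m _] := bmf_app R j.
      + by move=> w j; exact: app_ge0.
    have e n : (\int[P]_w (f (\row_(j < k) (@appearance_freq R n \o Pi) w j)%R)%:E =
        (\int[mu]_pi F (tail n pi))%:E)%E.
      have b := bmf_comp bF (measurable_tail n).
      rewrite (Ex_law P mPi b) EFin_Ex; last exact: (bmf_comp b mPi).
      by apply: eq_integral => w _; rewrite /F /= appearance_tail.
    rewrite (_ : (\int[P']_w _)%E = (\int[mu']_pi F pi)%:E); last first.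
      by rewrite (Ex_law P' mPit bF) EFin_Ex//; exact: (bmf_comp bF mPit).
    rewrite (funext e); apply: cvg_EFin; first exact: nearW.
    exact: (Ex_app_tail_cvg cf fM pe exm rk).
  - move=> proper d'' T'' P'' Q S sb.
    have full0 : mu (~` [set pi | powsum 1 (starfreq R pi) = 1]) = 0%E.
      have mf := measurableC (measurable_full R).
      rewrite /mu lawE; apply/negligibleP.
        by rewrite -[X in measurable X]setTI; exact: (mPi measurableT _ mf).
      case: proper => N [mN PN sub]; exists N; split=> // w nf; apply: sub => -[r0 r1]; apply: nf.
      rewrite /= -(powsum_ranked R (Pi w) (ltn0Sn 0)) /powsum.
      by under eq_eseriesr do rewrite expr1; rewrite r1.
    have concl (Z : npart -> realseq R) : (forall pi, rearr (starfreq R pi) (Z pi)) ->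
        (forall pi j, 0 <= Z pi j) -> eq_law P'' Q P (Z \o Pi) ->
        eq_law P'' S P' (@appearance_freq R 0 \o Pit).
      by move=> rZ Z0 eQ; exact: (size_biased_law exm rk full0 sb rZ Z0 eQ).
    split=> [|n].
      by apply: concl => [pi|pi j]; [exact: rearr_ranked|exact: ranked_ge0].
    apply: concl => [pi|pi j]; rewrite appearance_tail; last exact: app_ge0.
    apply: (@rearr_trans R (starfreq R (tail n pi))); last exact: rearr_starfreq_app.
    by apply: rearr_sym; exact: rearr_starfreq_tail.
have one : eq_law P (tail 1 \o Pi) P Pi -> forall n, eq_law P (tail n \o Pi) P Pi.
  move=> st n A mA; apply: (@stationary_tail R mu n _ A mA).
  exact: st.
tfae.
- by move=> ex A mA; apply: (@exch_tail1 R mu A).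
- by move=> st n _; exact: one.
- by move=> st c _; rewrite (eq_law_peppf (st 1%N (leqnn 1))).
- move=> e n _ c _; rewrite (eq_law_peppf (one _ n))//.
  by apply: peppf_law => //; exact: law_pexch_tail.
- move=> e; apply: (@stationary_exch R mu pe) => n A mA; apply: one => //.
  by apply: peppf_law => //; [exact: law_pexch_tail|exact: e].
Qed.
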